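(* Let $n,N,M\ge1$ be integers with $M\ge N$, let $A_0,A_1,\ldots,A_n\in M_N(\mathbb C)$ be Hermitian, and let $\eta(X)=\sum_{i=1}^n A_iXA_i$ for $X\in M_N(\mathbb C)$. Let $G_1,\ldots,G_n$ be independent $M\times M$ GUE matrices and put $$H_M=A_0\otimes I_M+\frac1{\sqrt M}\sum_{i=1}^n A_i\otimes G_i .$$ Suppose that there are positive semidefinite matrices $\widetilde A_1,\ldots,\widetilde A_r\in M_N(\mathbb C)$ such that $$\eta(X)=\sum_{j=1}^r\widetilde A_jX\widetilde A_j\qquad\text{for every }X\in M_N(\mathbb C).$$ Then $$\mathbb E\lambda_{\max}(H_M)\le\rho_++6\sqrt{\frac{rN}{M}}\,\|\eta(I_N)\|_{\mathrm{op}}^{1/2},$$ $$\mathbb E\lambda_{\min}(H_M)\ge\rho_--6\sqrt{\frac{rN}{M}}\,\|\eta(I_N)\|_{\mathrm{op}}^{1/2},$$ and $$\mathbb E\|H_M\|_{\mathrm{op}}\le\rho_*+9\sqrt{\frac{rN}{M}}\,\|\eta(I_N)\|_{\mathrm{op}}^{1/2}.$$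
   Context: GUE normalization: $G_i$ is a random Hermitian $M\times M$ matrix with independent centered Gaussian entries on and above the diagonal; diagonal entries are real standard Gaussians $N(0,1)$, and the real and imaginary parts of the off-diagonal entries are independent $N(0,1/2)$. Here $\|\cdot\|_{\mathrm{op}}$ is the operator norm, $Z\succ0$ (resp. $Z\prec 0$) means Hermitian positive (resp. negative) definite, and $\lambda_{\max},\lambda_{\min}$ denote the largest and smallest eigenvalues. The quantities $\rho_\pm,\rho_*$ are those of the original family $A_0,\ldots,A_n$: $$\rho_+=\inf_{Z\succ0}\lambda_{\max}\Bigl(A_0+Z+\sum_{i=1}^n A_iZ^{-1}A_i\Bigr),\qquad \rho_-=\sup_{Z\prec0}\lambda_{\min}\Bigl(A_0+Z+\sum_{i=1}^n A_iZ^{-1}A_i\Bigr),$$ with $Z$ ranging over $M_N(\mathbb C)$, and $\rho_*=\max\{\rho_+,-\rho_-\}$. *)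

(* Defs.v *)
From HB Require Import structures.
From mathcomp Require Import all_boot all_order all_algebra.
From mathcomp Require Import all_classical all_reals all_analysis.
From mathcomp.real_closed Require Export complex mxtens.

Set Implicit Arguments.
Unset Strict Implicit.
Unset Printing Implicit Defensive.

Import Order.TTheory GRing.Theory Num.Theory.
Import numFieldNormedType.Exports.

Local Open Scope classical_set_scope.
Local Open Scope ring_scope.
Local Open Scope complex_scope.
Local Open Scope sesquilinear_scope.

Notation "A *t B" := (tensmx A B)
  (at level 40, left associativity, format "A  *t  B") : ring_scope.

Section matrices.
Variable R : realType.
Local Notation C := R[i].

Definition quad_form N (Z : 'M[C]_N) (v : 'cV[C]_N) : C :=
  (v ^t* *m Z *m v) 0 0.

(* In the order on [R[i]], [0 <= z] means that [z] is a nonnegative real. *)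
Definition posdefmx N (Z : 'M[C]_N) : Prop :=
  Z \is hermsymmx /\ forall v : 'cV[C]_N, v != 0 -> 0 < quad_form Z v.

Definition negdefmx N (Z : 'M[C]_N) : Prop :=
  Z \is hermsymmx /\ forall v : 'cV[C]_N, v != 0 -> quad_form Z v < 0.

Definition possemidefmx N (Z : 'M[C]_N) : Prop :=
  Z \is hermsymmx /\ forall v : 'cV[C]_N, 0 <= quad_form Z v.

(* A Hermitian matrix of positive size has a finite nonempty set of eigenvalues,
   all real, so that the supremum and the infimum below are attained. *)
Definition lambda_max N (A : 'M[C]_N) : R :=
  sup [set x : R | eigenvalue A x%:C].

Definition lambda_min N (A : 'M[C]_N) : R :=
  inf [set x : R | eigenvalue A x%:C].

Definition euclid_norm N (v : 'cV[C]_N) : R :=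
  Num.sqrt (\sum_i ComplexField.Normc.normc (v i 0) ^+ 2).

Definition opnorm N (A : 'M[C]_N) : R :=
  sup [set euclid_norm (A *m v) | v in [set v : 'cV[C]_N | euclid_norm v <= 1]].

Definition eta n N (A : 'I_n -> 'M[C]_N) (X : 'M[C]_N) : 'M[C]_N :=
  \sum_(i < n) A i *m X *m A i.

Definition rho_plus n N (A0 : 'M[C]_N) (A : 'I_n -> 'M[C]_N) : R :=
  inf [set lambda_max (A0 + Z + \sum_(i < n) A i *m invmx Z *m A i)
      | Z in [set Z : 'M[C]_N | posdefmx Z]].

Definition rho_minus n N (A0 : 'M[C]_N) (A : 'I_n -> 'M[C]_N) : R :=
  sup [set lambda_min (A0 + Z + \sum_(i < n) A i *m invmx Z *m A i)
      | Z in [set Z : 'M[C]_N | negdefmx Z]].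

Definition rho_star n N (A0 : 'M[C]_N) (A : 'I_n -> 'M[C]_N) : R :=
  Num.max (rho_plus A0 A) (- rho_minus A0 A).

(* H_M for one realization G_1, ..., G_n of the GUE matrices. *)
Definition gaussian_model n N M (A0 : 'M[C]_N) (A : 'I_n -> 'M[C]_N)
    (G : 'I_n -> 'M[C]_M) : 'M[C]_(N * M) :=
  A0 *t (1%:M : 'M[C]_M) +
  ((Num.sqrt (M%:R : R))^-1)%:C *: \sum_(i < n) A i *t G i.

End matrices.

Section probability.
Context d (T : measurableType d) (R : realType) (P : probability T R).
Local Notation C := R[i].

Definition independent (I : finType) (F : I -> set (set T)) : Prop :=
  forall (J : {set I}) (E : I -> set T), (forall i, F i (E i)) ->
    P (\bigcap_(i in [set` J]) E i) = (\prod_(i in J) P (E i))%E.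

Definition sigma_generated (K : Type) (X : K -> T -> R) : set (set T) :=
  <<s [set X k @^-1` B | k in [set: K] & B in @measurable _ R] >>.

(* As in the library's [normal_prob], [s] is the standard deviation. *)
Definition gaussian_rv (m s : R) (X : T -> R) : Prop :=
  measurable_fun [set: T] X /\
  forall B : set R, measurable B -> P (X @^-1` B) = normal_prob m s B.

(* The M^2 real coordinates of a Hermitian matrix: the pair (j, k) stands for
   Re (G j k) if j <= k, and for Im (G k j) if k < j. *)
Definition herm_coord M (G : T -> 'M[C]_M) (jk : 'I_M * 'I_M) (w : T) : R :=
  if (jk.1 <= jk.2)%N then complex.Re (G w jk.1 jk.2)
  else complex.Im (G w jk.2 jk.1).

Definition is_GUE M (G : T -> 'M[C]_M) : Prop :=
  [/\ forall w, G w \is hermsymmx,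
      forall j, gaussian_rv 0 1 (herm_coord G (j, j)),
      forall j k, j != k ->
        gaussian_rv 0 (Num.sqrt 2^-1) (herm_coord G (j, k)) &
      independent (fun jk => sigma_generated (fun _ : unit => herm_coord G jk))].

(* The sigma-algebra generated by the real and imaginary parts of the entries. *)
Definition sigma_mx M (G : T -> 'M[C]_M) : set (set T) :=
  sigma_generated (fun (b_jk : bool * ('I_M * 'I_M)) w =>
    let z := G w b_jk.2.1 b_jk.2.2 in
    if b_jk.1 then complex.Re z else complex.Im z).

Definition independent_GUE n M (G : 'I_n -> T -> 'M[C]_M) : Prop :=
  (forall i, is_GUE (G i)) /\ independent (fun i => sigma_mx (G i)).

End probability.

(* Main.v *)
(* The proof is a Gaussian comparison. For V in the Frobenius unit ball of N x M
   matrices, the increments of V |-> <V, (H_M - A0 (x) I) V> have variance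
   (1/M) sum_j |V^* At_j V - W^* At_j W|^2, because the polarized sum depends on
   the A_i only through eta. Write At_j = D_j^* D_j and let T_j be a square factor
   of D_j V V^* D_j^*. The matrices L_j(V) = T_j D_j V satisfy
   |V^* At_j V - W^* At_j W|^2 <= 2 |L_j(V) - L_j(W)|^2, so the Sudakov-Fernique
   inequality compares the first process with sqrt(2/M) sum_j <Gamma_j, L_j(V)>,
   where the Gamma_j are Gaussian N x M matrices. Given Z > 0, that process plus
   <V, A0 V> is at most lambda_max (A0 + Z + eta (Z^-1)) |V|^2 by AM-GM, up to the
   excess over sqrt M of the norm of the M x 2rN real Gaussian matrix built from
   Gamma; by Chevet's inequality this excess has mean at most
   sqrt (2rN) + sqrt 2 / 2. The bound for the smallest eigenvalue follows by
   changing A0, A_i into - A0, - A_i, and the norm is controlled by both.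
   Expectations are taken over finite nets, where Gaussian expectations of
   Lipschitz functions are iterated one-dimensional integrals. *)

From HB Require Import structures.
Require Import Defs.
From mathcomp Require Import all_boot all_order all_algebra.
From mathcomp Require Import all_classical all_reals all_analysis.
From mathcomp Require Import measurable_realfun.
From mathcomp Require Import ring lra.

Set Implicit Arguments.
Unset Strict Implicit.
Unset Printing Implicit Defensive.
Import Order.TTheory GRing.Theory Num.Theory.
Import numFieldNormedType.Exports.
Local Open Scope classical_set_scope.
Local Open Scope ring_scope.

(** * One-dimensional Gaussian integrals *)

(** Positivity of [At_j] is what allows [V^* At_j V], of size M x M, to be written y^* y with y =
    D_j V. A process linear in these matrices would require M x M Gaussian matrices, too large for
    an error of order sqrt (rN / M); the substitute T_j y has only N rows. Its price is a factor 2
    in the squared increments. The part sqrt M of the norm of the Gaussian matrix then produces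
    exactly lambda_max (A0 + Z + eta (Z^-1)), and only the excess enters the error.

    Constants: as rN >= 1, 2 (sqrt 2 + sqrt 2 / 2 + 1/8) <= 9/2 bounds the cost of one extreme
    eigenvalue, where 1/8 pays for a net. The norm pays twice, hence 9.

    Gaussian averages are never differentiated along an interpolation. Each Gaussian variable is
    split into many small independent ones, and the two processes are exchanged one small step at a
    time. Norms are majorized by polynomials, so that moments up to order four suffice. *)

Section one_dim.
Context {R : realType}.
Local Notation mu := (@lebesgue_measure R).

(** The Radon-Nikodym derivative supplied by the change of variables is known only through its
    integrals. Having the same integrals as [normal_pdf] on measurable sets, it equals it almost
    everywhere. *)
Lemma ge0_integral_normal_prob (m s : R) (f : R -> R) :
  measurable_fun setT f -> (forall x, 0 <= f x) ->
  (\int[normal_prob m s]_x (f x)%:E =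
   \int[mu]_x (f x * normal_pdf m s x)%:E)%E.
Proof.
move=> mf f0.
have dom := normal_prob_dominates m s.
rewrite -(Radon_Nikodym_SigmaFinite.change_of_variables dom)//; last first.
  by apply/measurable_EFinP.
apply: ae_eq_integral => //.
- apply: emeasurable_funM; first exact/measurable_EFinP.
  exact: measurable_int (Radon_Nikodym_SigmaFinite.f_integrable _).
- apply/measurable_EFinP/measurable_funM => //; exact: measurable_normal_pdf.
under [X in ae_eq _ _ _ X]eq_fun do rewrite EFinM.
apply: ae_eqe_mul2l; apply: integral_ae_eq => //.
- exact: Radon_Nikodym_SigmaFinite.f_integrable.
- by apply/measurable_EFinP; exact: measurable_normal_pdf.
- by move=> A _ mA; rewrite -Radon_Nikodym_SigmaFinite.f_integral.
Qed.

Lemma integral_affine (a b : R) (f : R -> R) : 0 < a -> continuous f ->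
  (forall x, 0 <= f x) ->
  (\int[mu]_x (f x)%:E = \int[mu]_x (f (a * x + b) * a)%:E)%E.
Proof.
move=> a0 cf f0.
pose F (x : R) : R := a * x + b.
have dF (x : R) : is_derive x 1 F a.
  rewrite /F; apply: is_derive_eq.
  by rewrite addr0 [_ *: _]mulr1.
have F'E : F^`()%classic = cst a.
  by apply/funext => x; rewrite derive1E; apply: derive_val.
rewrite (@increasing_ge0_integration_by_substitutionT _ F)//.
- by rewrite F'E.
- by move=> x y xy; rewrite /F ltrD2r ltr_pM2l.
- by rewrite F'E => x; exact: cvg_cst.
- by rewrite F'E; exact: is_cvg_cst.
- by rewrite F'E; exact: is_cvg_cst.
- apply: (cvg_comp _ _ _ (cvg_addrr_Ny b)).
  exact: gt0_cvgMrNy.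
- apply: (cvg_comp _ _ _ (cvg_addrr b)).
  exact: gt0_cvgMry.
Qed.

Local Notation phi := (normal_pdf (0 : R) 1).

Lemma normal_pdf01E (x : R) : phi x = normal_peak 1 * expR (- (x ^+ 2) / 2).
Proof. by rewrite normal_pdfE ?oner_neq0// /normal_fun subr0 expr1n. Qed.

Lemma continuous_normal_pdf01 : continuous phi.
Proof. by apply: continuous_normal_pdf; exact: oner_neq0. Qed.

Lemma ge0_integral_normal_prob_scale (s : R) (f : R -> R) : 0 < s ->
  continuous f -> (forall x, 0 <= f x) ->
  (\int[normal_prob 0 s]_x (f x)%:E = \int[normal_prob 0 1]_x (f (s * x))%:E)%E.
Proof.
move=> s0 cf f0.
have mf := continuous_measurable_fun cf.
have cfs : continuous (fun x : R => f (s * x)).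
  by move=> x; apply: continuous_comp; [exact: mulrl_continuous|exact: cf].
have mfs := continuous_measurable_fun cfs.
rewrite (ge0_integral_normal_prob 0 s mf f0).
rewrite (ge0_integral_normal_prob 0 1 mfs (fun x => f0 (s * x))).
rewrite (@integral_affine s 0)//; last 2 first.
- move=> x; apply: continuousM; first exact: cf.
  by apply: continuous_normal_pdf; rewrite gt_eqF.
- by move=> x; rewrite mulr_ge0// normal_pdf_ge0.
apply: eq_integral => x _; rewrite addr0 -mulrA; congr (_ * _)%:E.
rewrite !normal_pdfE ?gt_eqF// /normal_peak /normal_fun !subr0 !expr1n mul1r.
rewrite mulrC -mulrnAr sqrtrM ?sqr_ge0// sqrtr_sqr gtr0_norm// invfM !mulrA divff ?gt_eqF// mul1r.
congr (_ * expR _); rewrite !mulNr; congr (- _).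
by field; rewrite gt_eqF.
Qed.

(** With q = sqrt 2 and y = q u - x, the exponents satisfy (q u - x)^2 + x^2 = u^2 + (q x - u)^2.
    After exchanging the integrals, the density of u splits off and the remaining integral in x has
    total mass 1. *)
Lemma ge0_integral_normal_stable (f : R -> R) :
  continuous f -> (forall x, 0 <= f x) ->
  (\int[normal_prob 0 1]_x \int[normal_prob 0 1]_y
     (f ((x + y) / Num.sqrt 2))%:E = \int[normal_prob 0 1]_x (f x)%:E)%E.
Proof.
move=> cf f0.
set q := Num.sqrt 2.
have q0 : 0 < q :> R by rewrite sqrtr_gt0.
have q2 : q * q = 2 :> R by rewrite -expr2 sqr_sqrtr.
have mf := continuous_measurable_fun cf.
have cphi := continuous_normal_pdf01.
have mphi := measurable_normal_pdf (0:R) 1.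
have inner x : (\int[normal_prob 0 1]_y (f ((x + y) / q))%:E =
   \int[mu]_u (f u * phi (q * u - x) * q)%:E)%E.
  have cfx : continuous (fun y : R => f ((x + y) / q)).
    move=> y; apply: continuous_comp; last exact: cf.
    by apply: continuousM; [apply: continuousD => //; exact: cvg_cst|exact: cvg_cst].
  rewrite ge0_integral_normal_prob//; last exact: continuous_measurable_fun.
  rewrite (@integral_affine q (- x))//; last 2 first.
  - by move=> y; apply: continuousM; [exact: cfx|exact: cphi].
  - by move=> y; rewrite mulr_ge0// normal_pdf_ge0.
  apply: eq_integral => u _; congr (f _ * _ * _)%:E.
  by field; rewrite gt_eqF.
under eq_integral do rewrite inner.
pose h (z : R * R) := f z.2 * phi (q * z.2 - z.1) * q.
have mh : measurable_fun setT h.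
  apply: measurable_funM => //; apply: measurable_funM.
    exact: measurableT_comp.
  apply: measurableT_comp => //.
  by apply: measurable_funB => //; exact: measurable_funM.
have h0 z : 0 <= h z.
  by rewrite /h !mulr_ge0 ?normal_pdf_ge0// ltW.
rewrite (@fubini_tonelli _ _ _ _ _ (normal_prob 0 1) mu (fun z => (h z)%:E))//; last first.
  exact/measurable_EFinP.
rewrite ge0_integral_normal_prob//.
apply: eq_integral => u _ /=; rewrite /h/=.
rewrite ge0_integral_normal_prob//; last 2 first.
- apply: measurable_funM => //; apply: measurable_funM => //.
  by apply: measurableT_comp => //; exact: measurable_funB.
- by move=> x; rewrite !mulr_ge0 ?normal_pdf_ge0// ltW.
transitivity (\int[mu]_x ((f u * phi u)%:E * (phi (q * x - u) * q)%:E))%E.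
  apply: eq_integral => x _; rewrite -EFinM; congr EFin.
  rewrite !normal_pdf01E.
  have E1 : expR (- (q * u - x) ^+ 2 / 2) * expR (- x ^+ 2 / 2) =
     expR (- u ^+ 2 / 2) * expR (- (q * x - u) ^+ 2 / 2).
    rewrite -!expRD; congr expR; rewrite !sqrrB !exprMn expr2 q2.
    by lra.
  transitivity (f u * normal_peak 1 * normal_peak 1 * q * (expR (- (q * u - x) ^+ 2 / 2) * expR (- x ^+ 2 / 2))); first by ring.
  by rewrite E1; ring.
rewrite ge0_integralZl//; last 3 first.
- apply/measurable_EFinP; apply: measurable_funM => //.
  apply: measurableT_comp => //.
  by apply: measurable_funB => //; exact: measurable_funM.
- by move=> x _; rewrite lee_fin mulr_ge0 ?normal_pdf_ge0// ltW.
- by rewrite lee_fin mulr_ge0 ?normal_pdf_ge0.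
rewrite -(@integral_affine q (- u))//; last by move=> x; exact: normal_pdf_ge0.
by rewrite integral_normal_pdf mule1.
Qed.

Local Notation itvn := (fun n : nat => `[- n.+1%:R, n.+1%:R]%classic : set R).

Lemma bigcup_itvn : \bigcup_n itvn n = [set: R].
Proof.
apply/seteqP; split => // x _; exists (Num.truncn `|x|) => //=.
rewrite /= in_itv/= -ler_norml ltW//.
exact: truncnS_gt.
Qed.

Lemma nd_itvn : {homo itvn : n m / (n <= m)%N >-> (n <= m)%O}.
Proof.
apply/nondecreasing_seqP => n; rewrite subsetEset => x; rewrite /= !in_itv/= -!ler_norml.
by move=> /le_trans; apply; rewrite ler_nat.
Qed.

Lemma cvg_integral_itvn (f : R -> R) : measurable_fun setT f -> (forall x, 0 <= f x) ->
  ((\int[mu]_(x in itvn n) (f x)%:E) @[n --> \oo] --> \int[mu]_x (f x)%:E)%E.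
Proof.
move=> mf f0; rewrite -bigcup_itvn; apply: ge0_nondecreasing_set_cvg_integral => //.
- exact: nd_itvn.
- by move=> n; apply/measurable_EFinP; exact: measurable_funTS.
- by move=> n x _; rewrite lee_fin.
Qed.


Lemma is_derive_monomial_normal_pdf (k : nat) (x : R) :
  is_derive x 1 (fun x => x ^+ k.+1 * phi x)
    ((k.+1%:R * x ^+ k - x ^+ k.+2) * phi x).
Proof.
have -> : (fun x => x ^+ k.+1 * phi x) =
    (fun x : R => x ^+ k.+1 * (normal_peak 1 * expR (- (x ^+ 2) / 2))).
  by apply/funext => y; rewrite normal_pdf01E.
rewrite normal_pdf01E.
have d1 : is_derive x 1 (fun x : R => x ^+ k.+1) (k.+1%:R * x ^+ k).
  have -> : (fun x : R => x ^+ k.+1) = (id ^+ k.+1 : R -> R).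
    by apply/funext => y; rewrite exprfctE.
  apply: is_derive_eq.
  by rewrite -mulr_natl [_ *: _]mulr1.
have d2 : is_derive x 1 (fun x : R => normal_peak 1 * expR (- (x ^+ 2) / 2))
    (- x * (normal_peak 1 * expR (- (x ^+ 2) / 2))).
  apply: is_derive_eq.
  by rewrite /GRing.scale/=; field.
apply: (is_derive_eq (is_deriveM d1 d2)).
by rewrite /GRing.scale/= !exprS; ring.
Qed.

Lemma continuous_monomial_normal_pdf k : continuous (fun x : R => x ^+ k * phi x).
Proof.
move=> x; apply: (@continuousM _ _ (fun x : R => x ^+ k) phi x).
  exact: exprn_continuous.
exact: continuous_normal_pdf01.
Qed.

(** Integration of the derivative of x^(k+1) phi over a symmetric interval. As k+1 is odd, the two
    endpoint values add up instead of cancelling. Large n gives the recursion between even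
    moments. *)
Lemma normal_moment_itvn (k n : nat) : ~~ odd k ->
  (\int[mu]_(x in itvn n) (k.+1%:R * (x ^+ k * phi x))%:E =
   \int[mu]_(x in itvn n) (x ^+ k.+2 * phi x)%:E +
   (2 * (n.+1%:R ^+ k.+1 * phi n.+1%:R))%:E)%E.
Proof.
move=> ek.
pose g (x : R) : R := (k.+1%:R * x ^+ k - x ^+ k.+2) * phi x.
have cg : continuous g.
  have -> : g = (fun x => k.+1%:R * (x ^+ k * phi x) - x ^+ k.+2 * phi x).
    by apply/funext => x; rewrite /g mulrBl mulrA.
  move=> x; apply: (@continuousB _ _ _ (fun x : R => k.+1%:R * (x ^+ k * phi x))
     (fun x : R => x ^+ k.+2 * phi x) x); last exact: continuous_monomial_normal_pdf.
  apply: (@continuousM _ _ (cst k.+1%:R) (fun x : R => x ^+ k * phi x) x).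
    exact: cvg_cst.
  exact: continuous_monomial_normal_pdf.
have ab : - n.+1%:R < n.+1%:R :> R by rewrite gtrN// ltr0n.
have -> : (2 * (n.+1%:R ^+ k.+1 * phi n.+1%:R))%:E =
    (\int[mu]_(x in itvn n) (g x)%:E)%E.
  rewrite (@continuous_FTC2 _ g (fun x => x ^+ k.+1 * phi x))//.
  - rewrite -EFinB; congr EFin; rewrite exprNn -signr_odd/= ek.
    have -> : phi (- n.+1%:R) = phi n.+1%:R by rewrite !normal_pdf01E sqrrN.
    by rewrite expr1; ring.
  - exact: continuous_subspaceT.
  - have c (x : R) : {for x, continuous (fun x : R => x ^+ k.+1 * phi x)} by exact: continuous_monomial_normal_pdf.
    split; first by move=> x _; exact: (@ex_derive _ _ _ _ _ _ _ (is_derive_monomial_normal_pdf k x)).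
      by apply: cvg_at_right_filter; exact: c.
    by apply: cvg_at_left_filter; exact: c.
  - by move=> x _; rewrite derive1E (@derive_val _ _ _ _ _ _ _ (is_derive_monomial_normal_pdf k x)).
have ci (h : R -> R) : continuous h -> mu.-integrable (itvn n) (EFin \o h).
  move=> ch; apply: continuous_compact_integrable; first exact: segment_compact.
  exact: continuous_subspaceT.
rewrite -integralD_EFin//; last 2 first.
- by apply: ci; exact: continuous_monomial_normal_pdf.
- exact: ci.
by apply: eq_integral => x _ /=; rewrite /g; congr EFin; ring.
Qed.

Local Notation mom k := (\int[normal_prob (0:R) 1]_x (x ^+ k)%:E)%E.

Lemma momE k : ~~ odd k -> mom k = (\int[mu]_x (x ^+ k * phi x)%:E)%E.
Proof.
move=> ek; rewrite ge0_integral_normal_prob//.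
by move=> x; rewrite exprn_even_ge0.
Qed.

Lemma cvg_mom k : ~~ odd k ->
  ((\int[mu]_(x in itvn n) (x ^+ k * phi x)%:E) @[n --> \oo] --> mom k)%E.
Proof.
move=> ek; rewrite momE//; apply: cvg_integral_itvn.
  by apply: continuous_measurable_fun; exact: continuous_monomial_normal_pdf.
by move=> x; rewrite mulr_ge0 ?normal_pdf_ge0// exprn_even_ge0.
Qed.

Lemma bdry0 : (n.+1%:R * phi n.+1%:R) @[n --> \oo] --> (0 : R).
Proof.
have peak0 : 0 <= normal_peak (1 : R) by exact: normal_peak_ge0.
have ub : (normal_peak 1 * 2 * harmonic n) @[n --> \oo] --> (0 : R).
  rewrite -[X in _ --> X](mulr0 (normal_peak 1 * 2)).
  by apply: cvgM; [exact: cvg_cst|exact: cvg_harmonic].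
apply: (squeeze_cvgr _ (cvg_cst 0) ub); near=> n.
have n0 : 0 < n.+1%:R :> R by [].
apply/andP; split; first by rewrite mulr_ge0 ?normal_pdf_ge0.
rewrite normal_pdf01E /harmonic/= mulrCA -mulrA ler_wpM2l//.
have e1 : n.+1%:R ^+ 2 / 2 <= expR (n.+1%:R ^+ 2 / 2) :> R.
  by apply: le_trans (expR_ge1Dx _); rewrite lerDr.
rewrite mulNr expRN ler_pdivlMr// mulrAC -expr2 ler_pdivrMr ?expR_gt0//.
by rewrite mulrC -ler_pdivrMr.
Unshelve. all: end_near. Qed.

Lemma integral_normal_sqr : (\int[normal_prob 0 1]_x ((x : R) ^+ 2)%:E = 1)%E.
Proof.
have m0 : mom 0 = 1%E.
  by rewrite momE//; under eq_integral do rewrite expr0 mul1r; exact: integral_normal_pdf.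
have c0 := cvg_mom (isT : ~~ odd 0).
have c2 := cvg_mom (isT : ~~ odd 2).
rewrite m0 in c0; apply: (cvg_unique _ c2) => //.
have cb : (2 * (n.+1%:R ^+ 1 * phi n.+1%:R))%:E @[n --> \oo] --> (0 : \bar R).
  apply/fine_cvgP; split; first by near=> n.
  rewrite -[X in _ --> X](mulr0 2); apply: cvgM; first exact: cvg_cst.
  exact: bdry0.
have := cvgeB _ c0 cb; rewrite sube0 => /(_ _ isT); apply: cvg_trans.
apply: near_eq_cvg; near=> n; rewrite /=.
have := normal_moment_itvn n (isT : ~~ odd 0).
under eq_integral do rewrite mul1r.
by move=> ->; rewrite addeK.
Unshelve. all: end_near. Qed.

(** Dropping the nonnegative endpoint term of [normal_moment_itvn] gives the inequality, which is
    all that later estimates use. *)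
Lemma integral_normal_pow4 : (\int[normal_prob 0 1]_x ((x : R) ^+ 4)%:E <= 3%:E)%E.
Proof.
have c2 := cvg_mom (isT : ~~ odd 2).
have c4 := cvg_mom (isT : ~~ odd 4).
have c3 : ((3%:E * \int[mu]_(x in itvn n) (x ^+ 2 * phi x)%:E) @[n --> \oo] -->
    (3%:E : \bar R))%E.
  rewrite -[X in _ --> X]mule1 -integral_normal_sqr; exact: cvgeZl.
apply: (lee_cvg_to c4 c3); near=> n.
have := normal_moment_itvn n (isT : ~~ odd 2).
under eq_integral do rewrite EFinM.
rewrite ge0_integralZl//; last 2 first.
- apply/measurable_EFinP/measurable_funTS; apply: continuous_measurable_fun.
  exact: continuous_monomial_normal_pdf.
- by move=> x _; rewrite lee_fin mulr_ge0 ?normal_pdf_ge0// exprn_even_ge0.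
move=> ->; rewrite leeDl// lee_fin mulr_ge0// mulr_ge0 ?exprn_ge0 ?normal_pdf_ge0//.
Unshelve. all: end_near. Qed.

End one_dim.

(** * Integrability and moments under the standard Gaussian measure *)

Section gauss_int.
Context {R : realType}.
Implicit Types (f g : R -> R).
Local Notation gam := (normal_prob (0 : R) 1).
Local Notation gint f := (Rintegral gam setT f).
Local Notation gintegrable f := (gam.-integrable setT (EFin \o f)).

Lemma gint_cst c : gint (fun _ => c) = c.
Proof.
by rewrite /Rintegral integral_cst//= [X in (_ * X)%E]probability_setT mule1.
Qed.

Lemma integrable_pow4 : gintegrable (fun x : R => x ^+ 4).
Proof.
apply/integrableP; split.
  by apply/measurable_EFinP; exact: exprn_measurable.
under eq_integral.
  move=> x _; rewrite /= ger0_norm ?exprn_even_ge0//; over.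
by rewrite (le_lt_trans integral_normal_pow4)// ltry.
Qed.

Lemma gintegrable_cst c : gintegrable (fun _ => c).
Proof. exact: finite_measure_integrable_cst. Qed.

Lemma gintegrableD f g : gintegrable f -> gintegrable g ->
  gintegrable (fun x => f x + g x).
Proof. by move=> fi gi; apply: eq_integrable (integrableD _ fi gi). Qed.

Lemma gintegrableZ c f : gintegrable f -> gintegrable (fun x => c * f x).
Proof. by move=> fi; apply: eq_integrable (integrableZl _ c fi). Qed.

Lemma gintegrable_bound (c c' : R) f : measurable_fun setT f ->
  (forall x, `|f x| <= c + c' * x ^+ 4) -> gintegrable f.
Proof.
move=> mf bf.
have gi : gintegrable (fun x => c + c' * x ^+ 4).
  by apply: gintegrableD; [exact: gintegrable_cst|exact/gintegrableZ/integrable_pow4].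
apply: (le_integrable _ _ _ gi) => //; first exact/measurable_EFinP.
by move=> x _; rewrite lee_fin (le_trans (bf x))// ler_norm.
Qed.

Lemma gintegrable_norm : gintegrable (fun x : R => `|x|).
Proof.
apply: (@gintegrable_bound 1 1); first exact: measurableT_comp.
move=> x; rewrite normr_id mul1r.
have -> : x ^+ 4 = `|x| ^+ 4 by rewrite -normrX ger0_norm// exprn_even_ge0.
set y := `|x|; have := sqr_ge0 (y ^+ 2 - 2^-1); have := sqr_ge0 (y - 2^-1); lra.
Qed.

Lemma gintegrable_id : gintegrable (fun x : R => x).
Proof.
apply: (le_integrable _ _ _ gintegrable_norm) => //.
  by apply/measurable_EFinP; exact: measurable_id.
by move=> x _; rewrite lee_fin normr_id.
Qed.

Lemma gintegrable_sqr : gintegrable (fun x : R => x ^+ 2).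
Proof.
apply: (@gintegrable_bound 1 1); first exact: exprn_measurable.
by move=> x; rewrite ger0_norm ?sqr_ge0// mul1r (exprM x 2 2); nra.
Qed.

Lemma gint_sqr : gint (fun x => x ^+ 2) = 1.
Proof. by rewrite /Rintegral integral_normal_sqr. Qed.

Lemma gint_pow4 : gint (fun x => x ^+ 4) <= 3.
Proof.
rewrite -lee_fin fineK ?integral_normal_pow4//; apply: integrable_fin_num => //.
exact: integrable_pow4.
Qed.

Lemma gint_id : gint (fun x => x) = 0.
Proof.
(* Reflection invariance is proved for nonnegative functions, so x is then split into its positive
   and negative parts, which reflection exchanges. *)
have sub (f : R -> R) : measurable_fun setT f -> (forall x, 0 <= f x) ->
    (\int[gam]_x (f x)%:E = \int[gam]_x (f (- x))%:E)%E.
  move=> mf f0.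
  have mphi := measurable_normal_pdf (0:R) 1.
  have mfN : measurable_fun setT (fun x : R => f (- x)) by exact: measurableT_comp.
  rewrite !ge0_integral_normal_prob//.
  rewrite (@eq_measure_integral _ _ _ setT (pushforward lebesgue_measure (-%R : _ -> measurableTypeR R))); last first.
    by move=> A mA _; symmetry; exact: lebesgue_measureN.
  etransitivity; first apply: ge0_integral_pushforward.
  - exact: oppr_measurable.
  - exact: measurableT.
  - by apply/measurable_EFinP; exact: measurable_funM.
  - by move=> x _; rewrite lee_fin mulr_ge0 ?normal_pdf_ge0.
  - apply: eq_integral => x _ /=; congr (_ * _)%:E.
    by rewrite !normal_pdf01E sqrrN.
have mp : measurable_fun setT (fun x : R => Num.max x 0).
  exact: measurable_maxr.
have ip : gintegrable (fun x : R => Num.max x 0).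
  apply: (le_integrable _ _ _ gintegrable_norm) => //; first exact/measurable_EFinP.
  move=> x _; rewrite lee_fin normr_id; have [x0|x0] := leP x 0; last by [].
  by rewrite normr0.
have im : gintegrable (fun x : R => Num.max (- x) 0).
  apply: (le_integrable _ _ _ gintegrable_norm) => //.
    by apply/measurable_EFinP; apply: measurable_maxr => //.
  move=> x _; rewrite lee_fin normr_id; have [x0|x0] := leP (- x) 0; last by rewrite normrN.
  by rewrite normr0.
transitivity (gint (fun x => Num.max x 0 - Num.max (- x) 0)).
  apply: eq_Rintegral => x _; rewrite /Num.max.
  by case: ltP => h1; case: ltP => h2; lra.
rewrite RintegralB//; apply/eqP; rewrite subr_eq0; apply/eqP.
by rewrite /Rintegral (sub (fun x => Num.max x 0))// => x; rewrite le_max lexx orbT.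
Qed.

End gauss_int.

(** * Iterated Gaussian averages of Lipschitz functions *)

Section lipschitz.
Context {R : realType} {I : finType}.
Implicit Types (F G : (I -> R) -> R) (x y z a : I -> R).

Definition l1norm x : R := \sum_i `|x i|.

Definition lip (C : R) F := forall x y, `|F x - F y| <= C * l1norm (fun i => x i - y i).

Definition lipschitzF F := exists2 C, 0 <= C & lip C F.

Lemma l1norm_ge0 x : 0 <= l1norm x.
Proof. by apply: sumr_ge0 => i _; exact: normr_ge0. Qed.

Lemma l1normZ (s : R) x : l1norm (fun i => s * x i) = `|s| * l1norm x.
Proof. by rewrite /l1norm mulr_sumr; apply: eq_bigr => i _; rewrite normrM. Qed.

(** F is the infimum of the functions F(q) + C |x - q|_1 over rational points q, so a strict
    sublevel set is a countable union of measurable ones. *)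
Lemma lip_measurable d (T : measurableType d) C F (Y : T -> I -> R) :
  0 <= C -> lip C F -> (forall i, measurable_fun setT (fun t => Y t i)) ->
  measurable_fun setT (fun t => F (Y t)).
Proof.
move=> C0 LF mY.
apply: (measurability _ (RGenInftyO.measurableE R)) => //.
move=> _ [_ [r ->] <-]; rewrite setTI.
pose q (f : {ffun I -> rat}) i : R := ratr (f i).
pose h f t := F (q f) + C * l1norm (fun i => Y t i - q f i).
have mh f : measurable_fun setT (h f).
  apply: measurable_funD => //; apply: measurable_funM => //.
  apply: measurable_sum => i; apply: measurableT_comp => //.
  exact: measurable_funB.
have -> : (fun t => F (Y t)) @^-1` `]-oo, r[%classic =
   \bigcup_(f in [set: {ffun I -> rat}]) (h f @^-1` `]-oo, r[%classic).
  apply/seteqP; split => t /=; rewrite ?in_itv/=.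
    (* A rational point within e in each coordinate costs C |I| e twice: once for moving F, once for
       the penalty in [h]. The added 1 keeps the denominator positive and the final inequality
       strict. *)
    move=> Fr; pose e := (r - F (Y t)) / (2 * C * #|I|%:R + 1).
    have D0 : 0 < 2 * C * #|I|%:R + 1.
      by rewrite ltr_wpDl// !mulr_ge0.
    have e0 : 0 < e by rewrite divr_gt0// subr_gt0.
    have /choice[f fP] i : exists p : rat, `|Y t i - ratr p| < e.
      have : Y t i - e < Y t i + e by lra.
      move=> /rat_in_itvoo [p]; rewrite in_itv/= => /andP[p1 p2]; exists p.
      by rewrite ltr_norml; apply/andP; split; lra.
    exists [ffun i => f i] => //=; rewrite in_itv/= /h.
    set D := l1norm _.
    have De : D <= #|I|%:R * e.
      rewrite mulr_natl -sumr_const; apply: ler_sum => i _.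
      by rewrite /q ffunE ltW.
    have : `|F (q [ffun i => f i]) - F (Y t)| <= C * D.
      by rewrite distrC; exact: LF.
    rewrite ler_norml => /andP[_ h1].
    have h2 : C * D <= C * (#|I|%:R * e) by rewrite ler_wpM2l.
    have h3 : (2 * C * #|I|%:R + 1) * e = r - F (Y t).
      by rewrite /e mulrC divfK// gt_eqF.
    lra.
  move=> [f _] /=; rewrite in_itv/= /h => hr.
  have := LF (Y t) (q f); rewrite ler_norml => /andP[_ h1]; lra.
apply: countable_bigcupT_measurable => [|f]; first exact: countableP.
by rewrite -[X in measurable X]setTI; exact: mh.
Qed.

Lemma lipschitz_cst c : lipschitzF (fun _ => c).
Proof. by exists 0 => // x y; rewrite subrr normr0 mul0r. Qed.

Lemma lipschitzD F G : lipschitzF F -> lipschitzF G ->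
  lipschitzF (fun x => F x + G x).
Proof.
move=> [C C0 LF] [D D0 LG]; exists (C + D); first exact: addr_ge0.
move=> x y; rewrite opprD addrACA mulrDl (le_trans (ler_normD _ _))//.
by rewrite lerD.
Qed.

Lemma lipschitzZ c F : lipschitzF F -> lipschitzF (fun x => c * F x).
Proof.
move=> [C C0 LF]; exists (`|c| * C); first exact: mulr_ge0.
by move=> x y; rewrite -mulrBr normrM -mulrA ler_wpM2l.
Qed.

Lemma lipschitzB F G : lipschitzF F -> lipschitzF G ->
  lipschitzF (fun x => F x - G x).
Proof.
move=> LF LG; have := lipschitzD LF (lipschitzZ (-1) LG).
by under eq_fun do rewrite mulN1r.
Qed.

Lemma lipschitz_max F G : lipschitzF F -> lipschitzF G ->
  lipschitzF (fun x => Num.max (F x) (G x)).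
Proof.
move=> [C C0 LF] [D D0 LG]; exists (C + D); first exact: addr_ge0.
move=> x y.
have h1 := LF x y; have h2 := LG x y.
have n0 : 0 <= l1norm (fun i => x i - y i) by exact: l1norm_ge0.
have p1 : 0 <= C * l1norm (fun i => x i - y i) by exact: mulr_ge0.
have p2 : 0 <= D * l1norm (fun i => x i - y i) by exact: mulr_ge0.
rewrite mulrDl; move: h1 h2; rewrite !ler_norml => /andP[a1 a2] /andP[b1 b2].
by case: (leP (F x)) => c1; case: (leP (F y)) => c2; apply/andP; split; lra.
Qed.

Lemma lipschitz_sum (K : Type) (l : seq K) (F : K -> (I -> R) -> R) :
  (forall k, lipschitzF (F k)) -> lipschitzF (fun x => \sum_(k <- l) F k x).
Proof.
move=> LF; elim: l => [|k l IH].
  by under eq_fun do rewrite big_nil; exact: lipschitz_cst.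
by under eq_fun do rewrite big_cons; exact: lipschitzD.
Qed.

Lemma lipschitz_coord i : lipschitzF (fun x => x i).
Proof.
exists 1 => // x y; rewrite mul1r /l1norm (bigD1 i)//= lerDl.
by apply: sumr_ge0 => j _; exact: normr_ge0.
Qed.

Lemma lipschitz_l1norm : lipschitzF l1norm.
Proof.
exists 1 => // x y; rewrite mul1r /l1norm -sumrB (le_trans (ler_norm_sum _ _ _))//.
by apply: ler_sum => i _; exact: ler_dist_dist.
Qed.

End lipschitz.

Section lipschitz_comp.
Context {R : realType} {I J : finType}.

Lemma lipschitz_comp (F : (J -> R) -> R) (l : (I -> R) -> J -> R) :
  lipschitzF F -> (forall j, lipschitzF (fun x => l x j)) ->
  lipschitzF (fun x => F (l x)).
Proof.
move=> [C C0 LF] Ll.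
have /choice[D DP] j : exists D, 0 <= D /\ lip D (fun x => l x j).
  by have [D D0 LD] := Ll j; exists D.
exists (C * \sum_j D j); first by rewrite mulr_ge0// sumr_ge0// => j _; case: (DP j).
move=> x y; rewrite (le_trans (LF _ _))// -mulrA ler_wpM2l// mulr_suml.
by apply: ler_sum => j _; case: (DP j) => _; exact.
Qed.

End lipschitz_comp.

(** * Averaging over a Gaussian step in one direction *)

Section gaussian_shift.
Context {R : realType} {I : finType}.
Implicit Types (F G : (I -> R) -> R) (x y z a b : I -> R).
Local Notation gint f := (Rintegral (normal_prob (0 : R) 1) setT f).
Local Notation gintegrable f :=
  ((normal_prob (0 : R) 1).-integrable setT (EFin \o f)).

Definition shift x (s : R) a : I -> R := fun i => x i + s * a i.

Definition Q a F x : R := gint (fun s => F (shift x s a)).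

Lemma shift0 x a : shift x 0 a = x.
Proof. by apply/funext => i; rewrite /shift mul0r addr0. Qed.

Lemma shiftC x s a t b : shift (shift x s a) t b = shift (shift x t b) s a.
Proof. by apply/funext => i; rewrite /shift addrAC. Qed.

Lemma lip_shift C F x a s t : lip C F ->
  `|F (shift x s a) - F (shift x t a)| <= C * l1norm a * `|s - t|.
Proof.
move=> LF; rewrite (le_trans (LF _ _))// -mulrA [l1norm a * _]mulrC -l1normZ.
rewrite (_ : (fun _ => _) = (fun i => (s - t) * a i))//.
by apply/funext => i; rewrite /shift; ring.
Qed.

Lemma lip_shift0 C F x a s : lip C F ->
  `|F (shift x s a) - F x| <= C * l1norm a * `|s|.
Proof. by move=> /lip_shift-/(_ x a s 0); rewrite shift0 subr0. Qed.

Lemma measurable_lip_shift F x a : lipschitzF F ->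
  measurable_fun setT (fun s => F (shift x s a)).
Proof.
move=> [C C0 LF]; apply: (lip_measurable C0 LF) => i.
by apply: measurable_funD => //; exact: measurable_funM.
Qed.

Lemma gintegrable_shift F x a : lipschitzF F ->
  gintegrable (fun s => F (shift x s a)).
Proof.
move=> LF; have mF := measurable_lip_shift x a LF; case: LF => C C0 LF.
have gi : gintegrable (fun s : R => `|F x| + C * l1norm a * `|s|).
  by apply: gintegrableD; [exact: gintegrable_cst|exact/gintegrableZ/gintegrable_norm].
apply: (le_integrable _ _ _ gi) => //; first exact/measurable_EFinP.
move=> s _; rewrite lee_fin (le_trans _ (ler_norm _))//.
have := lip_shift0 x a s LF; have := ler_distD (F x) (F (shift x s a)) 0.
by rewrite !subr0; lra.
Qed.

Lemma QE F a x : lipschitzF F ->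
  (Q a F x)%:E = (\int[normal_prob 0 1]_s (F (shift x s a))%:E)%E.
Proof.
by move=> LF; rewrite fineK//; apply: integrable_fin_num => //; exact: gintegrable_shift.
Qed.

Lemma Q_cst c a x : Q a (fun _ => c) x = c.
Proof. exact: gint_cst. Qed.

Lemma QD F G a x : lipschitzF F -> lipschitzF G ->
  Q a (fun x => F x + G x) x = Q a F x + Q a G x.
Proof. by move=> LF LG; rewrite /Q RintegralD//; exact: gintegrable_shift. Qed.

Lemma QB F G a x : lipschitzF F -> lipschitzF G ->
  Q a (fun x => F x - G x) x = Q a F x - Q a G x.
Proof. by move=> LF LG; rewrite /Q RintegralB//; exact: gintegrable_shift. Qed.

Lemma QZ c F a x : lipschitzF F -> Q a (fun x => c * F x) x = c * Q a F x.
Proof. by move=> LF; rewrite /Q RintegralZl//; exact: gintegrable_shift. Qed.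

Lemma le_Q F G a x : lipschitzF F -> lipschitzF G -> (forall x, F x <= G x) ->
  Q a F x <= Q a G x.
Proof.
move=> LF LG FG; apply: le_Rintegral => //; exact: gintegrable_shift.
Qed.

Lemma lip_Q C F a : 0 <= C -> lip C F -> lip C (Q a F).
Proof.
move=> C0 LF x y; have L : lipschitzF F by exists C.
have ix := gintegrable_shift x a L; have iy := gintegrable_shift y a L.
rewrite /Q -RintegralB// (le_trans (le_normr_Rintegral _ _))//.
  exact: (integrableB _ ix iy).
set D := leRHS; rewrite -[leRHS](gint_cst D).
apply: le_Rintegral => //.
- exact: (integrable_norm (integrableB _ ix iy)).
- exact: gintegrable_cst.
- move=> s _; rewrite (le_trans (LF _ _))//.
  rewrite (_ : (fun i => shift x s a i - shift y s a i) = (fun i => x i - y i))//.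
  by apply/funext => i; rewrite /shift; ring.
Qed.

Lemma lipschitz_Q F a : lipschitzF F -> lipschitzF (Q a F).
Proof. by move=> [C C0 LF]; exists C => //; exact: lip_Q. Qed.

(** Tonelli's theorem and the stability of the Gaussian measure are available for nonnegative
    functions; this splitting extends their consequences to all Lipschitz functions. *)
Lemma lipschitz_posneg F : lipschitzF F -> exists F1 F2,
  [/\ lipschitzF F1, lipschitzF F2, (forall x, 0 <= F1 x),
      (forall x, 0 <= F2 x) & F = (fun x => F1 x - F2 x)].
Proof.
move=> LF; exists (fun x => Num.max (F x) 0), (fun x => Num.max (- F x) 0).
split.
- by apply: lipschitz_max => //; exact: lipschitz_cst.
- apply: lipschitz_max; last exact: lipschitz_cst.
  by have := lipschitzZ (-1) LF; under eq_fun do rewrite mulN1r.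
- by move=> x; rewrite le_max lexx orbT.
- by move=> x; rewrite le_max lexx orbT.
- by apply/funext => x; case: ltP => h1; case: ltP => h2; lra.
Qed.

Lemma QQE F a b x : lipschitzF F -> (forall x, 0 <= F x) ->
  (Q a (Q b F) x)%:E = (\int[normal_prob 0 1]_s \int[normal_prob 0 1]_t
     (F (shift (shift x s a) t b))%:E)%E.
Proof.
move=> LF F0; rewrite QE; last exact: lipschitz_Q.
by apply: eq_integral => s _; rewrite QE.
Qed.

Lemma QC F a b x : lipschitzF F -> Q a (Q b F) x = Q b (Q a F) x.
Proof.
move=> /lipschitz_posneg[F1 [F2 [L1 L2 p1 p2 ->]]].
have ext c : Q c (fun x => F1 x - F2 x) = (fun x => Q c F1 x - Q c F2 x).
  by apply/funext => y; exact: QB.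
rewrite !ext !QB; [|exact: lipschitz_Q..].
suff H G : lipschitzF G -> (forall x, 0 <= G x) -> Q a (Q b G) x = Q b (Q a G) x.
  by rewrite (H _ L1 p1) (H _ L2 p2).
move=> LG G0; apply: EFin_inj.
apply: etrans (QQE a b x LG G0) _; apply/esym.
apply: etrans (QQE b a x LG G0) _; apply/esym.
pose f (z : R * R) := (G (shift (shift x z.1 a) z.2 b))%:E.
transitivity (\int[normal_prob 0 1]_s \int[normal_prob 0 1]_t f (s, t))%E => [//|].
rewrite fubini_tonelli.
- by apply: eq_integral => t _; apply: eq_integral => s _; rewrite /f shiftC.
- case: LG => C C0 LG; apply/measurable_EFinP; apply: (lip_measurable C0 LG) => i.
  rewrite /shift; apply: measurable_funD; last exact: measurable_funM.
  by apply: measurable_funD => //; exact: measurable_funM.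
- by move=> z; rewrite lee_fin.
Qed.

Lemma Q_stable F a x : lipschitzF F ->
  Q a F x = Q (fun i => (Num.sqrt 2)^-1 * a i) (Q (fun i => (Num.sqrt 2)^-1 * a i) F) x.
Proof.
move=> /lipschitz_posneg[F1 [F2 [L1 L2 p1 p2 ->]]].
have ext c : Q c (fun x => F1 x - F2 x) = (fun x => Q c F1 x - Q c F2 x).
  by apply/funext => y; exact: QB.
rewrite !ext QB; [|exact: lipschitz_Q..].
set b := fun i => _.
suff H G : lipschitzF G -> (forall x, 0 <= G x) -> Q a G x = Q b (Q b G) x.
  by rewrite (H _ L1 p1) (H _ L2 p2).
move=> LG G0; apply: EFin_inj; rewrite (QQE b b x LG G0) (QE a x LG).
pose f s := G (shift x s a).
have cf : continuous f.
  case: LG => C C0 LG s.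
  apply/cvgrPdist_le => /= e e0; near=> t.
  rewrite (le_trans (lip_shift _ _ _ _ LG))//.
  near: t.
  have D0 : 0 < C * l1norm a + 1 by rewrite ltr_wpDl// mulr_ge0// l1norm_ge0.
  exists (e / (C * l1norm a + 1)) => /=; first by rewrite divr_gt0.
  move=> t /= st; rewrite (@le_trans _ _ ((C * l1norm a + 1) * `|s - t|))//.
    by rewrite ler_wpM2r// lerDl.
  by rewrite mulrC -ler_pdivlMr// ltW.
rewrite -(@ge0_integral_normal_stable _ f cf (fun s => G0 _)).
apply: eq_integral => s _; apply: eq_integral => t _.
congr (G _)%:E; apply/funext => i; rewrite /shift /b; ring.
Unshelve. all: end_near. Qed.

End gaussian_shift.

(** * Averages over several independent directions, and their infinite divisibility *)

Section Qs.
Context {R : realType} {I : finType}.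
Implicit Types (F G : (I -> R) -> R) (x y a b : I -> R) (l : seq (I -> R)).

(* [Qs l F x] is the expectation of [F (x + sum_(a <- l) g_a a)] for independent
   standard Gaussian variables [g_a]. *)
Definition Qs l F := foldr Q F l.

Lemma lipschitz_Qs l F : lipschitzF F -> lipschitzF (Qs l F).
Proof. by move=> LF; elim: l => //= a l IH; exact: lipschitz_Q. Qed.

Lemma le_Qs l F G x : lipschitzF F -> lipschitzF G -> (forall x, F x <= G x) ->
  Qs l F x <= Qs l G x.
Proof.
move=> LF LG FG; elim: l x => //= a l IH x.
by apply: le_Q => //; exact: lipschitz_Qs.
Qed.

Lemma Qs_cst l c x : Qs l (fun=> c) x = c.
Proof.
elim: l x => //= a l IH x; rewrite -[RHS](Q_cst c a x).
by congr (Q a _ x); apply/funext => y; exact: IH.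
Qed.

Lemma QsD l F G x : lipschitzF F -> lipschitzF G ->
  Qs l (fun x => F x + G x) x = Qs l F x + Qs l G x.
Proof.
move=> LF LG; elim: l x => //= a l IH x.
by rewrite -QD; [congr (Q a _ x); exact/funext|exact: lipschitz_Qs..].
Qed.

Lemma QsZ l c F x : lipschitzF F -> Qs l (fun x => c * F x) x = c * Qs l F x.
Proof.
move=> LF; elim: l x => //= a l IH x.
by rewrite -QZ; [congr (Q a _ x); exact/funext|exact: lipschitz_Qs].
Qed.

Lemma QsDc l F c x : lipschitzF F -> Qs l (fun x => F x + c) x = Qs l F x + c.
Proof. by move=> LF; rewrite QsD ?Qs_cst//; exact: lipschitz_cst. Qed.

Lemma Q_Qs a l F : lipschitzF F -> Q a (Qs l F) = Qs l (Q a F).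
Proof.
move=> LF; elim: l => //= b l <-; apply/funext => x.
by apply: QC; exact: lipschitz_Qs.
Qed.

Lemma QsC l l' F : lipschitzF F -> Qs l (Qs l' F) = Qs l' (Qs l F).
Proof.
move=> LF; elim: l => //= a l ->; rewrite Q_Qs//; exact: lipschitz_Qs.
Qed.

Definition scales (t : R) l := [seq (fun i => t * a i) | a <- l].

Lemma scales_scales s t l : scales s (scales t l) = scales (s * t) l.
Proof.
rewrite /scales -map_comp; apply: eq_map => a /=.
by apply/funext => i; rewrite mulrA.
Qed.

(** Each direction splits into two scaled ones by [Q_stable]; since averages in different directions
    commute, the halves regroup into two complete passes through the list. *)
Lemma Qs_stable l F : lipschitzF F ->
  Qs l F = Qs (scales (Num.sqrt 2)^-1 l) (Qs (scales (Num.sqrt 2)^-1 l) F).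
Proof.
move=> LF; elim: l => //= a l {1}->.
have L := lipschitz_Qs (scales (Num.sqrt 2)^-1 l) LF.
have -> : Q a (Qs (scales (Num.sqrt 2)^-1 l) (Qs (scales (Num.sqrt 2)^-1 l) F)) =
    Q (fun i => (Num.sqrt 2)^-1 * a i) (Q (fun i => (Num.sqrt 2)^-1 * a i)
      (Qs (scales (Num.sqrt 2)^-1 l) (Qs (scales (Num.sqrt 2)^-1 l) F))).
  by apply/funext => x; apply: Q_stable; exact: lipschitz_Qs.
by congr (Q _ _); rewrite Q_Qs.
Qed.

Lemma iter_Qs_lip n l F : lipschitzF F -> lipschitzF (iter n (Qs l) F).
Proof. by move=> LF; elim: n => //= n; exact: lipschitz_Qs. Qed.

Lemma Qs_dyadic m l F : lipschitzF F ->
  Qs l F = iter (2 ^ m) (Qs (scales ((Num.sqrt 2)^-1 ^+ m) l)) F.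
Proof.
move=> LF; elim: m => [|m IH].
  rewrite /= expr0; congr (Qs _ F).
  by rewrite /scales -[LHS]map_id; apply: eq_map => a; apply/funext => i; rewrite mul1r.
rewrite IH; set t := _ ^+ m; rewrite expnS mul2n -addnn exprS -/t.
rewrite -scales_scales; set l' := scales t l.
elim: (2 ^ m)%N => //= n IHn; rewrite addnS/= -IHn Qs_stable//; exact: iter_Qs_lip.
Qed.

End Qs.

(** * Second-order expansion of the logarithm of an exponential mean *)

Section exp_bounds.
Context {R : realType}.
Implicit Types y u : R.

Lemma expR_sub1Dx_le y : `|y| <= 2^-1 -> 0 <= expR y - 1 - y <= 2 * y ^+ 2.
Proof.
rewrite ler_norml => /andP[y1 y2].
have h1 := expR_ge1Dx y; have h2 := expR_ge1Dx (- y).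
have e0 := expR_gt0 y.
have : expR y * (1 - y) <= 1.
  by rewrite -[leRHS](mulfV (lt0r_neq0 e0)) ler_pM2l// -expRN.
move=> h3; apply/andP; split; first by lra.
by nra.
Qed.

Lemma expR_taylor2 y : `|y| <= 2^-1 ->
  `|expR y - 1 - y - y ^+ 2 / 2| <= 2 * `|y| ^+ 3.
Proof.
pose g (t : R) : R := expR t - 1 - t - t ^+ 2 / 2.
have dg (t : R) : is_derive t 1 g (expR t - 1 - t).
  apply: is_derive_eq; rewrite /GRing.scale/=.
  by field.
have cg : continuous g.
  by move=> t; apply: differentiable_continuous; apply/derivable1_diffP; exact: ex_derive.
have g0 : g 0 = 0 by rewrite /g expR0; lra.
move=> y2.
have key c : `|c| <= `|y| -> `|(expR c - 1 - c) * y| <= 2 * `|y| ^+ 3.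
  move=> cy; have /expR_sub1Dx_le/andP[h1 h2] : `|c| <= 2^-1 by exact: le_trans y2.
  rewrite normrM (ger0_norm h1) exprSr mulrA ler_wpM2r//.
  by rewrite (le_trans h2)// ler_wpM2l// -[c ^+ 2]real_normK ?num_real// lerXn2r ?nnegrE.
have [y0|y0] := leP 0 y.
  have [c cin] := MVT_segment y0 (fun t _ => dg t) (continuous_subspaceT cg).
  rewrite /= g0 !subr0 -/(g y) => ->; apply: key.
  move: cin; rewrite in_itv/= => /andP[c0 cy]; rewrite !ger0_norm//.
have [c cin] := MVT_segment (ltW y0) (fun t _ => dg t) (continuous_subspaceT cg).
rewrite /= g0 !sub0r -normrN -/(g y) => ->; rewrite mulrN normrN; apply: key.
by move: cin; rewrite in_itv/= => /andP[c0 cy]; rewrite !ler0_norm ?lerN2// ltW.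
Qed.

Lemma ln_le_sub1 u : 0 < u -> ln u <= u - 1.
Proof. by move=> u0; rewrite -[in leLHS](subrKC 1 u) le_ln1Dx//; lra. Qed.

Lemma ln1D_ge u : 0 <= u -> u - u ^+ 2 <= ln (1 + u).
Proof.
move=> u0; have u1 : 0 < 1 + u by lra.
have := @ln_le_sub1 (1 + u)^-1; rewrite invr_gt0 => /(_ u1).
rewrite lnV ?posrE// => h.
have : (1 + u)^-1 <= 1 - u + u ^+ 2.
  by rewrite -[leLHS]mul1r ler_pdivrMr//; nra.
lra.
Qed.

End exp_bounds.

Section log_mean_exp.
Context {R : realType} {I : finType}.
Variables (p : I -> R).
Hypotheses (p0 : forall i, 0 <= p i) (p1 : \sum_i p i = 1).

Lemma mean_le (z : I -> R) c : (forall i, z i <= c) -> \sum_i p i * z i <= c.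
Proof.
move=> zc; rewrite -[leRHS]mul1r -p1 mulr_suml.
by apply: ler_sum => i _; rewrite ler_wpM2l.
Qed.

Lemma mean_ge (z : I -> R) c : (forall i, c <= z i) -> c <= \sum_i p i * z i.
Proof.
move=> zc; rewrite -[leLHS]mul1r -p1 mulr_suml.
by apply: ler_sum => i _; rewrite ler_wpM2l.
Qed.

Lemma mean_norm_le (z : I -> R) c : (forall i, `|z i| <= c) ->
  `|\sum_i p i * z i| <= c.
Proof.
move=> zc; rewrite ler_norml; apply/andP; split.
  by apply: mean_ge => i; have := zc i; rewrite ler_norml => /andP[].
by apply: mean_le => i; have := zc i; rewrite ler_norml => /andP[].
Qed.

Lemma mean_expR_gt0 (z : I -> R) c : (forall i, - c <= z i) ->
  expR (- c) <= \sum_i p i * expR (z i).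
Proof. by move=> zc; apply: mean_ge => i; rewrite ler_expR. Qed.

(** The second-order cumulant expansion with an explicit cubic remainder. The constant is not sharp;
    what matters is that the bound holds for all d, since it is later integrated over an unbounded
    Gaussian step. *)
Lemma centered_log_mean_exp (y : I -> R) d : 0 <= d ->
  \sum_i p i * y i = 0 -> (forall i, `|y i| <= 2 * d) ->
  `|ln (\sum_i p i * expR (y i)) - 2^-1 * \sum_i p i * y i ^+ 2| <= 40 * d ^+ 3.
Proof.
move=> d0 y0 yd.
have yd1 i : - (2 * d) <= y i by have := yd i; rewrite ler_norml => /andP[].
have yd2 i : y i <= 2 * d by have := yd i; rewrite ler_norml => /andP[].
have ysqr i : y i ^+ 2 <= 4 * d ^+ 2.
  rewrite -[y i ^+ 2]real_normK ?num_real//.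
  by have := yd i; have := normr_ge0 (y i); nra.
have v0 : 0 <= \sum_i p i * y i ^+ 2 by apply: mean_ge => i; exact: sqr_ge0.
have v1 : \sum_i p i * y i ^+ 2 <= 4 * d ^+ 2 by exact: mean_le.
set v := \sum_i p i * y i ^+ 2 in v0 v1 *.
set M := \sum_i p i * expR (y i).
have M1 : 1 <= M.
  have -> : 1 = \sum_i p i * (1 + y i).
    under eq_bigr do rewrite mulrDr mulr1.
    by rewrite big_split/= y0 p1 addr0.
  by apply: ler_sum => i _; rewrite ler_wpM2l// expR_ge1Dx.
have M0 : 0 < M by exact: lt_le_trans M1.
(* For d > 1/4 no expansion is made: ln M <= 2 d and v <= 4 d^2, and both d and d^2 are bounded by
   multiples of d^3. *)
have [dlt|dge] := leP d 4^-1; last first.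
  have l0 : 0 <= ln M by exact: ln_ge0.
  have l1 : ln M <= 2 * d.
    rewrite -[leRHS]expRK ler_ln ?posrE ?expR_gt0//.
    by apply: mean_le => i; rewrite ler_expR.
  rewrite ler_norml; have d2 : d <= 16 * d ^+ 3 by nra.
  have d3 : d ^+ 2 <= 4 * d ^+ 3 by nra.
  by apply/andP; split; lra.
have My : `|M - 1 - 2^-1 * v| <= 2 * (8 * d ^+ 3).
  have -> : M - 1 - 2^-1 * v = \sum_i p i * (expR (y i) - 1 - y i - y i ^+ 2 / 2).
    apply/esym; transitivity (\sum_i (p i * expR (y i) - p i - p i * y i -
        2^-1 * (p i * y i ^+ 2))); first by apply: eq_bigr => i _; field.
    by rewrite !sumrB y0 p1 -mulr_sumr subr0.
  apply: mean_norm_le => i.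
  have yi : `|y i| <= 2^-1 by rewrite (le_trans (yd i)); lra.
  rewrite (le_trans (expR_taylor2 yi))// ler_wpM2l//.
  have -> : 8 * d ^+ 3 = (2 * d) ^+ 3 by rewrite exprMn; ring.
  by rewrite lerXn2r ?nnegrE// mulr_ge0.
have M1' : 0 <= M - 1 by lra.
have l1 : ln M <= M - 1 by exact: ln_le_sub1.
have l2 : (M - 1) - (M - 1) ^+ 2 <= ln M by have := ln1D_ge M1'; rewrite subrKC.
move: My; rewrite ler_norml => /andP[My1 My2].
have u1 : M - 1 <= 6 * d ^+ 2 by nra.
have u2 : (M - 1) ^+ 2 <= 36 * d ^+ 4.
  by rewrite (_ : 36 * d ^+ 4 = (6 * d ^+ 2) ^+ 2) ?lerXn2r ?nnegrE ?mulr_ge0//; ring.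
have d3 : 0 <= d ^+ 3 by exact: exprn_ge0.
have d4 : d ^+ 4 <= d ^+ 3 / 4 by rewrite exprS; nra.
rewrite ler_norml; apply/andP; split; lra.
Qed.

Lemma log_mean_exp (z : I -> R) d : 0 <= d -> (forall i, `|z i| <= d) ->
  `|ln (\sum_i p i * expR (z i)) - \sum_i p i * z i
    - 2^-1 * (\sum_i p i * z i ^+ 2 - (\sum_i p i * z i) ^+ 2)| <= 40 * d ^+ 3.
Proof.
move=> d0 zd; set m := \sum_i p i * z i.
have md : `|m| <= d by exact: mean_norm_le.
pose y i := z i - m.
have y0 : \sum_i p i * y i = 0.
  under eq_bigr do rewrite mulrBr.
  by rewrite sumrB -mulr_suml p1 mul1r subrr.
have yd i : `|y i| <= 2 * d.
  by rewrite (le_trans (ler_normB _ _))//; have := zd i; lra.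
have := centered_log_mean_exp d0 y0 yd.
have -> : \sum_i p i * expR (y i) = expR (- m) * \sum_i p i * expR (z i).
  rewrite mulr_sumr; apply: eq_bigr => i _.
  by rewrite /y addrC expRD; ring.
rewrite lnM ?posrE ?expR_gt0//; last first.
  apply: lt_le_trans (mean_expR_gt0 (c := d) _); first exact: expR_gt0.
  by move=> i; have := zd i; rewrite ler_norml => /andP[].
rewrite expRK.
have -> : \sum_i p i * y i ^+ 2 = \sum_i p i * z i ^+ 2 - m ^+ 2.
  transitivity (\sum_i (p i * z i ^+ 2 - (2 * m) * (p i * z i) + p i * m ^+ 2)).
    by apply: eq_bigr => i _; rewrite /y; ring.
  rewrite big_split/= sumrB -mulr_sumr -/m -mulr_suml p1; ring.
by rewrite [- m + _]addrC.
Qed.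

End log_mean_exp.

(** * The Sudakov-Fernique inequality *)

Section softmax.
Context {R : realType} {I : finType}.
Variables (i0 : I) (beta : R).
Hypothesis beta0 : 0 < beta.
Implicit Types (x y a b : I -> R).

Definition expsum x : R := \sum_i expR (beta * x i).
(** A smooth substitute for the maximum. Its gradient is [gibbs x], and its second derivative in
    direction [a] is [beta * gvar a x]; these are the coefficients in [lse_taylor]. *)
Definition lse x : R := beta^-1 * ln (expsum x).
Definition gibbs x i : R := expR (beta * x i) / expsum x.
Definition gmean x a : R := \sum_i gibbs x i * a i.
Definition gvar a x : R := gmean x (fun i => a i ^+ 2) - gmean x a ^+ 2.

Lemma expsum_gt0 x : 0 < expsum x.
Proof.
rewrite /expsum (bigD1 i0)//= ltr_wpDr ?expR_gt0//.
by apply: sumr_ge0 => i _; exact: expR_ge0.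
Qed.

Lemma gibbs_ge0 x i : 0 <= gibbs x i.
Proof. by rewrite divr_ge0 ?expR_ge0// ltW// expsum_gt0. Qed.

Lemma gibbs_sum1 x : \sum_i gibbs x i = 1.
Proof. by rewrite -mulr_suml mulfV// gt_eqF// expsum_gt0. Qed.

Lemma le_coord_l1norm x i : `|x i| <= l1norm x.
Proof.
by rewrite /l1norm (bigD1 i)//= lerDl; apply: sumr_ge0 => j _; exact: normr_ge0.
Qed.

Lemma expsum_le x y : expsum x <= expR (beta * l1norm (fun i => x i - y i)) * expsum y.
Proof.
rewrite /expsum mulr_sumr; apply: ler_sum => i _.
rewrite -expRD ler_expR -mulrDr ler_wpM2l//; first exact: ltW.
have := le_coord_l1norm (fun i => x i - y i) i; rewrite ler_norml => /andP[_]; lra.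
Qed.

Lemma l1norm_distC x y : l1norm (fun i => x i - y i) = l1norm (fun i => y i - x i).
Proof. by apply: eq_bigr => i _; rewrite distrC. Qed.

Lemma lip_lse : lip 1 lse.
Proof.
have h x y : lse x - lse y <= l1norm (fun i => x i - y i).
  rewrite /lse -mulrBr -(ler_pM2l beta0) mulrA mulfV ?gt_eqF// mul1r lerBlDr.
  rewrite -[X in X + _]expRK -lnM ?posrE ?expR_gt0 ?expsum_gt0//.
  by rewrite ler_ln ?posrE ?mulr_gt0 ?expR_gt0 ?expsum_gt0//; exact: expsum_le.
move=> x y; rewrite mul1r ler_norml; apply/andP; split; last exact: h.
by rewrite l1norm_distC lerNl opprB; exact: h.
Qed.

Lemma lipschitz_lse : lipschitzF lse.
Proof. by exists 1 => //; exact: lip_lse. Qed.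

Lemma gibbs_le1 x i : gibbs x i <= 1.
Proof.
rewrite -(gibbs_sum1 x) (bigD1 i)//= lerDl; apply: sumr_ge0 => j _.
exact: gibbs_ge0.
Qed.

(** Moving x by D in the l1 norm changes numerator and denominator by factors at most exp (beta D),
    so a weight shrinks at most by exp (- 2 beta D). As weights are at most 1, 1 - exp (- t) <= t
    concludes. *)
Lemma lipschitz_gibbs i : lipschitzF (fun x => gibbs x i).
Proof.
exists (2 * beta); first by rewrite mulr_ge0// ltW.
have h x y : gibbs x i - gibbs y i <= 2 * beta * l1norm (fun i => x i - y i).
  set D := l1norm _.
  have h1 : gibbs x i * expR (- (2 * beta * D)) <= gibbs y i.
    have e2 : expsum y <= expR (beta * D) * expsum x.
      by rewrite /D l1norm_distC; exact: expsum_le.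
    have e3 : expR (beta * x i) <= expR (beta * D) * expR (beta * y i).
      rewrite -expRD ler_expR -mulrDr ler_wpM2l//; first exact: ltW.
      have := le_coord_l1norm (fun i => x i - y i) i; rewrite -/D ler_norml => /andP[_]; lra.
    have -> : expR (- (2 * beta * D)) = (expR (beta * D) * expR (beta * D))^-1.
      by rewrite -expRD -expRN; congr expR; ring.
    rewrite /gibbs -mulrA -invfM ler_pdivrMr ?mulr_gt0 ?expR_gt0 ?expsum_gt0//.
    rewrite mulrAC ler_pdivlMr ?expsum_gt0//.
    rewrite (le_trans (ler_pM _ _ e3 e2)) ?expR_ge0//; first exact/ltW/expsum_gt0.
    by rewrite le_eqVlt; apply/orP; left; apply/eqP; ring.
  have h2 := expR_ge1Dx (- (2 * beta * D)).
  have t0 : 0 <= 2 * beta * D by rewrite !mulr_ge0 ?l1norm_ge0// ltW.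
  move: (2 * beta * D) t0 h1 h2 => t t0 h1 h2.
  by have := gibbs_le1 x i; have := gibbs_ge0 x i; nra.
move=> x y; rewrite ler_norml; apply/andP; split; last exact: h.
by rewrite l1norm_distC lerNl opprB; exact: h.
Qed.

Lemma lipschitz_gmean a : lipschitzF (fun x => gmean x a).
Proof.
apply: lipschitz_sum => i; under eq_fun do rewrite mulrC.
exact/lipschitzZ/lipschitz_gibbs.
Qed.

Lemma lipschitz_gvar a : lipschitzF (gvar a).
Proof.
apply: lipschitzB; first exact: lipschitz_gmean.
have [C C0 LC] := lipschitz_gmean a.
have bd x : `|gmean x a| <= l1norm a.
  apply: mean_norm_le; [exact: gibbs_ge0|exact: gibbs_sum1|exact: le_coord_l1norm].
exists (2 * l1norm a * C); first by rewrite !mulr_ge0// l1norm_ge0.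
move=> x y; rewrite subr_sqr normrM mulrC -mulrA ler_pM//.
by rewrite (le_trans (ler_normD _ _))//; have := bd x; have := bd y; lra.
Qed.

(** Half the mean squared difference of two independent copies. In this form the variance sees [a]
    only through its increments, the data that the comparison hypothesis controls. *)
Lemma gvarE a x : gvar a x =
  2^-1 * \sum_i \sum_j gibbs x i * gibbs x j * (a i - a j) ^+ 2.
Proof.
have s1 := gibbs_sum1 x.
transitivity (2^-1 * \sum_i \sum_j (gibbs x i * a i ^+ 2 * gibbs x j
    + gibbs x i * (gibbs x j * a j ^+ 2)
    - 2 * (gibbs x i * a i) * (gibbs x j * a j))); last first.
  by congr (_ * _); apply: eq_bigr => i _; apply: eq_bigr => j _; ring.
transitivity (2^-1 * \sum_i (gibbs x i * a i ^+ 2 + gibbs x i * gmean x (fun i => a i ^+ 2)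
   - 2 * (gibbs x i * a i) * gmean x a)); last first.
  congr (_ * _); apply: eq_bigr => i _; rewrite sumrB big_split/=.
  by rewrite -!mulr_sumr s1 mulr1.
have s2 c : \sum_i gibbs x i * c = c by rewrite -mulr_suml s1 mul1r.
have s3 c : \sum_i 2 * (gibbs x i * a i) * c = 2 * gmean x a * c.
  by rewrite -mulr_suml -mulr_sumr.
rewrite sumrB big_split/= s2 s3 -/(gmean x (fun i => a i ^+ 2)).
by rewrite /gvar; field.
Qed.

Lemma lse_shift x s a : lse (shift x s a) - lse x =
  beta^-1 * ln (\sum_i gibbs x i * expR (beta * s * a i)).
Proof.
rewrite /lse -mulrBr; congr (_ * _).
rewrite -ln_div ?posrE ?expsum_gt0//; congr ln.
rewrite /expsum mulr_suml; apply: eq_bigr => i _.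
by rewrite /gibbs /shift mulrDr expRD mulrA mulrAC.
Qed.

Lemma lse_taylor x s a :
  `|lse (shift x s a) - lse x - s * gmean x a - s ^+ 2 * (beta / 2 * gvar a x)|
    <= 40 * beta ^+ 2 * l1norm a ^+ 3 * `|s| ^+ 3.
Proof.
pose d := beta * l1norm a * `|s|.
have b0 := ltW beta0.
have d0 : 0 <= d by rewrite !mulr_ge0// l1norm_ge0.
have zd i : `|beta * s * a i| <= d.
  rewrite !normrM gtr0_norm// /d -!mulrA ler_wpM2l// mulrC ler_wpM2r//.
  exact: le_coord_l1norm.
have := log_mean_exp (gibbs_ge0 x) (gibbs_sum1 x) d0 zd.
have -> : \sum_i gibbs x i * (beta * s * a i) = beta * s * gmean x a.
  by rewrite mulr_sumr; apply: eq_bigr => i _; ring.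
have -> : \sum_i gibbs x i * (beta * s * a i) ^+ 2 = (beta * s) ^+ 2 * gmean x (fun i => a i ^+ 2).
  by rewrite mulr_sumr; apply: eq_bigr => i _; ring.
rewrite lse_shift; set L := ln _ => h.
have -> : beta^-1 * L - s * gmean x a - s ^+ 2 * (beta / 2 * gvar a x) =
  beta^-1 * (L - beta * s * gmean x a -
    2^-1 * ((beta * s) ^+ 2 * gmean x (fun i => a i ^+ 2) - (beta * s * gmean x a) ^+ 2)).
  by rewrite /gvar; field; rewrite gt_eqF.
rewrite normrM gtr0_norm ?invr_gt0// ler_pdivrMl//.
rewrite (le_trans h)// le_eqVlt; apply/orP; left; apply/eqP.
by rewrite /d; ring.
Qed.

End softmax.

Section gint_approx.
Context {R : realType}.
Local Notation gint f := (Rintegral (normal_prob (0 : R) 1) setT f).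
Local Notation gintegrable f :=
  ((normal_prob (0 : R) 1).-integrable setT (EFin \o f)).

Lemma gint_dist_le (f g h : R -> R) : gintegrable f -> gintegrable g ->
  gintegrable h -> (forall s, `|f s - g s| <= h s) ->
  `|gint f - gint g| <= gint h.
Proof.
move=> fi gi hi fgh; rewrite -RintegralB//.
rewrite (le_trans (le_normr_Rintegral _ _))//; first exact: (integrableB _ fi gi).
apply: le_Rintegral => //; exact: (integrable_norm (integrableB _ fi gi)).
Qed.

Lemma gintegrable_cube : gintegrable (fun s : R => `|s| ^+ 3).
Proof.
apply: (@gintegrable_bound _ 1 1).
  apply: (measurableT_comp (exprn_measurable 3)).
  exact: normr_measurable.
move=> x; rewrite mul1r ger0_norm ?exprn_ge0//.
have -> : x ^+ 4 = `|x| ^+ 4 by rewrite -normrX ger0_norm// exprn_even_ge0.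
have := normr_ge0 x; set y := `|x| => y0.
rewrite (exprM y 2 2) (exprS y 2).
by have := sqr_ge0 (y ^+ 2 - 2^-1 * y); have := sqr_ge0 (2^-1 * y - 1); have := sqr_ge0 y; nra.
Qed.

End gint_approx.

(** * Comparison of two processes by small Gaussian steps *)

Section lindeberg_step.
Context {R : realType} {I : finType}.
Implicit Types (F G : (I -> R) -> R) (x y a b : I -> R) (l : seq (I -> R)).
Local Notation gint f := (Rintegral (normal_prob (0 : R) 1) setT f).
Local Notation gintegrable f :=
  ((normal_prob (0 : R) 1).-integrable setT (EFin \o f)).

Lemma Q_dist_le a F G e x : lipschitzF F -> lipschitzF G ->
  (forall x, `|F x - G x| <= e) -> `|Q a F x - Q a G x| <= e.
Proof.
move=> LF LG FG; rewrite -[leRHS](gint_cst e).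
by apply: gint_dist_le => //; [exact: gintegrable_shift..|exact: gintegrable_cst].
Qed.

Lemma shiftZ x s t a : shift x s (fun i => t * a i) = shift x (t * s) a.
Proof. by apply/funext => i; rewrite /shift mulrCA mulrA. Qed.

Lemma Q_scale_dist C F a t x : 0 <= C -> lip C F ->
  `|Q (fun i => t * a i) F x - F x| <=
    C * l1norm a * gint (fun s => `|s|) * `|t|.
Proof.
move=> C0 LF; have L : lipschitzF F by exists C.
rewrite -[X in _ - X](gint_cst (F x)) mulrAC -RintegralZl//; last exact: gintegrable_norm.
apply: gint_dist_le => //.
- exact: gintegrable_shift.
- exact: gintegrable_cst.
- exact/gintegrableZ/gintegrable_norm.
- by move=> s; rewrite shiftZ (le_trans (lip_shift0 _ _ _ LF))// normrM mulrA.
Qed.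

Variables (i0 : I) (beta : R).
Hypothesis beta0 : 0 < beta.
Let lse : (I -> R) -> R := lse beta.
Let llse : lipschitzF lse := lipschitz_lse i0 beta0.
Let gvar : (I -> R) -> (I -> R) -> R := gvar beta.

Lemma Q_lse_taylor a t x :
  `|Q (fun i => t * a i) lse x - (lse x + t ^+ 2 * (beta / 2 * gvar a x))| <=
    40 * beta ^+ 2 * l1norm a ^+ 3 * gint (fun s => `|s| ^+ 3) * `|t| ^+ 3.
Proof.
set v := beta / 2 * _.
pose g (s : R) : R := lse x + ((t * gmean beta x a) * s + (t ^+ 2 * v) * s ^+ 2).
have gi : gintegrable g.
  apply: gintegrableD; first exact: gintegrable_cst.
  by apply: gintegrableD; apply: gintegrableZ;
    [exact: gintegrable_id|exact: gintegrable_sqr].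
have -> : lse x + t ^+ 2 * v = gint g.
  rewrite RintegralD//; last 2 first.
  - exact: gintegrable_cst.
  - by apply: gintegrableD; apply: gintegrableZ;
      [exact: gintegrable_id|exact: gintegrable_sqr].
  rewrite gint_cst RintegralD//; last 2 first.
  - by apply: gintegrableZ; exact: gintegrable_id.
  - by apply: gintegrableZ; exact: gintegrable_sqr.
  rewrite RintegralZl//; last exact: gintegrable_id.
  rewrite RintegralZl//; last exact: gintegrable_sqr.
  by rewrite gint_id gint_sqr mulr0 add0r mulr1.
rewrite mulrAC -RintegralZl//; last exact: gintegrable_cube.
apply: gint_dist_le => //.
- exact: gintegrable_shift.
- exact/gintegrableZ/gintegrable_cube.
move=> s; rewrite shiftZ.
have := lse_taylor i0 beta0 x (t * s) a.
have -> : 40 * beta ^+ 2 * l1norm a ^+ 3 * `|t| ^+ 3 * `|s| ^+ 3 =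
    40 * beta ^+ 2 * l1norm a ^+ 3 * `|t * s| ^+ 3 by rewrite normrM; ring.
apply: le_trans.
by rewrite le_eqVlt; apply/orP; left; apply/eqP; congr `|_|; rewrite /g /v /lse /gvar; ring.
Qed.

(** A new direction contributes its own second-order term. It also moves the base point of the terms
    already collected, but these are Lipschitz with a factor t^2, so a step of size t changes them
    by O(t^3) only. *)
Lemma Qs_lse_taylor l : exists2 K, 0 <= K & forall t x, 0 <= t <= 1 ->
  `|Qs (scales t l) lse x - (lse x + t ^+ 2 * (beta / 2 * \sum_(a <- l) gvar a x))|
    <= K * t ^+ 3.
Proof.
elim: l => [|a l [K K0 IH]].
  exists 0 => // t x _; rewrite big_nil !mulr0 addr0 subrr normr0.
  by rewrite mul0r.
pose V x := beta / 2 * \sum_(a <- l) gvar a x.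
have LV : lipschitzF V.
  by apply: lipschitzZ; apply: lipschitz_sum => b; exact: (lipschitz_gvar i0 beta0).
have [C C0 LC] := LV.
set m1 := gint (fun s : R => `|s|); set m3 := gint (fun s : R => `|s| ^+ 3).
have m10 : 0 <= m1 by apply: Rintegral_ge0 => s _; exact: normr_ge0.
have m30 : 0 <= m3 by apply: Rintegral_ge0 => s _; exact: exprn_ge0.
exists (K + 40 * beta ^+ 2 * l1norm a ^+ 3 * m3 + C * l1norm a * m1).
  by rewrite !addr_ge0// !mulr_ge0// ?exprn_ge0// ?l1norm_ge0// ltW.
move=> t x /andP[t0 t1]; rewrite big_cons /=.
set b := (fun i => t * a i).
have LG := lipschitz_Qs (scales t l) llse.
have LH : lipschitzF (fun x => lse x + t ^+ 2 * V x).
  by apply: lipschitzD => //; exact: lipschitzZ.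
have h1 : `|Q b (Qs (scales t l) lse) x - Q b (fun x => lse x + t ^+ 2 * V x) x| <= K * t ^+ 3.
  by apply: Q_dist_le => // y; apply: IH; rewrite t0.
rewrite QD// in h1; last exact: lipschitzZ.
rewrite (QZ _ _ _ LV) in h1.
have h2 := Q_lse_taylor a t x; rewrite -/b (ger0_norm t0) -/m3 in h2.
have h3 := Q_scale_dist a t x C0 LC; rewrite -/b (ger0_norm t0) -/m1 in h3.
have h4 : `|t ^+ 2 * (Q b V x - V x)| <= C * l1norm a * m1 * t ^+ 3.
  rewrite normrM ger0_norm ?exprn_ge0// [t ^+ 3]exprSr [leRHS]mulrCA.
  by rewrite ler_wpM2l ?exprn_ge0// mulrC.
rewrite mulrDr -/(V x).
move: h1 h2 h4; set K1 := 40 * beta ^+ 2 * _ * _; rewrite 2!mulrDl.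
move: (K1 * _) (K * _) (C * _ * _) => k1 k2 k3; rewrite !ler_norml.
by move=> /andP[p1 p2] /andP[q1 q2] /andP[r1 r2]; apply/andP; split; lra.
Qed.

(* The second-order coefficient of [t |-> Qs (scales t la) lse] is
   [beta / 2] times the sum of the variances of [a \in la] under the Gibbs weights,
   hence a positive combination of the squared increments. *)
Lemma Qs_lse_compare la lb :
  (forall i j, \sum_(a <- la) (a i - a j) ^+ 2 <= \sum_(b <- lb) (b i - b j) ^+ 2) ->
  exists2 K, 0 <= K & forall t x, 0 <= t <= 1 ->
  Qs (scales t la) lse x <= Qs (scales t lb) lse x + K * t ^+ 3.
Proof.
move=> hab.
have [K K0 HK] := Qs_lse_taylor la; have [L L0 HL] := Qs_lse_taylor lb.
exists (K + L) => [|t x t01]; first exact: addr_ge0.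
have hv : \sum_(a <- la) gvar a x <= \sum_(b <- lb) gvar b x.
  under eq_bigr do rewrite /gvar gvarE//.
  under [leRHS]eq_bigr do rewrite /gvar gvarE//.
  rewrite -!mulr_sumr ler_wpM2l// exchange_big [leRHS]exchange_big/=.
  apply: ler_sum => i _; rewrite exchange_big [leRHS]exchange_big/=.
  apply: ler_sum => j _; rewrite -!mulr_sumr ler_wpM2l//.
  by rewrite mulr_ge0// gibbs_ge0.
have := HK t x t01; have := HL t x t01.
rewrite !ler_norml => /andP[p1 p2] /andP[q1 q2].
have hv2 : t ^+ 2 * (beta / 2 * \sum_(a <- la) gvar a x) <=
    t ^+ 2 * (beta / 2 * \sum_(b <- lb) gvar b x).
  by rewrite ler_wpM2l ?sqr_ge0// ler_wpM2l// divr_ge0// ltW.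
lra.
Qed.

(** One pass along [la] is replaced at a time: the one-pass inequality is applied innermost, and the
    resulting pass along [lb] is commuted to the outside. The inequality is thus used for [F] alone,
    never for its iterates. *)
Lemma Qs_iter_compare la lb F (e : R) n : lipschitzF F -> 0 <= e ->
  (forall x, Qs la F x <= Qs lb F x + e) ->
  forall x, iter n (Qs la) F x <= iter n (Qs lb) F x + n%:R * e.
Proof.
move=> LF e0 h; elim: n => [|n IH] x; first by rewrite mul0r addr0.
have La := iter_Qs_lip n la LF; have Lb := iter_Qs_lip n lb LF.
rewrite iterSr.
have iterD (G H : (I -> R) -> R) c m : lipschitzF G -> lipschitzF H ->
    (forall y, G y <= H y + c) -> forall y, iter m (Qs la) G y <= iter m (Qs la) H y + c.
  move=> LG LH GH; elim: m => //= m IHm y; have := iter_Qs_lip m la LH => LHm.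
  rewrite -QsDc//; apply: le_Qs => //; first exact: iter_Qs_lip.
  by apply: lipschitzD => //; exact: lipschitz_cst.
apply: (le_trans (iterD _ _ _ n (lipschitz_Qs la LF) (lipschitz_Qs lb LF) h x)).
have -> : iter n (Qs la) (Qs lb F) = Qs lb (iter n (Qs la) F).
  elim: n {IH La Lb} => //= n ->; rewrite QsC//; exact: iter_Qs_lip.
rewrite iterS -addn1 natrD mulrDl mul1r addrA lerD2r -QsDc//.
by apply: le_Qs => //; apply: lipschitzD => //; exact: lipschitz_cst.
Qed.

(* By stability, [Qs l] is the [2 ^ m]-th iterate of [Qs (scales t l)] with
   [t = 2 ^ (- m / 2)]; the third-order errors of the steps add up to
   [O(2 ^ (- m / 2))]. *)
Lemma sudakov_fernique_lse la lb x :
  (forall i j, \sum_(a <- la) (a i - a j) ^+ 2 <= \sum_(b <- lb) (b i - b j) ^+ 2) ->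
  Qs la lse x <= Qs lb lse x.
Proof.
move=> hab; have [K K0 HK] := Qs_lse_compare hab.
pose th : R := (Num.sqrt 2)^-1.
have s2 : 1 < Num.sqrt 2 :> R by rewrite -[ltLHS]sqrtr1 ltr_sqrt// ltr1n.
have th0 : 0 < th by rewrite invr_gt0; lra.
have th1 : th < 1 by rewrite invf_lt1; lra.
apply/ler_addgt0Pr => e e0.
have [m mP] : exists m, K * th ^+ m <= e.
  have : (th ^+ m) @[m --> \oo] --> (0 : R) by apply: cvg_expr; rewrite ger0_norm// ltW.
  move=> /cvgrPdist_le/(_ (e / (K + 1)))/= => /(_ _)[|m _ /(_ m (leqnn m))].
    by rewrite divr_gt0//; lra.
  have tn0 : 0 <= th ^+ m by rewrite exprn_ge0// ltW.
  rewrite sub0r normrN (ger0_norm tn0) => h; exists m.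
  apply: (@le_trans _ _ ((K + 1) * th ^+ m)).
    by rewrite ler_wpM2r ?exprn_ge0 ?ltW//; lra.
  by rewrite mulrC -ler_pdivlMr//; lra.
rewrite (Qs_dyadic m la llse) (Qs_dyadic m lb llse) -/th.
have tm : 0 <= th ^+ m <= 1 by rewrite exprn_ge0 ?exprn_ile1 ?ltW.
have t30 : 0 <= K * (th ^+ m) ^+ 3 by rewrite mulr_ge0// !exprn_ge0// ltW.
have := Qs_iter_compare (2 ^ m) llse t30 (fun x => HK (th ^+ m) x tm) x.
move=> /le_trans; apply; rewrite lerD2l.
rewrite (_ : (2 ^ m)%:R * _ = K * th ^+ m)//.
have t2 : 2%:R * th ^+ 2 = 1 by rewrite exprVn sqr_sqrtr// mulfV.
have e1 : (2 ^ m)%:R * (th ^+ m) ^+ 2 = 1 :> R.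
  by rewrite natrX -exprM mulnC exprM -exprMn t2 expr1n.
have aux (u v k : R) : u * (k * v ^+ 3) = k * v * (u * v ^+ 2) by ring.
by rewrite aux e1 mulr1.
Qed.

End lindeberg_step.

Section sudakov_fernique.
Context {R : realType} {I : finType}.
Variable i0 : I.
Implicit Types (x y a b : I -> R) (l : seq (I -> R)).

Definition maxF x : R := \big[Num.max/x i0]_i x i.

Lemma le_maxF x i : x i <= maxF x.
Proof. exact: le_bigmax. Qed.

Lemma maxF_le x c : (forall i, x i <= c) -> maxF x <= c.
Proof. by move=> xc; apply/bigmax_leP; split. Qed.

Lemma lipschitz_maxF : lipschitzF maxF.
Proof.
have h x y : maxF x - maxF y <= l1norm (fun i => x i - y i).
  rewrite lerBlDr; apply: maxF_le => i.
  have := le_coord_l1norm (fun i => x i - y i) i; rewrite ler_norml => /andP[_].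
  by have := le_maxF y i; lra.
exists 1 => // x y; rewrite mul1r ler_norml; apply/andP; split; last exact: h.
by rewrite l1norm_distC lerNl opprB; exact: h.
Qed.

Lemma maxF_le_lse beta x : 0 < beta -> maxF x <= lse beta x.
Proof.
move=> b0; apply: maxF_le => i.
rewrite /lse ler_pdivlMl// -[leLHS]expRK ler_ln ?posrE ?expR_gt0 ?(expsum_gt0 i0)//.
by rewrite /expsum (bigD1 i)//= lerDl; apply: sumr_ge0 => j _; exact: expR_ge0.
Qed.

Lemma lse_le_maxF beta x : 0 < beta -> lse beta x <= maxF x + beta^-1 * ln #|I|%:R.
Proof.
move=> b0; have I0 : 0 < #|I|%:R :> R by rewrite ltr0n; apply/card_gt0P; exists i0.
rewrite /lse -(ler_pM2l b0) mulrDr !mulrA mulfV ?gt_eqF// !mul1r.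
rewrite -[X in _ <= X + _]expRK -lnM ?posrE ?expR_gt0//.
rewrite ler_ln ?posrE ?mulr_gt0 ?expR_gt0 ?(expsum_gt0 i0)//.
rewrite mulrC mulr_natl -sumr_const; apply: ler_sum => i _.
by rewrite ler_expR ler_pM2l//; exact: le_maxF.
Qed.

(** The starting point [x] is the common mean of both processes and may be any vector. Only squared
    increments are compared, not variances. *)
Theorem sudakov_fernique la lb x :
  (forall i j, \sum_(a <- la) (a i - a j) ^+ 2 <= \sum_(b <- lb) (b i - b j) ^+ 2) ->
  Qs la maxF x <= Qs lb maxF x.
Proof.
move=> hab; apply/ler_addgt0Pr => e e0.
have L0 : 0 <= ln #|I|%:R :> R.
  by apply: ln_ge0; rewrite ler1n; apply/card_gt0P; exists i0.
(* Makes the smoothing error ln |I| / beta at most e; the added 1 keeps beta positive when the index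
   set has one element. *)
pose beta := (ln #|I|%:R + 1) / e.
have b0 : 0 < beta by rewrite divr_gt0//; lra.
have Ll := lipschitz_lse i0 b0; have Lm := lipschitz_maxF.
have h1 : Qs la maxF x <= Qs la (lse beta) x.
  by apply: le_Qs => // y; exact: maxF_le_lse.
have h2 := sudakov_fernique_lse i0 b0 x hab.
have h3 : Qs lb (lse beta) x <= Qs lb maxF x + beta^-1 * ln #|I|%:R.
  rewrite -QsDc//; apply: le_Qs => //.
    by apply: lipschitzD => //; exact: lipschitz_cst.
  by move=> y; exact: lse_le_maxF.
apply: (le_trans h1); apply: (le_trans h2); apply: (le_trans h3).
rewrite lerD2l /beta invf_div mulrAC ler_pdivrMr; last by lra.
by rewrite ler_pM2l//; lra.
Qed.

End sudakov_fernique.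

(** * Gaussian random variables on a probability space *)

Section partition.
Context {R : realType}.

Lemma sum_indic_cells (a h : R) (m : nat) (s : R) : 0 < h ->
  \sum_(i < m) \1_(`[a + i%:R * h, a + i.+1%:R * h[%classic) s =
  \1_(`[a, a + m%:R * h[%classic) s :> R.
Proof.
move=> h0; elim: m => [|m IH].
  rewrite big_ord0 mul0r addr0 indicE memNset//= in_itv/= => /andP[]; lra.
rewrite big_ord_recr/= {}IH !indicE !mem_setE !in_itv/=.
have mh : 0 <= m%:R * h by rewrite mulr_ge0// ltW.
rewrite -[m.+1]addn1 natrD mulrDl mul1r.
have [sa|sa] := leP a s => /=; last first.
  rewrite (_ : a + m%:R * h <= s = false) ?addr0//; apply/negbTE; rewrite -ltNge; lra.
have [sm|sm] := ltP s (a + m%:R * h) => /=.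
  by rewrite addr0 (_ : s < _ = true)//; lra.
by rewrite add0r.
Qed.

(** Cells of width 1/(n+1) cover the interval of radius n+1, and its complement is one cell
    represented by 0. There |s| >= n+1, so |s| <= s^2/(n+1): the weight 1 + s^2, integrable for
    Gaussian variables, covers both cases. *)
Lemma fine_partition (n : nat) : exists L : seq (set R * R),
  [/\ forall c, c \in L -> measurable c.1,
   forall s, \sum_(c <- L) \1_(c.1) s = 1 :> R &
   forall c s, c \in L -> c.1 s -> `|s - c.2| <= (1 + s ^+ 2) / n.+1%:R].
Proof.
pose h : R := n.+1%:R^-1; pose N : R := n.+1%:R; pose m := (2 * (n.+1 * n.+1))%N.
have N0 : 0 < N by rewrite ltr0n.
have h0 : 0 < h by rewrite invr_gt0.
have Nh : N * h = 1 by rewrite mulfV// gt_eqF.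
pose cell (i : 'I_m) := (`[- N + i%:R * h, - N + i.+1%:R * h[%classic : set R).
pose out : set R := ~` `[- N, N[%classic.
exists ((out, 0) :: [seq (cell i, - N + i%:R * h) | i <- enum 'I_m]); split.
- move=> c; rewrite inE => /orP[/eqP->/=|/mapP[i _ ->]/=].
    by apply: measurableC; exact: measurable_itv.
  exact: measurable_itv.
- move=> s; rewrite big_cons big_map big_enum/= sum_indic_cells//.
  rewrite (_ : - N + m%:R * h = N); last first.
    by rewrite /m !natrM -/N -!mulrA Nh; lra.
  rewrite /out !indicE in_setC; by case: (s \in _); rewrite ?addr0 ?add0r.
- move=> c s; rewrite inE => /orP[/eqP->/=|/mapP[i _ ->]/=].
    rewrite /out/= in_itv/= => /negP; rewrite negb_and -ltNge -leNgt => sN.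
    have sN' : N <= `|s| by case/orP: sN => ?; rewrite ler_normr; apply/orP; [right|left]; lra.
    rewrite subr0 ler_pdivlMr// -/N -[s ^+ 2]real_normK ?num_real//; nra.
  rewrite /cell/= in_itv/= => /andP[s1 s2].
  rewrite ger0_norm; last by lra.
  move: s2; rewrite -[i.+1]addn1 natrD mulrDl mul1r => s2.
  have := sqr_ge0 s; rewrite mulrDl mul1r -/h => s3.
  by have := mulr_ge0 s3 (ltW h0); lra.
Qed.

End partition.

Section normal_sd.
Context {R : realType} {I : finType}.
Variable sd : R.
Hypothesis sd0 : 0 < sd.
Local Notation N := (normal_prob (0 : R) sd).
Local Notation gint f := (Rintegral (normal_prob (0 : R) 1) setT f).

Lemma normal_integrable_sqr : N.-integrable setT (EFin \o (fun s : R => s ^+ 2)).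
Proof.
apply/integrableP; split; first by apply/measurable_EFinP; exact: exprn_measurable.
under eq_integral do rewrite /= ger0_norm ?sqr_ge0//.
rewrite ge0_integral_normal_prob_scale//; last 2 first.
- exact: exprn_continuous.
- by move=> x; exact: sqr_ge0.
under eq_integral do rewrite exprMn EFinM.
rewrite ge0_integralZl//; last 3 first.
- by apply/measurable_EFinP; exact: exprn_measurable.
- by move=> s _; rewrite lee_fin sqr_ge0.
- by rewrite lee_fin sqr_ge0.
by rewrite integral_normal_sqr mule1 ltry.
Qed.

Lemma normal_integrable_cst c : N.-integrable setT (EFin \o (fun _ : R => c)).
Proof. exact: finite_measure_integrable_cst. Qed.

Lemma continuous_lip_shift (F : (I -> R) -> R) x a : lipschitzF F ->
  continuous (fun s : R => F (shift x s a)).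
Proof.
case=> C C0 LF s; apply/cvgrPdist_le => /= e e0.
have D0 : 0 < C * l1norm a + 1 by rewrite ltr_wpDl// mulr_ge0// l1norm_ge0.
exists (e / (C * l1norm a + 1)) => /=; first by rewrite divr_gt0.
move=> t /= st; rewrite (le_trans (lip_shift _ _ _ _ LF))//.
rewrite (@le_trans _ _ ((C * l1norm a + 1) * `|s - t|))//.
  by rewrite ler_wpM2r// lerDl.
by rewrite mulrC -ler_pdivlMr// ltW.
Qed.

Lemma normal_integrable_shift (F : (I -> R) -> R) x a : lipschitzF F ->
  N.-integrable setT (EFin \o (fun s : R => F (shift x s a))).
Proof.
move=> LF; have mF := measurable_lip_shift x a LF; case: LF => C C0 LF.
have gi : N.-integrable setT (EFin \o (fun s : R => (`|F x| + C * l1norm a) + (C * l1norm a) * s ^+ 2)).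
  apply: eq_integrable (integrableD _ (normal_integrable_cst _) (integrableZl _ (C * l1norm a) normal_integrable_sqr)) => //.
apply: (le_integrable _ _ _ gi) => //; first exact/measurable_EFinP.
move=> s _; rewrite lee_fin (le_trans _ (ler_norm _))//.
have h1 := lip_shift0 x a s LF; have h2 := ler_distD (F x) (F (shift x s a)) 0.
rewrite !subr0 in h2.
have D0 : 0 <= C * l1norm a by rewrite mulr_ge0// l1norm_ge0.
have : C * l1norm a * `|s| <= C * l1norm a + C * l1norm a * s ^+ 2.
  rewrite -[X in _ <= X + _]mulr1 -mulrDr ler_wpM2l// -[s ^+ 2]real_normK ?num_real//.
  by have := sqr_ge0 (`|s| - 2^-1); nra.
lra.
Qed.

Lemma Q_normal (F : (I -> R) -> R) x a : lipschitzF F ->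
  Rintegral N setT (fun s => F (shift x s a)) = Q (fun i => sd * a i) F x.
Proof.
move=> /lipschitz_posneg[F1 [F2 [L1 L2 p1 p2 ->]]].
rewrite (QB _ _ L1 L2).
etransitivity; first apply: RintegralB => //.
- exact: (normal_integrable_shift x a L1).
- exact: (normal_integrable_shift x a L2).
suff H G : lipschitzF G -> (forall x, 0 <= G x) ->
    Rintegral N setT (fun s => G (shift x s a)) = Q (fun i => sd * a i) G x.
  by rewrite (H F1 L1 p1) (H F2 L2 p2).
move=> LG G0.
have e1 := ge0_integral_normal_prob_scale sd0 (@continuous_lip_shift G x a LG) (fun s => G0 _).
rewrite {1}/Rintegral e1 /Q /Rintegral; apply: (congr1 fine).
by apply: eq_integral => s _; rewrite shiftZ.
Qed.

End normal_sd.

(** * Replacing a random variable by one with finitely many values *)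

Section discretize.
Context d (T : measurableType d) (R : realType) (P : probability T R).
Local Notation Pint f := (P.-integrable setT (EFin \o f)).

Lemma integrable_indicM (Y h : T -> R) (c : set R) : measurable c ->
  measurable_fun setT Y -> Pint h -> Pint (fun w => \1_c (Y w) * h w).
Proof.
move=> mc mY hi; apply: (le_integrable _ _ _ hi) => //.
  apply/measurable_EFinP; apply: measurable_funM.
    exact: (measurableT_comp (measurable_indic mc) mY).
  by case/integrableP : hi => /measurable_EFinP.
move=> w _; rewrite lee_fin normrM indicE ler_piMl//.
by case: (_ \in _); rewrite ?normr1 ?normr0.
Qed.

Lemma Rintegral_seq_sum (J : Type) (r : seq J) (f : J -> T -> R) :
  (forall j, Pint (f j)) -> Pint (fun w => \sum_(j <- r) f j w) /\
  Rintegral P setT (fun w => \sum_(j <- r) f j w) =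
    \sum_(j <- r) Rintegral P setT (f j).
Proof.
move=> fi; elim: r => [|j r [IH1 IH2]].
  under eq_fun do rewrite big_nil; rewrite big_nil; split.
    exact: finite_measure_integrable_cst.
  by rewrite Rintegral_cst// mul0r.
under eq_fun do rewrite big_cons; rewrite big_cons; split.
  exact: (integrableD _ (fi j) IH1).
by rewrite RintegralD// IH2.
Qed.

(** In the finite sum, [Y] occurs only through indicators of cells, which can be absorbed into the
    boxes on which independence is assumed. The factor [g] stands for indicators of other
    coordinates. *)
Lemma discretize (Y g : T -> R) (Phi : T -> R -> R) (C : R) n (L : seq (set R * R)) :
  0 <= C -> measurable_fun setT Y -> Pint (fun w => Y w ^+ 2) ->
  (forall w, `|g w| <= 1) ->
  (forall s, Pint (fun w => g w * Phi w s)) ->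
  Pint (fun w => g w * Phi w (Y w)) ->
  (forall w s t, `|Phi w s - Phi w t| <= C * `|s - t|) ->
  (forall c, c \in L -> measurable c.1) ->
  (forall s, \sum_(c <- L) \1_(c.1) s = 1 :> R) ->
  (forall c s, c \in L -> c.1 s -> `|s - c.2| <= (1 + s ^+ 2) / n.+1%:R) ->
  `|Rintegral P setT (fun w => g w * Phi w (Y w)) -
    \sum_(c <- L) Rintegral P setT (fun w => \1_(c.1) (Y w) * (g w * Phi w c.2))|
  <= C * Rintegral P setT (fun w => 1 + Y w ^+ 2) / n.+1%:R.
Proof.
move=> C0 mY Y2 g1 iPhi iPhiY lPhi mL sumL apL.
(* The guard is there because [Rintegral_seq_sum] asks for integrability at every index, while
   measurability is known only for the cells of [L]. *)
have [h1 h2] : Pint (fun w => \sum_(c <- L) (if c \in L then \1_(c.1) (Y w) * (g w * Phi w c.2) else 0))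
  /\ Rintegral P setT (fun w => \sum_(c <- L) (if c \in L then \1_(c.1) (Y w) * (g w * Phi w c.2) else 0)) =
    \sum_(c <- L) Rintegral P setT (fun w => if c \in L then \1_(c.1) (Y w) * (g w * Phi w c.2) else 0).
  apply: Rintegral_seq_sum => c; case: (boolP (c \in L)) => cL; last exact: finite_measure_integrable_cst.
  by apply: integrable_indicM => //; exact: mL.
have -> : \sum_(c <- L) Rintegral P setT (fun w => \1_(c.1) (Y w) * (g w * Phi w c.2)) =
  \sum_(c <- L) Rintegral P setT (fun w => if c \in L then \1_(c.1) (Y w) * (g w * Phi w c.2) else 0).
  by rewrite big_seq [RHS]big_seq; apply: eq_bigr => c ->.
rewrite -h2 -RintegralB//.
have i1 : Pint (fun w => 1 + Y w ^+ 2).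
  have i0 : Pint (fun=> 1) by exact: finite_measure_integrable_cst.
  by apply: eq_integrable (integrableD _ i0 Y2).
rewrite (le_trans (le_normr_Rintegral _ _))//; first exact: (integrableB _ iPhiY h1).
rewrite mulrAC -RintegralZl//; apply: le_Rintegral => //.
- exact: (integrable_norm (integrableB _ iPhiY h1)).
- exact: (integrableZl _ _ i1).
move=> w _.
have -> : g w * Phi w (Y w) = \sum_(c <- L) \1_(c.1) (Y w) * (g w * Phi w (Y w)).
  by rewrite -mulr_suml sumL mul1r.
rewrite -sumrB (le_trans (ler_norm_sum _ _ _))//.
set Z := leRHS; rewrite -[Z]mul1r -(sumL (Y w)) mulr_suml big_seq [leRHS]big_seq /Z.
apply: ler_sum => c cL; rewrite cL -mulrBr -mulrBr normrM indicE.
case: (boolP (Y w \in c.1)) => [/set_mem cY|_]; last by rewrite normr0 !mul0r.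
rewrite normr1 !mul1r normrM (le_trans (ler_pM _ _ (g1 w) (lPhi w _ _)))// mul1r.
by rewrite -mulrA [_^-1 * _]mulrC ler_wpM2l//; exact: apL.
Qed.

End discretize.

Lemma norm_le_inv_nat0 (R : realType) (u M : R) :
  (forall n, `|u| <= M / n.+1%:R) -> u = 0.
Proof.
move=> h; apply/eqP; rewrite -normr_le0; apply/ler_addgt0Pr => e e0; rewrite add0r.
apply: (le_trans (h (Num.truncn (M / e)))).
rewrite ler_pdivrMr// mulrC -ler_pdivrMr//.
by apply: ltW; exact: truncnS_gt.
Qed.

(** * From independent Gaussian variables to iterated averages *)

Section transfer.
Context d (T : measurableType d) (R : realType) (P : probability T R).
Context {K I : finType}.
Variables (X : K -> T -> R) (sd : K -> R) (a : K -> I -> R).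
Hypothesis sd0 : forall k, 0 < sd k.
Hypothesis X_gauss : forall k, gaussian_rv P 0 (sd k) (X k).
Hypothesis X_indep : forall B : K -> set R, (forall k, measurable (B k)) ->
  P [set w | forall k, B k (X k w)] = (\prod_k P (X k @^-1` B k))%E.
Implicit Types (F : (I -> R) -> R) (x : I -> R) (l : seq K).
Local Notation EP f := (Rintegral P setT f).
Local Notation Pint f := (P.-integrable setT (EFin \o f)).

Let mX k : measurable_fun setT (X k). Proof. by case: (X_gauss k). Qed.

Lemma ge0_integral_gaussian_rv k (f : R -> R) : measurable_fun setT f ->
  (forall s, 0 <= f s) ->
  (\int[P]_w (f (X k w))%:E = \int[normal_prob 0 (sd k)]_s (f s)%:E)%E.
Proof.
move=> mf f0.
have mXk : measurable_fun setT (X k : T -> measurableTypeR R) by exact: mX.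
pose Xk : {mfun T >-> measurableTypeR R} :=
  HB.pack (X k : T -> measurableTypeR R) (isMeasurableFun.Build _ _ _ _ _ mXk).
apply/esym; transitivity (\int[distribution P Xk]_s (f s)%:E)%E.
  apply: eq_measure_integral => A mA _.
  by apply/esym; case: (X_gauss k) => _; apply.
apply: (ge0_integral_distribution Xk).
- by apply/measurable_EFinP.
- by move=> s; rewrite lee_fin.
Qed.

Lemma P_integrable_sqr k : Pint (fun w => X k w ^+ 2).
Proof.
have /integrableP[_] := normal_integrable_sqr (sd0 k).
under eq_integral do rewrite /= ger0_norm ?sqr_ge0//.
move=> h; apply/integrableP; split.
  by apply/measurable_EFinP; apply: (measurableT_comp (exprn_measurable 2)).
under eq_integral do rewrite /= ger0_norm ?sqr_ge0//.
rewrite (ge0_integral_gaussian_rv k (f := fun s => s ^+ 2))//.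
by move=> s; exact: sqr_ge0.
Qed.

Lemma P_integrable_cst c : Pint (fun _ => c).
Proof. exact: finite_measure_integrable_cst. Qed.

Lemma P_integrableD (f g : T -> R) : Pint f -> Pint g -> Pint (fun w => f w + g w).
Proof. by move=> fi gi; apply: eq_integrable (integrableD _ fi gi). Qed.

Lemma P_integrableZ c (f : T -> R) : Pint f -> Pint (fun w => c * f w).
Proof. by move=> fi; apply: eq_integrable (integrableZl _ c fi). Qed.

Lemma P_integrable_sum (J : Type) (r : seq J) (f : J -> T -> R) :
  (forall j, Pint (f j)) -> Pint (fun w => \sum_(j <- r) f j w).
Proof.
move=> fi; elim: r => [|j r IH].
  by under eq_fun do rewrite big_nil; exact: P_integrable_cst.
by under eq_fun do rewrite big_cons; exact: P_integrableD.
Qed.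

Definition walk l x (w : T) : I -> R := fun i => x i + \sum_(k <- l) X k w * a k i.

Lemma measurable_walk l x F : lipschitzF F ->
  measurable_fun setT (fun w => F (walk l x w)).
Proof.
move=> [C C0 LF]; apply: (lip_measurable C0 LF) => i.
apply: measurable_funD => //; apply: measurable_sum => k.
exact: measurable_funM.
Qed.

Lemma integrable_walk l x F (g : T -> R) : lipschitzF F -> measurable_fun setT g ->
  (forall w, `|g w| <= 1) -> Pint (fun w => g w * F (walk l x w)).
Proof.
move=> LF mg g1; have mF := measurable_walk l x LF; case: LF => C C0 LF.
have gi : Pint (fun w => `|F x| + \sum_(k <- l) (C * l1norm (a k)) * (1 + X k w ^+ 2)).
  apply: P_integrableD; first exact: P_integrable_cst.
  apply: P_integrable_sum => k; apply: P_integrableZ.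
  apply: P_integrableD; [exact: P_integrable_cst|exact: P_integrable_sqr].
apply: (le_integrable _ _ _ gi) => //.
  by apply/measurable_EFinP; exact: measurable_funM.
move=> w _; rewrite lee_fin (le_trans _ (ler_norm _))// normrM.
apply: (@le_trans _ _ (1 * `|F (walk l x w)|)); first by rewrite ler_wpM2r.
rewrite mul1r.
have h1 : `|F (walk l x w) - F x| <= C * \sum_(k <- l) `|X k w| * l1norm (a k).
  rewrite (le_trans (LF _ _))// ler_wpM2l//.
  rewrite (_ : (fun i => walk l x w i - x i) = (fun i => \sum_(k <- l) X k w * a k i)); last first.
    by apply/funext => i; rewrite /walk addrC addKr.
  rewrite /l1norm (le_trans (ler_sum _ (fun i _ => ler_norm_sum _ _ _)))//.
  rewrite exchange_big/=; apply: ler_sum => k _; rewrite mulr_sumr.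
  by apply: ler_sum => i _; rewrite normrM.
have h2 := ler_distD (F x) (F (walk l x w)) 0; rewrite !subr0 in h2.
have h3 : C * \sum_(k <- l) `|X k w| * l1norm (a k) <=
    \sum_(k <- l) C * l1norm (a k) * (1 + X k w ^+ 2).
  rewrite mulr_sumr; apply: ler_sum => k _.
  rewrite [_ * l1norm _]mulrC mulrA ler_wpM2l ?mulr_ge0 ?l1norm_ge0//.
  by rewrite -[X k w ^+ 2]real_normK ?num_real//; have := sqr_ge0 (`|X k w| - 2^-1); nra.
lra.
Qed.

Let pX k (B : set R) : R := fine (P (X k @^-1` B)).

Lemma walk_cons k l x w :
  walk (k :: l) x w = walk l (shift x (X k w) (a k)) w.
Proof.
by apply/funext => i; rewrite /walk /shift big_cons addrA.
Qed.

Lemma walk_shift l x s k w : walk l (shift x s (a k)) w = shift (walk l x w) s (a k).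
Proof. by apply/funext => i; rewrite /walk /shift addrAC. Qed.

Lemma prod_indic_norm_le1 (Pr : pred K) (B : K -> set R) w :
  `|\prod_(j | Pr j) \1_(B j) (X j w) : R| <= 1.
Proof.
rewrite normr_prod; apply: prodr_ile1 => j.
by rewrite indicE; case: (_ \in _); rewrite ?normr1 ?normr0 lexx ?ler01.
Qed.

Lemma measurable_prod_indic (Pr : pred K) (B : K -> set R) :
  (forall k, measurable (B k)) ->
  measurable_fun setT (fun w => \prod_(j | Pr j) \1_(B j) (X j w) : R).
Proof.
move=> mB.
suff H (r : seq K) : measurable_fun setT
  (fun w => \prod_(j <- r | Pr j) \1_(B j) (X j w) : R) by exact: H.
elim: r => [|j r IH].
  by under eq_fun do rewrite big_nil; exact: measurable_cst.
under eq_fun do rewrite big_cons.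
case: (Pr j) => //; apply: measurable_funM => //.
exact: (measurableT_comp (measurable_indic (mB j)) (mX j)).
Qed.

Let pXE k B : measurable B -> (P (X k @^-1` B)) = (pX k B)%:E.
Proof.
move=> mB; rewrite fineK// fin_num_measure//.
by rewrite -[X in measurable X]setTI; exact: mX.
Qed.

Lemma EP_prod_indic (B : K -> set R) : (forall k, measurable (B k)) ->
  EP (fun w => \prod_j \1_(B j) (X j w)) = \prod_j pX j (B j).
Proof.
move=> mB; pose A := [set w | forall k, B k (X k w)].
have mA : measurable A.
  have -> : A = \bigcap_(k in [set: K]) (X k @^-1` B k).
    by apply/seteqP; split => [w Aw k _|w Aw k]; [exact: Aw|exact: (Aw k)].
  apply: fin_bigcap_measurable => // k _.
  by rewrite -[X in measurable X]setTI; exact: mX.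
have eA w : \prod_j \1_(B j) (X j w) = \1_A w :> R.
  rewrite [RHS]indicE; have [/set_mem Aw|/negP nAw] := boolP (w \in A).
    by rewrite big1// => k _; rewrite indicE mem_set//; exact: Aw.
  have /existsNP[k kP] : ~ A w by move=> Aw; apply: nAw; exact: mem_set.
  by rewrite (bigD1 k)//= indicE memNset ?mul0r.
under eq_Rintegral do rewrite eA.
have := X_indep mB; rewrite -/A => hA.
rewrite /Rintegral integral_indic// setIT.
transitivity (fine (\prod_k P (X k @^-1` B k))%E).
  by apply: (congr1 fine); exact: hA.
transitivity (fine (\prod_k (pX k (B k))%:E)).
  by congr fine; apply: eq_bigr => k _; rewrite pXE.
by rewrite prodEFin.
Qed.

Definition steps l := [seq (fun i => sd k * a k i) | k <- l].

(* Conditioning on the remaining coordinates through products of indicators lets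
   the induction use independence on boxes only; [X k] is approximated by a
   variable with finitely many values. *)
Lemma walk_indep l F x (B : K -> set R) : uniq l -> lipschitzF F ->
  (forall k, measurable (B k)) ->
  EP (fun w => (\prod_(j | j \notin l) \1_(B j) (X j w)) * F (walk l x w)) =
  (\prod_(j | j \notin l) pX j (B j)) * Qs (steps l) F x.
Proof.
move=> + LF; elim: l x B => [|k l IH] x B.
  move=> _ mB /=; rewrite -EP_prod_indic// -RintegralZr//; last first.
    apply: (@measurable_bounded_integrable _ _ _ P) => //.
    - by rewrite (le_lt_trans (probability_le1 _ _))// ltry.
    - exact: measurable_prod_indic.
    - exists 1; split; rewrite ?num_real// => y y1 w _ /=.
      by rewrite (le_trans (prod_indic_norm_le1 _ _ _))// ltW.
  apply: eq_Rintegral => w _; congr (_ * F _).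
  by apply/funext => i; rewrite /walk big_nil addr0.
move=> /= /andP[kl ul] mB.
pose G := Qs (steps l) F; have LG : lipschitzF G by exact: lipschitz_Qs.
pose pi := \prod_(j | j \notin k :: l) pX j (B j).
pose g w : R := \prod_(j | j \notin k :: l) \1_(B j) (X j w).
have mg : measurable_fun setT g by exact: measurable_prod_indic.
have g1 w : `|g w| <= 1 by exact: prod_indic_norm_le1.
have [C C0 LC] := LF; have [D D0 LD] := LG.
pose Phi w s := F (walk l (shift x s (a k)) w).
have -> : EP (fun w => g w * F (walk (k :: l) x w)) = EP (fun w => g w * Phi w (X k w)).
  by apply: eq_Rintegral => w _; rewrite walk_cons.
rewrite /= -(Q_normal (sd0 k) x (a k) LG).
set N := normal_prob 0 (sd k).
apply/eqP; rewrite -subr_eq0; apply/eqP.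
pose C' := C * l1norm (a k); pose D' := D * l1norm (a k).
have C'0 : 0 <= C' by rewrite mulr_ge0// l1norm_ge0.
have D'0 : 0 <= D' by rewrite mulr_ge0// l1norm_ge0.
(* Both sides are discretized with the same cells, one under P and the other under the normal law of
   [X k]. The induction hypothesis and the law of [X k] identify the two sums, so only errors O(1/n)
   remain. *)
apply: (@norm_le_inv_nat0 _ _ (C' * EP (fun w => 1 + X k w ^+ 2) +
   `|pi| * (D' * Rintegral N setT (fun s => 1 + s ^+ 2)))) => n.
have [L [mL sL aL]] := @fine_partition R n.
have h1 : `|EP (fun w => g w * Phi w (X k w)) -
    \sum_(c <- L) EP (fun w => \1_(c.1) (X k w) * (g w * Phi w c.2))| <=
    C' * EP (fun w => 1 + X k w ^+ 2) / n.+1%:R.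
  apply: discretize => //.
  - exact: P_integrable_sqr.
  - by move=> s; exact: integrable_walk.
  - under eq_fun do rewrite /Phi -walk_cons; exact: integrable_walk.
  - by move=> w s t; rewrite /Phi !walk_shift; exact: lip_shift.
have : `|Rintegral N setT (fun s => 1 * G (shift x s (a k))) -
    \sum_(c <- L) Rintegral N setT (fun s => \1_(c.1) s * (1 * G (shift x c.2 (a k))))| <=
    D' * Rintegral N setT (fun s => 1 + s ^+ 2) / n.+1%:R.
  apply: (@discretize _ _ _ N id (fun=> 1) (fun _ s => G (shift x s (a k)))) => //.
  - exact: normal_integrable_sqr.
  - by move=> _; rewrite normr1.
  - by move=> s; exact: finite_measure_integrable_cst.
  - under eq_fun do rewrite mul1r; exact: normal_integrable_shift.
  - by move=> _ s t; exact: lip_shift.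
under [X in `|X - _|]eq_Rintegral do rewrite mul1r.
move=> h2.
have e1 c : measurable c.1 -> EP (fun w => \1_(c.1) (X k w) * (g w * Phi w c.2)) =
    pi * (pX k c.1 * G (shift x c.2 (a k))).
  (* Placing the cell at coordinate k turns its indicator into one more factor of the product, as
     required for the list without k. *)
  move=> mc; pose B' j := if j == k then c.1 else B j.
  have mB' j : measurable (B' j) by rewrite /B'; case: ifP.
  have := IH (shift x c.2 (a k)) B' ul mB'.
  have pr (V : K -> set R -> R) : \prod_(j | j \notin l) V j (B' j) =
      V k c.1 * \prod_(j | j \notin k :: l) V j (B j).
    rewrite (bigD1 k)//= /B' eqxx; congr (_ * _).
    apply: eq_big => j; first by rewrite inE negb_or andbC.
    by case/andP => _ /negbTE ->.
  rewrite (pr pX) -/pi -/G.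
  have -> : pi * (pX k c.1 * G (shift x c.2 (a k))) =
    pX k c.1 * pi * G (shift x c.2 (a k)) by ring.
  move=> <-.
  apply: eq_Rintegral => w _.
  by rewrite (pr (fun j b => \1_b (X j w))) mulrA.
have e2 c : measurable c.1 ->
    Rintegral N setT (fun s => \1_(c.1) s * (1 * G (shift x c.2 (a k)))) =
    pX k c.1 * G (shift x c.2 (a k)).
  move=> mc; rewrite mul1r RintegralZr//; last first.
    exact: integrable_indic.
  rewrite /Rintegral integral_indic// setIT; congr (fine _ * _).
  by apply/esym; case: (X_gauss k) => _; apply.
have E1 : \sum_(c <- L) EP (fun w => \1_(c.1) (X k w) * (g w * Phi w c.2)) =
   pi * \sum_(c <- L) pX k c.1 * G (shift x c.2 (a k)).
  rewrite mulr_sumr big_seq [RHS]big_seq; apply: eq_bigr => c cL.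
  by rewrite e1//; exact: mL.
have E2 : \sum_(c <- L) Rintegral N setT (fun s => \1_(c.1) s * (1 * G (shift x c.2 (a k)))) =
   \sum_(c <- L) pX k c.1 * G (shift x c.2 (a k)).
  rewrite big_seq [RHS]big_seq; apply: eq_bigr => c cL.
  by rewrite e2//; exact: mL.
rewrite E1 in h1; rewrite E2 in h2.
set S := \sum_(c <- L) _ in h1 h2; set U := EP _ in h1 *; set W := Rintegral N _ _ in h2 *.
rewrite mulrDl.
have -> : U - pi * W = (U - pi * S) - pi * (W - S) by ring.
rewrite (le_trans (ler_normB _ _))// lerD// normrM -mulrA ler_wpM2l//.
Qed.

Lemma EP_walk F x : lipschitzF F ->
  EP (fun w => F (fun i => x i + \sum_k X k w * a k i)) = Qs (steps (enum K)) F x.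
Proof.
move=> LF; have := @walk_indep (enum K) F x (fun=> setT) (enum_uniq _) LF (fun=> measurableT).
rewrite big_pred0 ?mul1r => [<-|k]; last by rewrite mem_enum.
apply: eq_Rintegral => w _; rewrite big_pred0 ?mul1r => [|k]; last by rewrite mem_enum.
by congr (F _); apply/funext => i; rewrite /walk big_enum.
Qed.

End transfer.

(** * Chevet's inequality *)

Section net.
Context {R : realType} {D : finType}.

(* Rounding the coordinates towards [0] keeps the net inside the ball. *)
Lemma ball_net (eps : R) : 0 < eps ->
  exists (J : finType) (j0 : J) (f : J -> D -> R),
  [/\ forall i, f j0 i = 0, forall j, \sum_i f j i ^+ 2 <= 1 &
      forall x : D -> R, \sum_i x i ^+ 2 <= 1 ->
        exists j, forall i, `|x i - f j i| <= eps /\ `|f j i| <= `|x i|].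
Proof.
move=> eps0; pose n := Num.truncn eps^-1.
have n0 : 0 < n.+1%:R :> R by rewrite ltr0n.
have ne : n.+1%:R^-1 <= eps.
  rewrite -[leRHS]invrK lef_pV2 ?posrE ?invr_gt0//.
  by rewrite ltW//; exact: truncnS_gt.
pose J := {ffun D -> bool * 'I_n.+2}.
pose g (j : J) i : R := (if (j i).1 then 1 else -1) * ((j i).2)%:R / n.+1%:R.
(* Grid points outside the ball are sent to the origin, so the index type can remain the full
   grid. *)
pose f (j : J) i : R := if \sum_i g j i ^+ 2 <= 1 then g j i else 0.
exists J, [ffun=> (true, ord0)], f; split.
- by move=> i; rewrite /f; case: ifP => // _; rewrite /g ffunE/= mulr0 mul0r.
- move=> j; rewrite /f; case: (lerP (\sum_i g j i ^+ 2) 1) => // _.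
  by rewrite big1 ?ler01// => i _; rewrite expr0n.
move=> x x1.
have xi1 i : `|x i| <= 1.
  rewrite -(@ler_pXn2r _ 2)// ?nnegrE// expr1n real_normK ?num_real//.
  apply: le_trans x1; rewrite (bigD1 i)//= lerDl.
  by apply: sumr_ge0 => k _; exact: sqr_ge0.
pose k i := Num.truncn (n.+1%:R * `|x i|).
have kx i : (k i)%:R <= n.+1%:R * `|x i|.
  by rewrite truncn_le// mulr_ge0// ltW.
have kx2 i : n.+1%:R * `|x i| < (k i)%:R + 1.
  by rewrite natr1; exact: truncnS_gt.
have kn i : (k i < n.+2)%N.
  rewrite ltnS -(ler_nat R) (le_trans (kx i))// -[leRHS]mulr1.
  by rewrite ler_pM2l.
pose j : J := [ffun i => (0 <= x i, Ordinal (kn i))].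
have gx i : `|g j i| = (k i)%:R / n.+1%:R.
  rewrite /g ffunE/= 2!normrM normfV (ger0_norm (ltW n0)).
  by rewrite (ger0_norm (ler0n R (k i))); case: ifP; rewrite ?normrN normr1 mul1r.
have gxx i : `|g j i| <= `|x i| by rewrite gx ler_pdivrMr// mulrC.
have xg i : `|x i - g j i| <= eps.
  apply: le_trans ne; rewrite /g ffunE/=.
  have kk : (k i)%:R / n.+1%:R <= `|x i| by rewrite -gx.
  have kk2 : `|x i| <= (k i)%:R / n.+1%:R + n.+1%:R^-1.
    by rewrite -[X in _ + X]mul1r -mulrDl ler_pdivlMr// mulrC ltW.
  have i0 : 0 <= n.+1%:R^-1 :> R by rewrite invr_ge0 ltW.
  rewrite ler_norml; case: (leP 0 (x i)) => x0.
    move: i0 kk kk2; rewrite (ger0_norm x0) mul1r.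
    move: (_ / _) => A; move: (_^-1) => B *; apply/andP; split; lra.
  move: i0 kk kk2; rewrite (ltr0_norm x0) mulN1r mulNr.
  move: (_ / _) => A; move: (_^-1) => B *; apply/andP; split; lra.
have gj1 : \sum_i g j i ^+ 2 <= 1.
  apply: le_trans x1; apply: ler_sum => i _.
  rewrite -[leLHS]real_normK ?num_real// -[leRHS]real_normK ?num_real//.
  by rewrite lerXn2r ?nnegrE.
exists j => i; rewrite /f gj1; split; [exact: xg|exact: gxx].
Qed.

End net.

(** * Gaussian averages under affine maps and of polynomial bounds *)

Section Qs_affine.
Context {R : realType} {I J : finType}.

Definition delta (i : I) : I -> R := fun k => (k == i)%:R.

(** [L0] is the linear part of the affine map [L]; averaging over coordinate directions becomes
    averaging over their images. This presents a Gaussian process as the image of a standard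
    Gaussian vector. *)
Lemma Qs_affine (L L0 : (I -> R) -> J -> R) (F : (J -> R) -> R) l x :
  (forall x s a, L (shift x s a) = shift (L x) s (L0 a)) ->
  Qs l (fun x => F (L x)) x = Qs (map L0 l) F (L x).
Proof.
move=> aff; elim: l x => //= a l IH x.
transitivity (Q a (fun x => Qs (map L0 l) F (L x)) x).
  by congr (Q a _ x); apply/funext => y; exact: IH.
by rewrite /Q; apply: eq_Rintegral => s _; rewrite aff.
Qed.

Lemma sum_map_delta (L0 : (I -> R) -> J -> R) (f : (J -> R) -> R) :
  \sum_(a <- map L0 (map delta (enum I))) f a = \sum_i f (L0 (delta i)).
Proof. by rewrite -map_comp big_map big_enum. Qed.

End Qs_affine.

Section peel.
Context {R : realType} {I : finType}.
Variables (u v : I -> R) (M al be ka : R).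
Hypotheses (v01 : forall i, v i ^+ 2 = v i) (be0 : 0 <= be).
Variable F : (I -> R) -> R.
Hypothesis LF : lipschitzF F.
Hypothesis Fle : forall z, F z <=
  al * (\sum_i u i * z i ^+ 2) + be * (\sum_i v i * z i ^+ 2 - M) ^+ 2 + ka.
Local Notation gint f := (Rintegral (normal_prob (0 : R) 1) setT f).
Local Notation gintegrable f :=
  ((normal_prob (0 : R) 1).-integrable setT (EFin \o f)).

Let v0 i : 0 <= v i. Proof. by rewrite -v01 sqr_ge0. Qed.

Lemma gint_quartic (c0 c2 c4 : R) :
  gintegrable (fun s => c0 + (c2 * s ^+ 2 + c4 * s ^+ 4)) /\
  (0 <= c4 -> gint (fun s => c0 + (c2 * s ^+ 2 + c4 * s ^+ 4)) <= c0 + c2 + 3 * c4).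
Proof.
have i2 := gintegrableZ c2 (@gintegrable_sqr R).
have i4 := gintegrableZ c4 (@integrable_pow4 R).
have i24 := gintegrableD i2 i4.
split; first exact: (gintegrableD (gintegrable_cst c0) i24).
move=> c40; rewrite RintegralD//; last exact: gintegrable_cst.
rewrite gint_cst RintegralD// RintegralZl//; last exact: gintegrable_sqr.
rewrite RintegralZl//; last exact: integrable_pow4.
rewrite gint_sqr mulr1 -!addrA !lerD2l mulrC ler_wpM2r//; exact: gint_pow4.
Qed.

(** Coordinates are integrated one by one. For v in {0, 1}, the mean of (c + v s^2)^2 is at most c^2
    + 2 c v + 3 v^2 = (c + v)^2 + 2 v, so the shape of the bound persists. The 2 is the variance of
    the square of a standard Gaussian variable. *)
Lemma Qs_peel l z : uniq l -> (forall i, i \in l -> z i = 0) ->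
  Qs (map delta l) F z <=
  al * (\sum_i u i * z i ^+ 2 + \sum_(i <- l) u i) +
  be * ((\sum_i v i * z i ^+ 2 + \sum_(i <- l) v i - M) ^+ 2 + 2 * \sum_(i <- l) v i) + ka.
Proof.
elim: l z => [|k l IH] z /=.
  by move=> _ _; rewrite !big_nil !addr0 mulr0 addr0.
move=> /andP[kl ul] z0; rewrite !big_cons.
have sq (w : I -> R) s : \sum_i w i * (shift z s (delta k) i) ^+ 2 =
    \sum_i w i * z i ^+ 2 + w k * s ^+ 2.
  have zk : z k = 0 by apply: z0; rewrite mem_head.
  rewrite (bigD1 k)//= [in RHS](bigD1 k)//= zk /shift /delta eqxx zk add0r mulr1.
  rewrite expr0n mulr0 add0r addrC; congr (_ + _); apply: eq_bigr => i /negbTE ik.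
  by rewrite ik mulr0 addr0.
set U := \sum_i u i * z i ^+ 2 in sq *; set V := \sum_i v i * z i ^+ 2.
set Ul := \sum_(i <- l) u i; set Vl := \sum_(i <- l) v i.
pose rr := V + Vl - M.
have [qi ql] := gint_quartic (al * (U + Ul) + be * (rr ^+ 2 + 2 * Vl) + ka)
  (al * u k + be * (2 * rr * v k)) (be * v k ^+ 2).
have Lq := lipschitz_Qs (map delta l) LF.
apply: (@le_trans _ _ (gint (fun s => (al * (U + Ul) + be * (rr ^+ 2 + 2 * Vl) + ka) +
  ((al * u k + be * (2 * rr * v k)) * s ^+ 2 + be * v k ^+ 2 * s ^+ 4)))).
  apply: le_Rintegral => //; first exact: gintegrable_shift.
  move=> s _; apply: (le_trans (IH _ ul _)).
    move=> i il; rewrite /shift /delta (negbTE (memPn kl _ il)) mulr0 addr0.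
    by apply: z0; rewrite inE il orbT.
  rewrite !sq -/U -/V -/Ul -/Vl le_eqVlt; apply/orP; left; apply/eqP.
  by rewrite /rr; ring.
apply: (le_trans (ql _)); first by rewrite mulr_ge0// sqr_ge0.
rewrite -subr_ge0 /rr v01.
have -> : al * (U + (u k + Ul)) + be * ((V + (v k + Vl) - M) ^+ 2 + 2 * (v k + Vl)) + ka -
  (al * (U + Ul) + be * ((V + Vl - M) ^+ 2 + 2 * Vl) + ka +
    (al * u k + be * (2 * (V + Vl - M) * v k)) + 3 * (be * v k)) =
  be * (v k ^+ 2 - v k) by ring.
by rewrite v01 subrr mulr0.
Qed.

Lemma Qs_peel0 : Qs (map delta (enum I)) F (fun=> 0) <=
  al * (\sum_i u i) + be * ((\sum_i v i - M) ^+ 2 + 2 * \sum_i v i) + ka.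
Proof.
apply: (le_trans (Qs_peel (enum_uniq _) _)) => //.
rewrite !big_enum/=.
have s0 (w : I -> R) : \sum_i w i * (fun=> 0) i ^+ 2 = 0 :> R.
  by rewrite big1// => i _; rewrite expr0n mulr0.
by rewrite !s0 !add0r.
Qed.

End peel.

Section norm2.
Context {R : realType} {I : finType}.
Implicit Types x y : I -> R.

Definition norm2 x : R := Num.sqrt (\sum_i x i ^+ 2).

Lemma norm2_ge0 x : 0 <= norm2 x. Proof. exact: sqrtr_ge0. Qed.

Lemma sqr_norm2 x : norm2 x ^+ 2 = \sum_i x i ^+ 2.
Proof. by rewrite sqr_sqrtr// sumr_ge0// => i _; exact: sqr_ge0. Qed.

Lemma norm2_eq0 x : norm2 x = 0 -> forall i, x i = 0.
Proof.
move=> x0 i; have := sqr_norm2 x; rewrite x0 expr0n/= => /esym/eqP.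
rewrite psumr_eq0 => [/allP/(_ i)|j _]; last exact: sqr_ge0.
by rewrite mem_index_enum => /(_ isT); rewrite sqrf_eq0 => /eqP.
Qed.

Lemma coord_le1 x i : \sum_i x i ^+ 2 <= 1 -> `|x i| <= 1.
Proof.
move=> x1; rewrite -(@ler_pXn2r _ 2)// ?nnegrE// expr1n real_normK ?num_real//.
apply: le_trans x1; rewrite (bigD1 i)//= lerDl.
by apply: sumr_ge0 => j _; exact: sqr_ge0.
Qed.

Lemma cauchy_schwarz x y : \sum_i x i * y i <= norm2 x * norm2 y.
Proof.
have [y0|yn0] := eqVneq (norm2 y) 0.
  by rewrite y0 mulr0 big1// => i _; rewrite (norm2_eq0 y0) mulr0.
have yp : 0 < norm2 y by rewrite lt_def yn0 norm2_ge0.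
have h : 0 <= \sum_i (norm2 y * x i - norm2 x * y i) ^+ 2.
  by apply: sumr_ge0 => i _; exact: sqr_ge0.
have [x0|xn0] := eqVneq (norm2 x) 0.
  by rewrite x0 mul0r big1// => i _; rewrite (norm2_eq0 x0) mul0r.
have xp : 0 < norm2 x by rewrite lt_def xn0 norm2_ge0.
have e : \sum_i (norm2 y * x i - norm2 x * y i) ^+ 2 =
    2 * (norm2 x * norm2 y) * (norm2 x * norm2 y - \sum_i x i * y i).
  transitivity (\sum_i (norm2 y ^+ 2 * x i ^+ 2 + norm2 x ^+ 2 * y i ^+ 2
    - 2 * (norm2 x * norm2 y) * (x i * y i))).
    by apply: eq_bigr => i _; ring.
  rewrite sumrB big_split/= -!mulr_sumr -!sqr_norm2; ring.
by move: h; rewrite e pmulr_rge0 ?subr_ge0// !mulr_gt0.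
Qed.

Lemma norm2Z (s : R) x : norm2 (fun i => s * x i) = `|s| * norm2 x.
Proof.
rewrite /norm2; under eq_bigr do rewrite exprMn.
by rewrite -mulr_sumr sqrtrM ?sqr_ge0// sqrtr_sqr.
Qed.

End norm2.

Section chevet.
Context {R : realType} {D1 D2 : finType}.
Variable k0 : D1.
Variable m0 : D2.
Let K1 : R := #|D1|%:R.
Let M : R := #|D2|%:R.
Let sM : R := Num.sqrt M.

Let K1_gt0 : 0 < K1. Proof. by rewrite ltr0n; apply/card_gt0P; exists k0. Qed.
Let M_gt0 : 0 < M. Proof. by rewrite ltr0n; apply/card_gt0P; exists m0. Qed.
Let sM_gt0 : 0 < sM. Proof. by rewrite sqrtr_gt0. Qed.

Definition bform (h : D1 * D2 -> R) (x : D1 -> R) (y : D2 -> R) : R :=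
  \sum_p h p * (x p.1 * y p.2).

Lemma bform_row h x y :
  bform h x y = \sum_m (\sum_k h (k, m) * x k) * y m.
Proof.
rewrite /bform (eq_bigr (fun p => h (p.1, p.2) * (x p.1 * y p.2))); last by case.
rewrite -(pair_bigA _ (fun k m => h (k, m) * (x k * y m)))/= exchange_big/=.
by apply: eq_bigr => m _; rewrite mulr_suml; apply: eq_bigr => k _; rewrite mulrA.
Qed.

(* The comparison process of Chevet's inequality: its increments dominate
   those of the bilinear form on a product of two balls. *)
Lemma chevet_increments (x x' : D1 -> R) (y y' : D2 -> R) :
  norm2 x <= 1 -> norm2 x' <= 1 ->
  \sum_p (x p.1 * y p.2 - x' p.1 * y' p.2) ^+ 2 <=
  \sum_k (norm2 y * x k - norm2 y' * x' k) ^+ 2 + \sum_m (y m - y' m) ^+ 2.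
Proof.
move=> x1 x1'.
have e1 : \sum_p (x p.1 * y p.2 - x' p.1 * y' p.2) ^+ 2 =
    norm2 x ^+ 2 * norm2 y ^+ 2 + norm2 x' ^+ 2 * norm2 y' ^+ 2
    - 2 * (\sum_k x k * x' k) * (\sum_m y m * y' m).
  rewrite !sqr_norm2.
  transitivity (\sum_k \sum_m (x k ^+ 2 * y m ^+ 2 + x' k ^+ 2 * y' m ^+ 2
     - 2 * (x k * x' k) * (y m * y' m))).
    rewrite pair_bigA/=; apply: eq_bigr => p _; ring.
  under eq_bigr do rewrite sumrB big_split/= -!mulr_sumr.
  by rewrite sumrB big_split/= -!mulr_suml -mulr_sumr.
have e2 : \sum_k (norm2 y * x k - norm2 y' * x' k) ^+ 2 =
   norm2 y ^+ 2 * norm2 x ^+ 2 + norm2 y' ^+ 2 * norm2 x' ^+ 2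
   - 2 * (norm2 y * norm2 y') * \sum_k x k * x' k.
  transitivity (\sum_k (norm2 y ^+ 2 * x k ^+ 2 + norm2 y' ^+ 2 * x' k ^+ 2
     - 2 * (norm2 y * norm2 y') * (x k * x' k))).
    by apply: eq_bigr => p _; ring.
  by rewrite sumrB big_split/= -!mulr_sumr -!sqr_norm2.
have e3 : \sum_m (y m - y' m) ^+ 2 = norm2 y ^+ 2 + norm2 y' ^+ 2 - 2 * \sum_m y m * y' m.
  transitivity (\sum_m (y m ^+ 2 + y' m ^+ 2 - 2 * (y m * y' m))).
    by apply: eq_bigr => p _; ring.
  by rewrite sumrB big_split/= -!mulr_sumr -!sqr_norm2.
rewrite e1 e2 e3.
have c1 := cauchy_schwarz x x'; have c2 := cauchy_schwarz y y'.
have x0 := norm2_ge0 x; have x0' := norm2_ge0 x'.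
have y0 := norm2_ge0 y; have y0' := norm2_ge0 y'.
set A := \sum_k _ in c1 *; set B := \sum_m _ in c2 *.
have A1 : A <= 1 by apply: (le_trans c1); rewrite mulr_ile1.
have h1 : 0 <= (1 - A) * (norm2 y * norm2 y' - B).
  by rewrite mulr_ge0// subr_ge0.
have h2 := sqr_ge0 (norm2 y - norm2 y').
rewrite -subr_ge0; move: h1 h2; set a := norm2 x; set b := norm2 x'.
set c := norm2 y; set d := norm2 y' => h1 h2; nra.
Qed.

(** The norms |g| and |h| are replaced by polynomials whose means are accessible. AM-GM is tuned to
    the means of |g|^2, namely K1, and of (|h|^2 - M)^2, at most 2 M. For |h| > sqrt M, first |h| -
    sqrt M <= (|h|^2 - M) / (2 sqrt M). The means then add up to sqrt K1 + sqrt 2 / 2. *)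
Lemma chevet_pointwise (g : D1 -> R) (h : D2 -> R) (x : D1 -> R) (y : D2 -> R) :
  norm2 x <= 1 -> norm2 y <= 1 ->
  norm2 y * (\sum_k g k * x k) + \sum_m h m * y m - sM * norm2 y <=
  (2 * Num.sqrt K1)^-1 * (\sum_k g k ^+ 2) +
  (4 * Num.sqrt 2 * M)^-1 * (\sum_m h m ^+ 2 - M) ^+ 2 +
  (Num.sqrt K1 / 2 + Num.sqrt 2 / 4).
Proof.
move=> x1 y1.
have gx := cauchy_schwarz g x; have hy := cauchy_schwarz h y.
have g0 := norm2_ge0 g; have h0 := norm2_ge0 h.
have x0 := norm2_ge0 x; have y0 := norm2_ge0 y.
rewrite -!sqr_norm2; set G := norm2 g in g0 gx *; set H := norm2 h in h0 hy *.
set c := Num.sqrt K1; have c0 : 0 < c by rewrite sqrtr_gt0.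
set q := Num.sqrt 2; have q0 : 0 < q by rewrite sqrtr_gt0.
have q2 : q ^+ 2 = 2 by rewrite sqr_sqrtr.
have sM2 : sM ^+ 2 = M by rewrite sqr_sqrtr// ltW.
have hG : G <= (2 * c)^-1 * G ^+ 2 + c / 2.
  have : 0 <= (G - c) ^+ 2 / (2 * c) by rewrite divr_ge0 ?sqr_ge0// mulr_ge0// ltW.
  have -> : (G - c) ^+ 2 / (2 * c) = (2 * c)^-1 * G ^+ 2 + c / 2 - G.
    by field; rewrite gt_eqF.
  lra.
have hH : Num.max (H - sM) 0 <= (4 * q * M)^-1 * (H ^+ 2 - M) ^+ 2 + q / 4.
  have k1 : 0 <= (4 * q * M)^-1 * (H ^+ 2 - M) ^+ 2.
    by rewrite mulr_ge0 ?sqr_ge0// invr_ge0 !mulr_ge0// ltW.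
  have [Hs|Hs] := leP (H - sM) 0; first by rewrite addr_ge0// divr_ge0// ltW.
  have k2 : 0 <= (4 * q * M)^-1 * ((H ^+ 2 - M) - q * sM) ^+ 2.
    by rewrite mulr_ge0 ?sqr_ge0// invr_ge0 !mulr_ge0// ltW.
  have -> : (4 * q * M)^-1 * (H ^+ 2 - M) ^+ 2 + q / 4 =
     (4 * q * M)^-1 * ((H ^+ 2 - M) - q * sM) ^+ 2 + (H ^+ 2 - M) / (2 * sM).
    by rewrite -sM2; field; rewrite !gt_eqF.
  have : H - sM <= (H ^+ 2 - M) / (2 * sM).
    by rewrite ler_pdivlMr ?mulr_gt0// -sM2; nra.
  lra.
have s1 : norm2 y * (\sum_k g k * x k) <= G.
  apply: (@le_trans _ _ (norm2 y * (G * norm2 x))); first by rewrite ler_wpM2l.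
  apply: (@le_trans _ _ (1 * (G * 1))); last by rewrite mul1r mulr1.
  by rewrite ler_pM ?mulr_ge0// ler_wpM2l.
have s2 : \sum_m h m * y m - sM * norm2 y <= Num.max (H - sM) 0.
  apply: (@le_trans _ _ ((H - sM) * norm2 y)); first by rewrite mulrBl lerB.
  have [Hs|Hs] := leP (H - sM) 0; first by rewrite mulr_le0_ge0.
  by rewrite ler_piMr// ltW.
lra.
Qed.

Lemma lipschitz_bform x y : lipschitzF (fun h => bform h x y).
Proof.
apply: lipschitz_sum => p; under eq_fun do rewrite mulrC.
exact/lipschitzZ/lipschitz_coord.
Qed.

(* [m h] bounds the excess of the operator norm of [h] over [sqrt #|D2|]. *)
Lemma chevet (eps : R) : 0 < eps -> exists m : (D1 * D2 -> R) -> R,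
  [/\ lipschitzF m, forall h, 0 <= m h,
      forall h x, norm2 (fun i => \sum_k h (k, i) * x k) <= (sM + m h) * norm2 x &
      Qs (map delta (enum {: D1 * D2})) m (fun=> 0) <=
        Num.sqrt K1 + Num.sqrt 2 / 2 +
        eps * Qs (map delta (enum {: D1 * D2})) l1norm (fun=> 0)].
Proof.
move=> eps0; have e0 : 0 < eps / 2 by rewrite divr_gt0.
have [J1 [j1 [f1 [f10 f1b f1n]]]] := @ball_net R D1 _ e0.
have [J2 [j2 [f2 [f20 f2b f2n]]]] := @ball_net R D2 _ e0.
have nb1 j : norm2 (f1 j) <= 1 by rewrite -sqrtr1 ler_sqrt// f1b.
have nb2 j : norm2 (f2 j) <= 1 by rewrite -sqrtr1 ler_sqrt// f2b.
pose J := (J1 * J2)%type; pose jj : J := (j1, j2).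
(* With this offset the maximum measures the excess over sqrt M. It is nonnegative because the net
   contains 0, and the offset cancels the main part of <h, y> in the comparison process. *)
pose off (j : J) : R := - (sM * norm2 (f2 j.2)).
pose L (h : D1 * D2 -> R) (j : J) : R := off j + bform h (f1 j.1) (f2 j.2).
pose L0 (h : D1 * D2 -> R) (j : J) : R := bform h (f1 j.1) (f2 j.2).
have affL h s a : L (shift h s a) = shift (L h) s (L0 a).
  apply/funext => j; rewrite /L /L0 /shift -addrA; congr (_ + _).
  rewrite /bform mulr_sumr -big_split/=; apply: eq_bigr => p _; ring.
have LL j : lipschitzF (fun h => L h j).
  by apply: lipschitzD; [exact: lipschitz_cst|exact: lipschitz_bform].
have LF : lipschitzF (fun h => maxF jj (L h)).
  by apply: lipschitz_comp => //; exact: lipschitz_maxF.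
have Ln := @lipschitz_l1norm R (D1 * D2)%type.
have mge0 h : 0 <= maxF jj (L h) + eps * l1norm h.
  rewrite addr_ge0//; last by rewrite mulr_ge0 ?l1norm_ge0// ltW.
  apply: le_trans (le_maxF _ _ jj); rewrite /L /off /jj/=.
  have -> : norm2 (f2 j2) = 0.
    by rewrite /norm2 big1 ?sqrtr0// => i _; rewrite f20 expr0n.
  by rewrite mulr0 oppr0 add0r /bform big1// => p _; rewrite f20 !mulr0.
(* The second term pays for the net: both arguments of the bilinear form move by at most eps/2 in
   each coordinate. *)
exists (fun h => maxF jj (L h) + eps * l1norm h); split.
- by apply: lipschitzD => //; exact: lipschitzZ.
- exact: mge0.
- move=> h x.
  have key (a : D1 -> R) (b : D2 -> R) : norm2 a = 1 -> norm2 b = 1 ->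
      bform h a b <= sM + (maxF jj (L h) + eps * l1norm h).
    move=> na nb.
    have a1 : \sum_i a i ^+ 2 <= 1 by rewrite -sqr_norm2 na expr1n.
    have b1 : \sum_i b i ^+ 2 <= 1 by rewrite -sqr_norm2 nb expr1n.
    have [c cP] := f1n a a1; have [d dP] := f2n b b1.
    have nd : norm2 (f2 d) <= 1 by [].
    have : bform h a b - bform h (f1 c) (f2 d) <= eps * l1norm h.
      rewrite /bform -sumrB /l1norm mulr_sumr; apply: ler_sum => p _.
      rewrite -mulrBr (le_trans (ler_norm _))// normrM mulrC ler_wpM2r//.
      have -> : a p.1 * b p.2 - f1 c p.1 * f2 d p.2 =
         (a p.1 - f1 c p.1) * b p.2 + f1 c p.1 * (b p.2 - f2 d p.2) by ring.
      have [xa _] := cP p.1; have [yb _] := dP p.2.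
      rewrite (le_trans (ler_normD _ _))// !normrM.
      have := coord_le1 p.2 b1; have := coord_le1 p.1 (f1b c).
      have := normr_ge0 (a p.1 - f1 c p.1); have := normr_ge0 (b p.2 - f2 d p.2).
      have := normr_ge0 (b p.2); have := normr_ge0 (f1 c p.1).
      move: xa yb; nra.
    have := le_maxF jj (L h) (c, d); rewrite /L /off/=.
    have : sM * norm2 (f2 d) <= sM by rewrite ler_piMr// ltW.
    lra.
  set W := fun i => _.
  have m0h := mge0 h.
  have [x0|xn0] := eqVneq (norm2 x) 0.
    rewrite x0 mulr0 /norm2 big1 ?sqrtr0// => i _.
    by rewrite /W big1 ?expr0n// => k _; rewrite (norm2_eq0 x0) mulr0.
  have xp : 0 < norm2 x by rewrite lt_def xn0 norm2_ge0.
  have [W0|Wn0] := eqVneq (norm2 W) 0.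
    by rewrite W0 mulr_ge0// ?norm2_ge0// addr_ge0// ltW.
  have Wp : 0 < norm2 W by rewrite lt_def Wn0 norm2_ge0.
  have nx1 : norm2 (fun k => (norm2 x)^-1 * x k) = 1.
    by rewrite norm2Z ger0_norm ?invr_ge0 ?norm2_ge0// mulVf.
  have nW1 : norm2 (fun m => (norm2 W)^-1 * W m) = 1.
    by rewrite norm2Z ger0_norm ?invr_ge0 ?norm2_ge0// mulVf.
  have := key _ _ nx1 nW1.
  have -> : bform h (fun k => (norm2 x)^-1 * x k) (fun m => (norm2 W)^-1 * W m) =
      (norm2 x)^-1 * norm2 W.
    rewrite bform_row.
    transitivity (\sum_m (norm2 x)^-1 * (norm2 W)^-1 * W m ^+ 2).
      apply: eq_bigr => m _.
      rewrite (_ : \sum_k h (k, m) * ((norm2 x)^-1 * x k) = (norm2 x)^-1 * W m); first by ring.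
      by rewrite /W mulr_sumr; apply: eq_bigr => k _; ring.
    rewrite -mulr_sumr -sqr_norm2; field.
    by rewrite xn0 Wn0.
  by rewrite mulrC ler_pdivrMr.
rewrite QsD//; last exact: lipschitzZ.
rewrite QsZ// lerD2r (Qs_affine _ _ _ affL).
(* Chevet's comparison process |y| <g, x> + <h, y>, with the independent vectors g and h stored in
   the two summands of the index type. *)
pose L1 (z : D1 + D2 -> R) (j : J) : R :=
  norm2 (f2 j.2) * (\sum_k z (inl k) * f1 j.1 k) + \sum_m z (inr m) * f2 j.2 m.
pose L2 z j : R := off j + L1 z j.
have affL2 z s a : L2 (shift z s a) = shift (L2 z) s (L1 a).
  apply/funext => j; rewrite /L2 /L1 /shift -addrA; congr (_ + _).
  transitivity (norm2 (f2 j.2) * (\sum_k z (inl k) * f1 j.1 k + s * \sum_k a (inl k) * f1 j.1 k) + (\sum_m z (inr m) * f2 j.2 m + s * \sum_m a (inr m) * f2 j.2 m)); last by ring.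
  by congr (_ * _ + _); rewrite mulr_sumr -big_split/=; apply: eq_bigr => p _; ring.
have -> : L (fun=> 0) = L2 (fun=> 0).
  apply/funext => j; rewrite /L /L2 /L1 /bform; congr (_ + _).
  by rewrite !big1 ?mulr0 ?addr0// => p _; rewrite mul0r.
have L0d p j : L0 (delta p) j = f1 j.1 p.1 * f2 j.2 p.2.
  rewrite /L0 /bform (bigD1 p)//= /delta eqxx mul1r big1 ?addr0// => q /negbTE qp.
  by rewrite qp mul0r.
have L1l k j : L1 (delta (inl k)) j = norm2 (f2 j.2) * f1 j.1 k.
  rewrite /L1 (bigD1 k)//= /delta eqxx mul1r !big1 ?addr0// => [q _|q /negbTE qk].
    by rewrite mul0r.
  by rewrite (inj_eq inl_inj) qk mul0r.
have L1r m j : L1 (delta (inr m)) j = f2 j.2 m.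
  rewrite /L1 big1; last by move=> q _; rewrite /delta mul0r.
  rewrite mulr0 add0r (bigD1 m)//= /delta eqxx mul1r !big1 ?addr0// => q /negbTE qk.
  by rewrite (inj_eq inr_inj) qk mul0r.
pose lb := map L1 (map delta (enum {: D1 + D2})).
apply: (@le_trans _ _ (Qs lb (maxF jj) (L2 (fun=> 0)))).
  apply: sudakov_fernique => i j.
  rewrite /lb !sum_map_delta big_sumType/=.
  under eq_bigr do rewrite !L0d.
  under [X in _ <= X + _]eq_bigr do rewrite !L1l.
  under [X in _ <= _ + X]eq_bigr do rewrite !L1r.
  exact: chevet_increments.
rewrite -(Qs_affine _ _ _ affL2).
have LL2 : lipschitzF (fun z => maxF jj (L2 z)).
  apply: lipschitz_comp; first exact: lipschitz_maxF.
  move=> j; apply: lipschitzD; first exact: lipschitz_cst.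
  apply: lipschitzD; first apply: lipschitzZ.
    by apply: lipschitz_sum => k; under eq_fun do rewrite mulrC; exact/lipschitzZ/lipschitz_coord.
  by apply: lipschitz_sum => k; under eq_fun do rewrite mulrC; exact/lipschitzZ/lipschitz_coord.
pose u (i : D1 + D2) : R := if i is inl _ then 1 else 0.
pose v (i : D1 + D2) : R := if i is inl _ then 0 else 1.
have := @Qs_peel0 _ _ u v M (2 * Num.sqrt K1)^-1 (4 * Num.sqrt 2 * M)^-1
  (Num.sqrt K1 / 2 + Num.sqrt 2 / 4) _ _ _ LL2.
have -> : \sum_i u i = K1 by rewrite big_sumType/= sumr_const big1// addr0.
have -> : \sum_i v i = M by rewrite big_sumType/= big1// add0r sumr_const.
move=> h; apply: (le_trans (h _ _ _)).
- by move=> [?|?]; rewrite /v ?expr0n ?expr1n.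
- by rewrite invr_ge0 !mulr_ge0 ?sqrtr_ge0// ltW.
- move=> z.
  have -> : \sum_i u i * z i ^+ 2 = \sum_k z (inl k) ^+ 2.
    rewrite big_sumType/= [X in _ + X]big1 ?addr0; last by move=> ? _; rewrite mul0r.
    by apply: eq_bigr => k _; rewrite mul1r.
  have -> : \sum_i v i * z i ^+ 2 = \sum_m z (inr m) ^+ 2.
    rewrite big_sumType/= [X in X + _]big1 ?add0r; last by move=> ? _; rewrite mul0r.
    by apply: eq_bigr => k _; rewrite mul1r.
  apply: maxF_le => j; rewrite /L2 /L1 /off addrC.
  exact: chevet_pointwise.
- have c0 : 0 < Num.sqrt K1 by rewrite sqrtr_gt0.
  have q0 : 0 < Num.sqrt 2 :> R by rewrite sqrtr_gt0.
  have e1 : Num.sqrt K1 ^+ 2 = K1 by rewrite sqr_sqrtr// ltW.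
  have e2 : Num.sqrt 2 ^+ 2 = 2 :> R by rewrite sqr_sqrtr.
  rewrite subrr expr0n add0r -{2}e1.
  rewrite le_eqVlt; apply/orP; left; apply/eqP.
  transitivity (Num.sqrt K1 + (2 / Num.sqrt 2 / 4 + Num.sqrt 2 / 4)).
    by field; rewrite !gt_eqF.
  by rewrite -{1}e2; field; rewrite gt_eqF.
Qed.

End chevet.

Local Open Scope complex_scope.
Local Open Scope sesquilinear_scope.

(** * Hermitian matrices *)

Section inner_product.
Variable R : realType.
Local Notation C := R[i].
Local Notation Re := (@complex.Re R).
Local Notation Im := (@complex.Im R).
Implicit Types (x y : C).

Lemma conjCE x : Num.conj x = Re x +i* - Im x. Proof. by case: x. Qed.
Lemma Re_add x y : Re (x + y) = Re x + Re y. Proof. by case: x; case: y. Qed.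
Lemma Im_add x y : Im (x + y) = Im x + Im y. Proof. by case: x; case: y. Qed.
Lemma Re_sub x y : Re (x - y) = Re x - Re y. Proof. by case: x; case: y. Qed.
Lemma Im_sub x y : Im (x - y) = Im x - Im y. Proof. by case: x; case: y. Qed.
Lemma Re_mul x y : Re (x * y) = Re x * Re y - Im x * Im y.
Proof. by case: x; case: y. Qed.
Lemma Im_mul x y : Im (x * y) = Re x * Im y + Im x * Re y.
Proof. by case: x; case: y. Qed.
Lemma Re_scale (a : R) y : Re (a%:C * y) = a * Re y.
Proof. by rewrite Re_mul /= mul0r subr0. Qed.
Lemma Im_scale (a : R) y : Im (a%:C * y) = a * Im y.
Proof. by rewrite Im_mul /= mul0r addr0. Qed.
Lemma Re_sum I (r : seq I) (Q : pred I) (f : I -> C) :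
  Re (\sum_(i <- r | Q i) f i) = \sum_(i <- r | Q i) Re (f i).
Proof. exact: (big_morph _ Re_add erefl). Qed.
Lemma Im_sum I (r : seq I) (Q : pred I) (f : I -> C) :
  Im (\sum_(i <- r | Q i) f i) = \sum_(i <- r | Q i) Im (f i).
Proof. exact: (big_morph _ Im_add erefl). Qed.
Lemma complex_eq x y : Re x = Re y -> Im x = Im y -> x = y.
Proof. by case: x => a b; case: y => c e /= -> ->. Qed.

Lemma adjE p q (A : 'M[C]_(p, q)) i j : A^t* i j = Num.conj (A j i).
Proof. by rewrite !mxE. Qed.

Lemma adjM p q s (A : 'M[C]_(p, q)) (B : 'M[C]_(q, s)) :
  (A *m B)^t* = B^t* *m A^t*.
Proof. by rewrite trmx_mul map_mxM. Qed.

Lemma adjD p q (A B : 'M[C]_(p, q)) : (A + B)^t* = A^t* + B^t*.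
Proof. by rewrite raddfD /= map_mxD. Qed.

Lemma adjB p q (A B : 'M[C]_(p, q)) : (A - B)^t* = A^t* - B^t*.
Proof. by rewrite raddfB /= map_mxB. Qed.

Lemma adjZ p q (a : R) (A : 'M[C]_(p, q)) : (a%:C *: A)^t* = a%:C *: A^t*.
Proof.
by apply/matrixP => i j; rewrite !mxE rmorphM /=; congr (_ * _); rewrite conjCE /= oppr0.
Qed.

Lemma adj_sum p q I (r : seq I) (Q : pred I) (A : I -> 'M[C]_(p, q)) :
  (\sum_(i <- r | Q i) A i)^t* = \sum_(i <- r | Q i) (A i)^t*.
Proof.
apply: (big_morph (fun A : 'M[C]_(p, q) => A^t*) (@adjD _ _)).
by apply/matrixP => i j; rewrite !mxE rmorph0.
Qed.

Lemma adj1 p : (1%:M : 'M[C]_p)^t* = 1%:M.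
Proof. by rewrite trmx1 map_mx1. Qed.

Lemma hermE p (A : 'M[C]_p) : (A \is hermsymmx) <-> A^t* = A.
Proof.
split=> [/is_hermitianmxP h|h]; first by rewrite {2}h expr0 scale1r.
by apply/is_hermitianmxP; rewrite expr0 scale1r.
Qed.

(** The Euclidean inner product of the 2pq real coordinates. Gaussian comparison is a real theory,
    hence the real part. *)
Definition ip p q (A B : 'M[C]_(p, q)) : R := Re (\tr (A^t* *m B)).

Definition frob p q (A : 'M[C]_(p, q)) : R := ip A A.

Lemma ipE p q (A B : 'M[C]_(p, q)) :
  ip A B = \sum_i \sum_j (Re (A i j) * Re (B i j) + Im (A i j) * Im (B i j)).
Proof.
rewrite /ip /mxtrace Re_sum exchange_big /=.
apply: eq_bigr => j _; rewrite mxE Re_sum; apply: eq_bigr => i _.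
by rewrite adjE conjCE Re_mul /= mulNr opprK.
Qed.

Lemma ipC p q (A B : 'M[C]_(p, q)) : ip A B = ip B A.
Proof.
rewrite !ipE; apply: eq_bigr => i _; apply: eq_bigr => j _.
by rewrite mulrC [X in _ + X]mulrC.
Qed.

Lemma ipDl p q (A B D : 'M[C]_(p, q)) : ip (A + B) D = ip A D + ip B D.
Proof. by rewrite /ip adjD mulmxDl mxtraceD Re_add. Qed.

Lemma ipBl p q (A B D : 'M[C]_(p, q)) : ip (A - B) D = ip A D - ip B D.
Proof. by rewrite /ip adjB mulmxBl raddfB /= Re_sub. Qed.

Lemma ipZl p q (a : R) (A B : 'M[C]_(p, q)) : ip (a%:C *: A) B = a * ip A B.
Proof. by rewrite /ip adjZ -scalemxAl mxtraceZ Re_scale. Qed.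

Lemma ipDr p q (A B D : 'M[C]_(p, q)) : ip D (A + B) = ip D A + ip D B.
Proof. by rewrite ipC ipDl !(ipC D). Qed.

Lemma ipBr p q (A B D : 'M[C]_(p, q)) : ip D (A - B) = ip D A - ip D B.
Proof. by rewrite ipC ipBl !(ipC D). Qed.

Lemma ipZr p q (a : R) (A B : 'M[C]_(p, q)) : ip B (a%:C *: A) = a * ip B A.
Proof. by rewrite ipC ipZl ipC. Qed.

Lemma ip0l p q (B : 'M[C]_(p, q)) : ip 0 B = 0.
Proof. by rewrite -[0](subrr 0) ipBl subrr. Qed.

Lemma ip_suml p q I (r : seq I) (Q : pred I) (A : I -> 'M[C]_(p, q)) B :
  ip (\sum_(i <- r | Q i) A i) B = \sum_(i <- r | Q i) ip (A i) B.
Proof.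
by apply: (big_morph (fun A => ip A B)) => [X Y|]; [exact: ipDl | exact: ip0l].
Qed.

Lemma ip_sumr p q I (r : seq I) (Q : pred I) (A : I -> 'M[C]_(p, q)) B :
  ip B (\sum_(i <- r | Q i) A i) = \sum_(i <- r | Q i) ip B (A i).
Proof. by rewrite ipC ip_suml; apply: eq_bigr => i _; exact: ipC. Qed.

Lemma ip_mull p q s (D : 'M[C]_(p, q)) (A : 'M[C]_(q, s)) B :
  ip (D *m A) B = ip A (D^t* *m B).
Proof. by rewrite /ip adjM mulmxA. Qed.

Lemma ip_adj p q (A B : 'M[C]_(p, q)) : ip (A^t*) (B^t*) = ip A B.
Proof. by rewrite ipC /ip trmxCK mxtrace_mulC. Qed.

Lemma frob_ge0 p q (A : 'M[C]_(p, q)) : 0 <= frob A.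
Proof.
rewrite /frob ipE; apply: sumr_ge0 => i _; apply: sumr_ge0 => j _.
by rewrite -!expr2 addr_ge0 ?sqr_ge0.
Qed.

Lemma frobE p q (A : 'M[C]_(p, q)) :
  frob A = \sum_i \sum_j (Re (A i j) ^+ 2 + Im (A i j) ^+ 2).
Proof.
by rewrite /frob ipE; apply: eq_bigr => i _; apply: eq_bigr => j _; rewrite !expr2.
Qed.

Lemma frob_eq0 p q (A : 'M[C]_(p, q)) : frob A = 0 -> A = 0.
Proof.
rewrite frobE => /eqP; rewrite psumr_eq0; last first.
  by move=> i _; apply: sumr_ge0 => j _; rewrite addr_ge0 ?sqr_ge0.
move=> /allP h; apply/matrixP => i j.
have := h i (mem_index_enum _); rewrite /=.
rewrite psumr_eq0; last by move=> k _; rewrite addr_ge0 ?sqr_ge0.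
move=> /allP /(_ j (mem_index_enum _)) /=.
rewrite paddr_eq0 ?sqr_ge0// !sqrf_eq0 mxE => /andP[/eqP a /eqP b].
exact: complex_eq.
Qed.

Lemma frobD p q (A B : 'M[C]_(p, q)) : frob (A + B) = frob A + 2 * ip A B + frob B.
Proof. by rewrite /frob !ipDl !ipDr (ipC B A); ring. Qed.

Lemma frobB p q (A B : 'M[C]_(p, q)) : frob (A - B) = frob A - 2 * ip A B + frob B.
Proof. by rewrite /frob !ipBl !ipBr (ipC B A); ring. Qed.

Lemma frobZ p q (a : R) (A : 'M[C]_(p, q)) : frob (a%:C *: A) = a ^+ 2 * frob A.
Proof. by rewrite /frob ipZl ipZr; ring. Qed.

Lemma frob_adj p q (A : 'M[C]_(p, q)) : frob (A^t*) = frob A.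
Proof. exact: ip_adj. Qed.

Lemma ip_amgm p q (A B : 'M[C]_(p, q)) : 2 * ip A B <= frob A + frob B.
Proof. have := frob_ge0 (A - B); rewrite frobB; lra. Qed.

Lemma ip_cs p q (A B : 'M[C]_(p, q)) : ip A B <= Num.sqrt (frob A) * Num.sqrt (frob B).
Proof.
have A0 := frob_ge0 A; have B0 := frob_ge0 B.
have := frob_ge0 ((Num.sqrt (frob B))%:C *: A - (Num.sqrt (frob A))%:C *: B).
rewrite frobB !frobZ ipZl ipZr !sqr_sqrtr//.
set a := Num.sqrt (frob A); set b := Num.sqrt (frob B) => h.
have [a0|a0] := eqVneq a 0.
  have : frob A = 0 by apply/eqP; rewrite eq_le A0 andbT -sqrtr_eq0 -/a a0.
  by move=> /frob_eq0 ->; rewrite ip0l mulr_ge0 ?sqrtr_ge0.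
have [b0|b0] := eqVneq b 0.
  have : frob B = 0 by apply/eqP; rewrite eq_le B0 andbT -sqrtr_eq0 -/b b0.
  by move=> /frob_eq0 ->; rewrite ipC ip0l mulr_ge0 ?sqrtr_ge0.
have ha : 0 < a by rewrite lt_neqAle eq_sym a0 sqrtr_ge0.
have hb : 0 < b by rewrite lt_neqAle eq_sym b0 sqrtr_ge0.
have eA : frob A = a ^+ 2 by rewrite sqr_sqrtr.
have eB : frob B = b ^+ 2 by rewrite sqr_sqrtr.
rewrite eA eB in h.
have : 0 <= 2 * (a * b) * (a * b - ip A B) by move: h; lra.
by rewrite pmulr_rge0 ?subr_ge0// !mulr_gt0.
Qed.

End inner_product.

(** * Spectral theorem, extreme eigenvalues, operator norm and Gram factors *)

Section spectral.
Variable R : realType.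
Local Notation C := R[i].
Local Notation Re := (@complex.Re R).
Local Notation Im := (@complex.Im R).

Lemma frob_unitary p q (U : 'M[C]_p) (V : 'M[C]_(p, q)) :
  U^t* *m U = 1%:M -> frob (U *m V) = frob V.
Proof. by move=> h; rewrite /frob ip_mull mulmxA h mul1mx. Qed.

Variant spectral_spec p (A : 'M[C]_p) : Prop :=
  SpectralSpec U (d : 'I_p -> R) of U^t* *m U = 1%:M & U *m U^t* = 1%:M
    & A = U^t* *m diag_mx (\row_i (d i)%:C) *m U.

Lemma herm_spectral p (A : 'M[C]_p) : A \is hermsymmx -> spectral_spec A.
Proof.
move=> hA; have nA := hermitian_normalmx hA.
have /unitarymxP uU := spectral_unitarymx A.
have iU := invmx_unitary (spectral_unitarymx A).
exists (spectralmx A) (fun i => Re (spectral_diag A 0 i)) => //.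
  by rewrite -iU mulVmx// spectral_unit.
suff E : \row_i (Re (spectral_diag A 0 i))%:C = spectral_diag A.
  by rewrite E -iU; exact/orthomx_spectralP.
apply/rowP => i; rewrite mxE.
have /mxOverP/(_ 0 i) := hermitian_spectral_diag_real hA.
by move=> /RRe_real ->.
Qed.

Section diagonalized.
Variables (p : nat) (U : 'M[C]_p) (d : 'I_p -> R).
Hypotheses (UU1 : U^t* *m U = 1%:M) (UU2 : U *m U^t* = 1%:M).
Let A := U^t* *m diag_mx (\row_i (d i)%:C) *m U.

Lemma frob_rows q (W : 'M[C]_(p, q)) : frob W = \sum_i frob (row i W).
Proof.
rewrite frobE; apply: eq_bigr => i _; rewrite frobE big_ord1.
by apply: eq_bigr => j _; rewrite !mxE.
Qed.

Lemma ip_diag q (W : 'M[C]_(p, q)) :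
  ip W (diag_mx (\row_i (d i)%:C) *m W) = \sum_i d i * frob (row i W).
Proof.
rewrite ipE; apply: eq_bigr => i _; rewrite frobE big_ord1 mulr_sumr.
by apply: eq_bigr => j _; rewrite mul_diag_mx !mxE Re_scale Im_scale; ring.
Qed.

Lemma ip_spectral q (V : 'M[C]_(p, q)) :
  ip V (A *m V) = \sum_i d i * frob (row i (U *m V)).
Proof. by rewrite -ip_diag ip_mull /A !mulmxA. Qed.

Lemma frob_spectral q (V : 'M[C]_(p, q)) :
  frob (A *m V) = \sum_i d i ^+ 2 * frob (row i (U *m V)).
Proof.
have -> : frob (A *m V) = frob (diag_mx (\row_i (d i)%:C) *m (U *m V)).
  by rewrite /A -!mulmxA [LHS](frob_unitary (U := U^t*)) ?trmxCK.
rewrite frob_rows; apply: eq_bigr => i _; rewrite -frobZ; congr frob.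
by rewrite mul_diag_mx; apply/rowP => j; rewrite !mxE.
Qed.

Lemma spectral_vector i (v := U^t* *m delta_mx i (0 : 'I_1)) :
  frob v = 1 /\ A *m v = (d i)%:C *: v.
Proof.
split.
  rewrite frob_unitary ?trmxCK// frobE (bigD1 i)//= big_ord1 mxE !eqxx/=.
  rewrite expr1n expr0n addr0 big1 ?addr0// => j ji.
  by rewrite big_ord1 mxE (negbTE ji) expr0n addr0.
rewrite /A /v -!mulmxA (mulmxA U) UU2 mul1mx scalemxAr; congr (_ *m _).
apply/matrixP => k l; rewrite mul_diag_mx !mxE.
by have [->|_] := eqVneq k i; rewrite ?mulr0.
Qed.

Lemma spectral_eigenvalue x : eigenvalue A x%:C <-> exists i, d i = x.
Proof.
split=> [/eigenvalueP[v hv v0]|[i <-]].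
  have w0 : v *m U^t* != 0.
    by apply: contra v0 => /eqP h; rewrite -[v]mulmx1 -UU1 mulmxA h mul0mx.
  have hw : (v *m U^t*) *m diag_mx (\row_i (d i)%:C) = x%:C *: (v *m U^t*).
    by rewrite scalemxAl -hv /A -!mulmxA UU2 mulmx1.
  have /rV0Pn[i wi0] := w0; exists i; apply: (@complexI R).
  move/rowP/(_ i): hw; rewrite mul_mx_diag !mxE mulrC => /(mulIf _); apply.
  by move: wi0; rewrite !mxE.
apply/eigenvalueP; exists (row i U).
  rewrite /A -row_mul !mulmxA UU2 mul1mx row_mul; apply/rowP => j.
  rewrite !mxE (bigD1 i)//= !mxE eqxx mulr1n big1 ?addr0 ?mxE// => k ki.
  by rewrite !mxE eq_sym (negbTE ki) mulr0n mul0r.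
apply/negP => /eqP h.
have : row i (U *m U^t*) = 0 by rewrite row_mul h mul0mx.
by rewrite UU2 => /rowP/(_ i)/eqP; rewrite !mxE eqxx oner_eq0.
Qed.

Lemma spectral_lambda_max : (0 < p)%N ->
  (exists i, d i = lambda_max A) /\ forall i, d i <= lambda_max A.
Proof.
move=> p0; have [/= m _ hm] := arg_maxP d (isT : xpredT (Ordinal p0)).
have E : lambda_max A = d m.
  apply/eqP; rewrite eq_le; apply/andP; split.
    apply: ge_sup; first by exists (d m); apply/spectral_eigenvalue; exists m.
    by move=> x /spectral_eigenvalue[i <-]; exact: hm.
  apply: ub_le_sup; last by apply/spectral_eigenvalue; exists m.
  by exists (d m) => x /spectral_eigenvalue[i <-]; exact: hm.
by rewrite E; split=> [|i]; [exists m | exact: hm].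
Qed.

End diagonalized.

Lemma lambda_max_attained p (A : 'M[C]_p) : (0 < p)%N -> A \is hermsymmx ->
  exists v : 'cV[C]_p, frob v = 1 /\ ip v (A *m v) = lambda_max A.
Proof.
move=> p0 /herm_spectral[U d U1 U2 ->].
have [[i <-] _] := spectral_lambda_max d U1 U2 p0.
have [f1 fv] := spectral_vector d U2 i; eexists; split; first exact: f1.
by rewrite fv ipZr -/(frob _) f1 mulr1.
Qed.

Lemma lambda_max_ge p q (A : 'M[C]_p) (V : 'M[C]_(p, q)) : A \is hermsymmx ->
  ip V (A *m V) <= lambda_max A * frob V.
Proof.
case: p A V => [A V _|p A V]; first by rewrite ipE frobE !big_ord0 mulr0.
move=> /herm_spectral[U d U1 U2 ->].
have [_ dm] := spectral_lambda_max d U1 U2 (ltn0Sn p).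
rewrite ip_spectral// -[in leRHS](frob_unitary V U1) [in leRHS]frob_rows mulr_sumr.
by apply: ler_sum => i _; apply: ler_wpM2r; [exact: frob_ge0 | exact: dm].
Qed.

Lemma lambda_minE p (A : 'M[C]_p) : lambda_min A = - lambda_max (- A).
Proof.
rewrite /lambda_min /lambda_max /inf; congr (- sup _).
apply/seteqP; split=> x /=.
  move=> [y /= /eigenvalueP[v vA v0] <-]; apply/eigenvalueP; exists v => //.
  by rewrite mulmxN vA rmorphN scaleNr.
move=> /eigenvalueP[v vA v0]; exists (- x); rewrite ?opprK//=.
apply/eigenvalueP; exists v => //.
by rewrite rmorphN scaleNr -vA mulmxN opprK.
Qed.

Lemma euclid_normE p (v : 'cV[C]_p) : euclid_norm v = Num.sqrt (frob v).
Proof.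
rewrite /euclid_norm frobE; congr Num.sqrt; apply: eq_bigr => i _.
rewrite big_ord1; case: (v i 0) => a b /=.
by rewrite sqr_sqrtr// addr_ge0 ?sqr_ge0.
Qed.

Lemma frob_mul_herm p q (A : 'M[C]_p) (c : R) (V : 'M[C]_(p, q)) :
  A \is hermsymmx ->
  (forall v : 'cV[C]_p, ip v (A *m v) <= c * frob v) ->
  (forall v : 'cV[C]_p, - c * frob v <= ip v (A *m v)) ->
  frob (A *m V) <= c ^+ 2 * frob V.
Proof.
move=> /herm_spectral[U d U1 U2 ->] h1 h2.
rewrite frob_spectral// -[in leRHS](frob_unitary V U1) [in leRHS]frob_rows mulr_sumr.
apply: ler_sum => i _; apply: ler_wpM2r; first exact: frob_ge0.
have [f1 fv] := spectral_vector d U2 i.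
have := h1 _ ; move/(_ (U^t* *m delta_mx i (0 : 'I_1))).
have := h2 _ ; move/(_ (U^t* *m delta_mx i (0 : 'I_1))).
by rewrite fv ipZr -/(frob _) f1 !mulr1; nra.
Qed.

Lemma opnorm_le p (A : 'M[C]_p) (c : R) : A \is hermsymmx -> 0 <= c ->
  (forall v : 'cV[C]_p, ip v (A *m v) <= c * frob v) ->
  (forall v : 'cV[C]_p, - c * frob v <= ip v (A *m v)) ->
  ubound [set euclid_norm (A *m v) | v in [set v : 'cV[C]_p | euclid_norm v <= 1]] c.
Proof.
move=> hA c0 h1 h2 _ [v /= v1 <-]; rewrite euclid_normE.
rewrite -[leRHS](ger0_norm c0) -sqrtr_sqr ler_sqrt ?sqr_ge0//.
apply: (le_trans (frob_mul_herm _ hA h1 h2)).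
rewrite -[leRHS]mulr1 ler_wpM2l ?sqr_ge0//.
have := frob_ge0 v; move: v1; rewrite euclid_normE -{1}[1]sqrtr1 ler_sqrt //.
Qed.

(** Provides an upper bound for the set defining [opnorm], so that its [sup] is a genuine
    supremum. *)
Lemma herm_bounded p (A : 'M[C]_p) : A \is hermsymmx -> exists c, [/\ 0 <= c,
  forall v : 'cV[C]_p, ip v (A *m v) <= c * frob v &
  forall v : 'cV[C]_p, - c * frob v <= ip v (A *m v)].
Proof.
move=> hA; have hN : - A \is hermsymmx.
  by apply/hermE; move/hermE: hA => {2}<-; rewrite raddfN/= map_mxN.
exists (`|lambda_max A| + `|lambda_max (- A)|); split=> [|v|v].
- by rewrite addr_ge0.
- apply: (le_trans (lambda_max_ge v hA)); apply: ler_wpM2r; first exact: frob_ge0.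
  by apply: (le_trans (ler_norm _)); rewrite lerDl.
- rewrite mulNr lerNl.
  have := lambda_max_ge v hN; rewrite mulNmx -[X in ip _ X]sub0r ipBr ipC ip0l sub0r.
  move=> /le_trans; apply; apply: ler_wpM2r; first exact: frob_ge0.
  by apply: (le_trans (ler_norm _)); rewrite lerDr.
Qed.

Lemma opnorm_ge p (A : 'M[C]_p) (v : 'cV[C]_p) : A \is hermsymmx ->
  frob v <= 1 -> Num.sqrt (frob (A *m v)) <= opnorm A.
Proof.
move=> hA v1; rewrite -euclid_normE.
have [c [c0 h1 h2]] := herm_bounded hA.
apply: ub_le_sup; first by exists c; exact: opnorm_le.
by exists v => //=; rewrite euclid_normE -sqrtr1 ler_wsqrtr.
Qed.

Lemma opnorm_ge0 p (A : 'M[C]_p) : A \is hermsymmx -> 0 <= opnorm A.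
Proof.
move=> hA; apply: (le_trans _ (@opnorm_ge _ A 0 hA _)); first exact: sqrtr_ge0.
by rewrite /frob ip0l ler01.
Qed.

Lemma ip_le_opnorm p q (A : 'M[C]_p) (V : 'M[C]_(p, q)) : A \is hermsymmx ->
  ip V (A *m V) <= opnorm A * frob V.
Proof.
move=> hA; have [p0|p0] := posnP p.
  by subst p; rewrite ipE frobE !big_ord0 mulr0.
apply: (le_trans (lambda_max_ge V hA)); apply: ler_wpM2r; first exact: frob_ge0.
have [v [v1 <-]] := lambda_max_attained p0 hA.
apply: (le_trans (ip_cs _ _)); rewrite v1 sqrtr1 mul1r.
by apply: opnorm_ge => //; rewrite v1.
Qed.

Lemma opnorm_le_max p (A : 'M[C]_p) (c : R) : (0 < p)%N -> A \is hermsymmx ->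
  lambda_max A <= c -> - c <= lambda_min A -> opnorm A <= c.
Proof.
move=> p0 hA h1; rewrite lambda_minE lerN2 => h2.
have hN : - A \is hermsymmx.
  by apply/hermE; move/hermE: hA => {2}<-; rewrite raddfN/= map_mxN.
have c0 : 0 <= c.
  have [v [v1 hv]] := lambda_max_attained p0 hA.
  have := lambda_max_ge v hN.
  rewrite mulNmx -[X in ip _ X]sub0r ipBr ipC ip0l sub0r v1 hv mulr1.
  by move: (lambda_max A) (lambda_max (- A)) h1 h2 => a b; lra.
apply: ge_sup.
  by exists (euclid_norm (A *m 0)); exists 0 => //=; rewrite euclid_normE /frob ip0l sqrtr0.
apply: opnorm_le => // v.
  apply: (le_trans (lambda_max_ge v hA)); apply: ler_wpM2r; last exact: h1.
  exact: frob_ge0.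
rewrite mulNr lerNl.
have := lambda_max_ge v hN; rewrite mulNmx -[X in ip _ X]sub0r ipBr ipC ip0l sub0r.
move=> /le_trans; apply; apply: ler_wpM2r; last exact: h2.
exact: frob_ge0.
Qed.

Lemma psd_factor p (A : 'M[C]_p) : A \is hermsymmx ->
  (forall v : 'cV[C]_p, 0 <= ip v (A *m v)) ->
  exists D : 'M[C]_p, A = D^t* *m D.
Proof.
move=> /herm_spectral[U d U1 U2 ->] h.
have d0 i : 0 <= d i.
  have [f1 fv] := spectral_vector d U2 i.
  by move: (h (U^t* *m delta_mx i (0 : 'I_1))); rewrite fv ipZr -/(frob _) f1 mulr1.
exists (diag_mx (\row_i (Num.sqrt (d i))%:C) *m U); rewrite adjM mulmxA.
congr (_ *m _); rewrite -mulmxA; congr (_ *m _).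
rewrite mul_mx_diag; apply/matrixP => i j; rewrite !mxE.
have [->|ij] := eqVneq j i; last by rewrite mulr0n conjC0 mul0r.
rewrite !mulr1n conjCE /= oppr0 -[X in _ = X * _]/((Num.sqrt (d i))%:C).
by rewrite -rmorphM/= -expr2 sqr_sqrtr.
Qed.

Lemma possemidef_factor p (A : 'M[C]_p) : possemidefmx A ->
  exists D : 'M[C]_p, A = D^t* *m D.
Proof.
move=> [hA h]; apply: psd_factor => // v.
rewrite /ip mulmxA /mxtrace big_ord1; have := h v.
by rewrite lecE => /andP[_].
Qed.

Lemma posdef_factor p (A : 'M[C]_p) : posdefmx A ->
  A \in unitmx /\ exists D : 'M[C]_p, A = D^t* *m D.
Proof.
move=> [hA h]; split; last first.
  apply: possemidef_factor; split=> // v; have [->|v0] := eqVneq v 0.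
    by rewrite /quad_form mulmx0 mxE.
  exact/ltW/h.
rewrite -unitmx_tr -row_free_unit -kermx_eq0; apply/negPn/negP => /rowV0Pn[v].
move=> /sub_kermxP hv v0.
have := h v^T; rewrite -trmx_eq0 trmxK => /(_ v0).
rewrite /quad_form -mulmxA -[A *m _]trmxK trmx_mul trmxK hv trmx0 mulmx0 mxE.
by rewrite ltxx.
Qed.

Lemma gram_herm p q (D : 'M[C]_(p, q)) : D^t* *m D \is hermsymmx.
Proof. by apply/hermE; rewrite adjM trmxCK. Qed.

(** Trades the p rows of [D] for q. Applied to the adjoint of the N x M matrix D_j V, it gives a
    factor of size N x N, which keeps M out of the number of Gaussian rows. *)
Lemma gram_factor p q (D : 'M[C]_(p, q)) :
  exists T : 'M[C]_q, D^t* *m D = T^t* *m T.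
Proof.
apply: psd_factor (gram_herm _) _ => v.
by rewrite -mulmxA -{1}[D]trmxCK -ip_mull trmxCK; exact: frob_ge0.
Qed.

End spectral.

(** * The comparison process *)

Section comparison.
Variable R : realType.
Local Notation C := R[i].
Local Notation Re := (@complex.Re R).
Local Notation Im := (@complex.Im R).

Lemma ip_tr_eq p q (A B : 'M[C]_(p, q)) p' q' (A' B' : 'M[C]_(p', q')) :
  \tr (A^t* *m B) = \tr (A'^t* *m B') -> ip A B = ip A' B'.
Proof. by rewrite /ip => ->. Qed.

Lemma tr_sum p I (l : seq I) (Q : pred I) (A : I -> 'M[C]_p) :
  \tr (\sum_(i <- l | Q i) A i) = \sum_(i <- l | Q i) \tr (A i).
Proof. exact: (big_morph _ (@mxtraceD _ _) (@mxtrace0 _ _)). Qed.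

(** [eta] is self-adjoint for the trace. This moves it from V V^* to the identity or to Z^-1. *)
Lemma tr_eta n N M (A : 'I_n -> 'M[C]_N) X (V : 'M[C]_(N, M)) :
  \tr (X *m eta A (V *m V^t*)) = \tr (V^t* *m eta A X *m V).
Proof.
rewrite /eta !mulmx_sumr mulmx_suml !tr_sum; apply: eq_bigr => i _.
by rewrite !mulmxA [LHS]mxtrace_mulC -!mulmxA [RHS]mxtrace_mulC -!mulmxA.
Qed.

(* The pair (y, y') and the square factors T, T' of y y^*, y' y'^* satisfy
   |y^* y - y'^* y'|^2 <= 2 |T y - T' y'|^2. *)
Lemma gram_increments p q s (y y' : 'M[C]_(p, q)) (T T' : 'M[C]_(s, p)) :
  T^t* *m T = y *m y^t* -> T'^t* *m T' = y' *m y'^t* ->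
  frob (y^t* *m y - y'^t* *m y') <= 2 * frob (T *m y - T' *m y').
Proof.
move=> hT hT'.
have nT q' (z : 'M[C]_(p, q')) (S : 'M[C]_(s, p)) : S^t* *m S = z *m z^t* ->
    frob (S *m z) = frob (z^t* *m z).
  move=> hS; rewrite /frob; apply: ip_tr_eq.
  by rewrite !adjM trmxCK -!mulmxA (mulmxA (S^t*)) hS !mulmxA.
have nTT q' (z : 'M[C]_(p, q')) (S : 'M[C]_(s, p)) : S^t* *m S = z *m z^t* ->
    frob (S *m S^t*) = frob (z^t* *m z).
  move=> hS; rewrite /frob; apply: ip_tr_eq.
  rewrite !adjM !trmxCK -!mulmxA mxtrace_mulC -!mulmxA hS (mulmxA (S^t*)) hS.
  by rewrite -!mulmxA mxtrace_mulC -!mulmxA.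
(* Two uses of AM-GM: the cross term is at most half of |y y'^*|^2 + |T^* T'|^2. The first summand
   is the wanted <y^* y, y'^* y'>, and the second is <T T^*, T' T'^*>, at most half of |y^* y|^2 +
   |y'^* y'|^2. *)
have cross : ip (T *m y) (T' *m y') = ip (y *m y'^t*) (T^t* *m T').
  apply: ip_tr_eq; rewrite !adjM trmxCK -!mulmxA [RHS]mxtrace_mulC.
  by rewrite -!mulmxA.
have crossP : frob (y *m y'^t*) = ip (y^t* *m y) (y'^t* *m y').
  by rewrite /frob; apply: ip_tr_eq; rewrite !adjM !trmxCK -!mulmxA
    mxtrace_mulC -!mulmxA.
have crossT : frob (T^t* *m T') = ip (T *m T^t*) (T' *m T'^t*).
  by rewrite /frob; apply: ip_tr_eq; rewrite !adjM !trmxCK -!mulmxA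
    mxtrace_mulC -!mulmxA.
rewrite !frobB (nT _ _ _ hT) (nT _ _ _ hT') cross.
have := ip_amgm (y *m y'^t*) (T^t* *m T').
have := ip_amgm (T *m T^t*) (T' *m T'^t*).
rewrite crossP crossT (nTT _ _ _ hT) (nTT _ _ _ hT').
move: (frob (y^t* *m y)) (frob (y'^t* *m y')) (ip (y^t* *m y) _).
by move: (ip _ _) (ip _ _) => *; lra.
Qed.

Section eta_swap.
Variables (n r N M : nat) (A : 'I_n -> 'M[C]_N) (At : 'I_r -> 'M[C]_N).
Hypothesis A_herm : forall i, A i \is hermsymmx.
Hypothesis At_herm : forall i, At i \is hermsymmx.
Hypothesis etaE : forall X, eta A X = eta At X.

Lemma ip_compress (B : 'M[C]_N) (V W : 'M[C]_(N, M)) : B \is hermsymmx ->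
  ip (V^t* *m B *m V) (W^t* *m B *m W) =
  Re (\tr (V^t* *m (B *m (V *m W^t*) *m B) *m W)).
Proof.
by move=> /hermE hB; rewrite /ip !adjM trmxCK hB !mulmxA.
Qed.

Lemma sum_ip_compress (k : nat) (B : 'I_k -> 'M[C]_N) (V W : 'M[C]_(N, M)) :
  (forall i, B i \is hermsymmx) ->
  \sum_i ip (V^t* *m B i *m V) (W^t* *m B i *m W) =
  Re (\tr (V^t* *m eta B (V *m W^t*) *m W)).
Proof.
move=> hB; rewrite /eta mulmx_sumr mulmx_suml tr_sum Re_sum.
by apply: eq_bigr => i _; exact: ip_compress.
Qed.

Lemma compress_increments (V W : 'M[C]_(N, M)) :
  \sum_i frob (V^t* *m A i *m V - W^t* *m A i *m W) =
  \sum_j frob (V^t* *m At j *m V - W^t* *m At j *m W).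
Proof.
have E k (B : 'I_k -> 'M[C]_N) : (forall i, B i \is hermsymmx) ->
    \sum_i frob (V^t* *m B i *m V - W^t* *m B i *m W) =
    Re (\tr (V^t* *m eta B (V *m V^t*) *m V))
    - 2 * Re (\tr (V^t* *m eta B (V *m W^t*) *m W))
    + Re (\tr (W^t* *m eta B (W *m W^t*) *m W)).
  move=> hB; under eq_bigr do rewrite frobB.
  rewrite big_split/= sumrB -mulr_sumr /frob.
  by rewrite (sum_ip_compress V V hB) (sum_ip_compress V W hB) (sum_ip_compress W W hB).
by rewrite (E _ _ A_herm) (E _ _ At_herm) !etaE.
Qed.

End eta_swap.

Lemma eta_herm n N (A : 'I_n -> 'M[C]_N) X : (forall i, A i \is hermsymmx) ->
  X \is hermsymmx -> eta A X \is hermsymmx.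
Proof.
move=> hA /hermE hX; apply/hermE; rewrite /eta adj_sum; apply: eq_bigr => i _.
by have /hermE hAi := hA i; rewrite !adjM hX hAi mulmxA.
Qed.

Lemma hermD N (X Y : 'M[C]_N) :
  X \is hermsymmx -> Y \is hermsymmx -> X + Y \is hermsymmx.
Proof. by move=> /hermE hX /hermE hY; apply/hermE; rewrite adjD hX hY. Qed.

Lemma hermN N (X : 'M[C]_N) : X \is hermsymmx -> - X \is hermsymmx.
Proof. by move=> /hermE hX; apply/hermE; rewrite raddfN/= map_mxN hX. Qed.

Lemma herm_inv N (X : 'M[C]_N) : X \is hermsymmx -> invmx X \is hermsymmx.
Proof. by move=> /hermE hX; apply/hermE; rewrite trmx_inv map_invmx hX. Qed.

(** * Pointwise bound for the comparison process *)

Section majorant.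
Variables (n r N M : nat) (A0 : 'M[C]_N) (A : 'I_n -> 'M[C]_N).
Variable At : 'I_r -> 'M[C]_N.
Hypothesis A0_herm : A0 \is hermsymmx.
Hypothesis A_herm : forall i, A i \is hermsymmx.
Hypothesis etaE : forall X, eta A X = eta At X.
Variable Z : 'M[C]_N.
Hypothesis Z_pos : posdefmx Z.
Let lam := lambda_max (A0 + Z + eta A (invmx Z)).

(* With [Z = E^* E] and [F = E^{-*}], the linear term is [2 <B, V> = 2 <F B, E V>],
   at most [|F B|^2 + |E V|^2 = <V, eta (Z^-1) V> + <V, Z V>]. *)
Lemma linear_majorant (V : 'M[C]_(N, M)) (S : 'I_r -> 'M[C]_N)
    (Ga : 'I_r -> 'M[C]_(N, M)) (tau : R) :
  frob V <= 1 -> 1 <= tau -> (0 < M)%N ->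
  (forall j, (S j)^t* *m S j = At j *m (V *m V^t*) *m At j) ->
  (forall p (U : 'I_r -> 'M[C]_(N, p)),
     frob (\sum_j (Ga j)^t* *m U j) <= 2 * M%:R * tau ^+ 2 * \sum_j frob (U j)) ->
  ip V (A0 *m V) + Num.sqrt (2 / M%:R) * \sum_j ip (Ga j) (S j *m V)
  <= lam * frob V + 2 * (tau - 1) * Num.sqrt (opnorm (eta A 1%:M)).
Proof.
move=> V1 tau1 M0 hS hGa.
have M0' : 0 < M%:R :> R by rewrite ltr0n.
set c := (tau * Num.sqrt (2 * M%:R)).
have c0 : 0 < c by rewrite mulr_gt0 ?sqrtr_gt0 ?mulr_gt0 ?ltr0n// (lt_le_trans _ tau1).
have c2 : c ^+ 2 = 2 * M%:R * tau ^+ 2.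
  by rewrite exprMn sqr_sqrtr ?mulr_ge0// mulrC.
set B := (c^-1)%:C *: \sum_j (S j)^t* *m Ga j.
have BE : \sum_j ip (Ga j) (S j *m V) = c * ip B V.
  rewrite ipZl mulrA divff ?gt_eqF// mul1r ip_suml; apply: eq_bigr => j _.
  by rewrite ip_mull trmxCK.
have sc : Num.sqrt (2 / M%:R) * c = 2 * tau.
  rewrite /c mulrCA -sqrtrM ?divr_ge0// (_ : 2 / M%:R * (2 * M%:R) = 2 ^+ 2).
    by rewrite sqrtr_sqr ger0_norm// mulrC.
  by field; rewrite gt_eqF.
set Qm := V *m V^t*.
have FB (F : 'M[C]_N) : frob (F *m B) <= Re (\tr (F *m eta A Qm *m F^t*)).
  have -> : frob (F *m B) = c^-1 ^+ 2 * frob (\sum_j (Ga j)^t* *m (S j *m F^t*)).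
    rewrite /B -scalemxAr frobZ; congr (_ * _).
    rewrite -frob_adj adjM adj_sum mulmx_suml; congr frob; apply: eq_bigr => j _.
    by rewrite adjM trmxCK mulmxA.
  apply: (@le_trans _ _ (c^-1 ^+ 2 * (c ^+ 2 * \sum_j frob (S j *m F^t*)))).
    by rewrite ler_wpM2l ?sqr_ge0// c2; exact: hGa.
  rewrite mulrA -exprMn mulVf ?gt_eqF// expr1n mul1r etaE /eta.
  rewrite mulmx_sumr mulmx_suml tr_sum Re_sum; apply: ler_sum => j _.
  by rewrite -[At j *m Qm *m At j]hS /frob /ip adjM trmxCK !mulmxA.
rewrite BE mulrA sc.
have etaQ : Re (\tr (eta A Qm)) <= opnorm (eta A 1%:M).
  have h1 := eta_herm A_herm (X := 1%:M) (proj2 (hermE _) (@adj1 _ _)).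
  rewrite -[eta A Qm]mul1mx tr_eta -mulmxA.
  apply: (le_trans (ip_le_opnorm V h1)).
  by rewrite -[leRHS]mulr1 ler_wpM2l// opnorm_ge0.
(* The coefficient 2 tau is split as 2 + 2 (tau - 1): the excess part is bounded here by
   Cauchy-Schwarz, and [main] absorbs the rest into Z and Z^-1. *)
have BV : ip B V <= Num.sqrt (opnorm (eta A 1%:M)).
  apply: (le_trans (ip_cs _ _)).
  rewrite -[leRHS]mulr1; apply: ler_pM; rewrite ?sqrtr_ge0//; last first.
    by rewrite -sqrtr1 ler_wsqrtr.
  rewrite ler_wsqrtr// -[B]mul1mx; apply: (le_trans (FB _)).
  by rewrite adj1 mul1mx mulmx1.
have main : 2 * ip B V <= ip V (Z *m V) + ip V (eta A (invmx Z) *m V).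
  have [Zu [E ZE]] := posdef_factor Z_pos.
  have Eu : E \in unitmx by move: Zu; rewrite ZE unitmx_mul => /andP[].
  have Eu' : E^t* \in unitmx by move: Zu; rewrite ZE unitmx_mul => /andP[].
  set F := (invmx E)^t*.
  have -> : ip B V = ip (F *m B) (E *m V).
    by rewrite ip_mull trmxCK mulmxA mulVmx// mul1mx.
  apply: (le_trans (ip_amgm _ _)); rewrite addrC; apply: lerD.
    by rewrite /frob ip_mull mulmxA -ZE.
  apply: (le_trans (FB _)).
  have FF : F^t* *m F = invmx Z.
    have ZX : Z *m (invmx E *m F) = 1%:M.
      by rewrite ZE -mulmxA (mulmxA E) mulmxV// mul1mx -adjM mulVmx// adj1.
    by rewrite /F trmxCK -[LHS](mulKmx Zu) ZX mulmx1.
  by rewrite mxtrace_mulC mulmxA FF tr_eta /ip mulmxA.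
have := @lambda_max_ge _ _ _ _ V (hermD (hermD A0_herm Z_pos.1)
   (eta_herm A_herm (herm_inv Z_pos.1))).
rewrite !mulmxDl !ipDr -/lam; have t0 : 0 <= tau - 1 by lra.
have := ler_wpM2l t0 BV; move: main.
move: (ip B V) (ip V (A0 *m V)) (ip V (Z *m V)) (ip V _) (lam * frob V) (Num.sqrt _).
by move=> *; lra.
Qed.
End majorant.

End comparison.

(** * Vectors of the tensor product as N x M matrices *)

Section tensor.
Variable R : realType.
Local Notation C := R[i].
Local Notation Re := (@complex.Re R).
Local Notation Im := (@complex.Im R).
Variables N M : nat.

Definition tvec (V : 'M[C]_(N, M)) : 'cV[C]_(N * M) :=
  \col_k V (mxtens_unindex k).1 (mxtens_unindex k).2.

Lemma sum_tens (W : zmodType) (f : 'I_(N * M) -> W) :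
  \sum_k f k = \sum_i \sum_j f (mxtens_index (i, j)).
Proof.
rewrite pair_bigA /= (reindex (@mxtens_index N M)) /=; last first.
  by exists (@mxtens_unindex N M) => ? _; rewrite ?mxtens_indexK ?mxtens_unindexK.
by apply: eq_bigr => -[].
Qed.

Lemma ip_tvec (V W : 'M[C]_(N, M)) : ip (tvec V) (tvec W) = ip V W.
Proof.
rewrite !ipE sum_tens; apply: eq_bigr => i _; apply: eq_bigr => j _.
by rewrite big_ord1 !mxE !mxtens_indexK.
Qed.

Lemma tvec_surj (v : 'cV[C]_(N * M)) : exists V, v = tvec V.
Proof.
exists (\matrix_(i, j) v (mxtens_index (i, j)) 0); apply/colP => k.
by rewrite !mxE -surjective_pairing mxtens_unindexK.
Qed.

(** The transpose on the second factor is the origin of the transposes in [gue_coef] and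
    [ip_tens]. *)
Lemma tens_tvec (A : 'M[C]_N) (B : 'M[C]_M) (V : 'M[C]_(N, M)) :
  (A *t B) *m tvec V = tvec (A *m V *m B^T).
Proof.
apply/colP => k; rewrite !mxE sum_tens exchange_big /=; apply: eq_bigr => j _.
rewrite !mxE mulr_suml; apply: eq_bigr => i _.
by rewrite !mxE mxtens_indexK/=; ring.
Qed.

Lemma tens_herm (A : 'M[C]_N) (B : 'M[C]_M) :
  A \is hermsymmx -> B \is hermsymmx -> A *t B \is hermsymmx.
Proof.
move=> /hermE hA /hermE hB; apply/hermE; apply/matrixP => k l.
by rewrite -{2}hA -{2}hB !mxE rmorphM.
Qed.

End tensor.

(** * Real coordinates of Hermitian matrices *)

Section hermitian_coordinates.
Variable R : realType.
Local Notation C := R[i].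
Local Notation Re := (@complex.Re R).
Local Notation Im := (@complex.Im R).
Variable M : nat.
Implicit Types (A B : 'M[C]_M) (p : 'I_M * 'I_M).

Definition hcoord A p : R :=
  if (p.1 <= p.2)%N then Re (A p.1 p.2) else Im (A p.2 p.1).

(* Off-diagonal coordinates count twice in the Frobenius inner product. *)
Definition hweight p : R := if p.1 == p.2 then 1 else 2.

Lemma sum_sym (f : 'I_M -> 'I_M -> R) : (forall j k, f j k = f k j) ->
  \sum_j \sum_k f j k = \sum_(p : 'I_M * 'I_M) (if (p.1 <= p.2)%N then hweight p * f p.1 p.2 else 0).
Proof.
move=> fC.
pose U := \sum_(j < M) \sum_(k < M) (if (j < k)%N then f j k else 0).
pose D := \sum_(j < M) \sum_k (if j == k then f j k else 0).
have LU : \sum_(j < M) \sum_(k < M) (if (k < j)%N then f j k else 0) = U.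
  by rewrite exchange_big; apply: eq_bigr => j _; apply: eq_bigr => k _; rewrite fC.
transitivity (D + U + U).
  rewrite -[X in _ + X]LU /D /U -!big_split; apply: eq_bigr => j _ /=.
  rewrite -!big_split; apply: eq_bigr => k _ /=.
  by rewrite -(inj_eq val_inj) /=; case: ltngtP; rewrite ?addr0 ?add0r.
rewrite -(pair_bigA _ (fun j k : 'I_M => if (j <= k)%N then hweight (j, k) * f j k else 0))/=.
rewrite -addrA /D /U -!big_split; apply: eq_bigr => j _ /=.
rewrite -!big_split; apply: eq_bigr => k _ /=.
rewrite /hweight/= -(inj_eq val_inj) /=.
by case: ltngtP; rewrite ?addr0 ?add0r ?mul1r// => _; ring.
Qed.

(** The counterpart of [sum_sym] for imaginary parts, which [hcoord] stores at the pairs below the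
    diagonal with their indices exchanged. *)
Lemma sum_sym_offdiag (f : 'I_M -> 'I_M -> R) :
  (forall j k, f j k = f k j) -> (forall j, f j j = 0) ->
  \sum_j \sum_k f j k = \sum_(p : 'I_M * 'I_M) (if (p.1 <= p.2)%N then 0 else hweight p * f p.2 p.1).
Proof.
move=> fC f0; rewrite sum_sym// -(pair_bigA _ (fun j k : 'I_M => if (j <= k)%N then hweight (j, k) * f j k else 0)).
rewrite -(pair_bigA _ (fun j k : 'I_M => if (j <= k)%N then 0 else hweight (j, k) * f k j)).
rewrite exchange_big/=; apply: eq_bigr => j _; apply: eq_bigr => k _.
rewrite /hweight/= eq_sym -(inj_eq val_inj)/=.
by case: ltngtP => // /val_inj ->; rewrite f0 mulr0.
Qed.

Lemma herm_entry A j k : A \is hermsymmx ->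
  Re (A k j) = Re (A j k) /\ Im (A k j) = - Im (A j k).
Proof. by move=> /hermE {1 3}<-; rewrite adjE conjCE. Qed.

Lemma ip_hcoord A B : A \is hermsymmx -> B \is hermsymmx ->
  ip A B = \sum_(p : 'I_M * 'I_M) hweight p * (hcoord A p * hcoord B p).
Proof.
move=> hA hB; rewrite ipE; under eq_bigr do rewrite big_split/=.
rewrite big_split/= sum_sym => [|j k]; last first.
  by rewrite (herm_entry j k hA).1 (herm_entry j k hB).1.
rewrite sum_sym_offdiag => [|j k|j].
- rewrite -big_split; apply: eq_bigr => p _ /=; rewrite /hcoord.
  by case: ifP => _; rewrite ?addr0 ?add0r.
- by rewrite (herm_entry j k hA).2 (herm_entry j k hB).2 mulrNN.
- have := (herm_entry j j hA).2; have := (herm_entry j j hB).2; nra.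
Qed.

Lemma hcoordB A B p : hcoord (A - B) p = hcoord A p - hcoord B p.
Proof. by rewrite /hcoord !mxE; case: ifP => _; rewrite ?Re_sub ?Im_sub. Qed.

Lemma tr_herm A : A \is hermsymmx -> A^T \is hermsymmx.
Proof. by move=> /hermE hA; apply/hermE; rewrite -[in RHS]hA map_trmx. Qed.

Lemma frob_tr A : frob (A^T) = frob A.
Proof.
rewrite !frobE exchange_big; apply: eq_bigr => i _; apply: eq_bigr => j _.
by rewrite !mxE.
Qed.

Lemma ip_trC A B : ip A (B^T) = ip (A^T) B.
Proof.
rewrite !ipE exchange_big; apply: eq_bigr => i _; apply: eq_bigr => j _.
by rewrite !mxE.
Qed.

End hermitian_coordinates.

(** * Frobenius norm estimates and nets of matrices *)

Section frobenius.
Variable R : realType.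
Local Notation C := R[i].
Local Notation Re := (@complex.Re R).
Local Notation Im := (@complex.Im R).

Lemma frobZc p q (z : C) (A : 'M[C]_(p, q)) :
  frob (z *: A) = (Re z ^+ 2 + Im z ^+ 2) * frob A.
Proof.
rewrite !frobE mulr_sumr; apply: eq_bigr => i _; rewrite mulr_sumr.
by apply: eq_bigr => j _; rewrite !mxE Re_mul Im_mul; ring.
Qed.

(** Complex Cauchy-Schwarz from the real one: with z = a b, pairing b with z a^* gives |z|^2, so no
    phase is lost in the real part. *)
Lemma frob_row_col q (a : 'rV[C]_q) (b : 'cV[C]_q) :
  frob (a *m b) <= frob a * frob b.
Proof.
have [->|z0] := eqVneq (frob (a *m b)) 0; first by rewrite mulr_ge0 ?frob_ge0.
have zp : 0 < frob (a *m b) by rewrite lt_neqAle eq_sym z0 frob_ge0.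
set z := (a *m b) 0 0.
have zE : frob (a *m b) = Re z ^+ 2 + Im z ^+ 2 by rewrite frobE !big_ord1.
have aE : a^t* *m (a *m b) = z *: a^t*.
  apply/matrixP => i j; rewrite (ord1 j) [LHS]mxE big_ord1 -/z mulrC.
  by rewrite [in RHS]mxE.
have := ip_cs b (z *: a^t*); rewrite -{1}aE -ip_mull -/(frob _) frobZc frob_adj -zE => h.
have {h} : frob (a *m b) ^+ 2 <= frob b * (frob (a *m b) * frob a).
  rewrite -[leRHS]sqr_sqrtr ?mulr_ge0 ?frob_ge0// ler_sqr ?nnegrE ?frob_ge0 ?sqrtr_ge0//.
  by rewrite sqrtrM ?frob_ge0.
by rewrite mulrCA expr2 ler_pM2l// mulrC.
Qed.

Lemma frob_mul p q s (A : 'M[C]_(p, q)) (B : 'M[C]_(q, s)) :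
  frob (A *m B) <= frob A * frob B.
Proof.
have colE : frob B = \sum_j frob (col j B).
  rewrite frobE exchange_big; apply: eq_bigr => j _; rewrite frobE.
  by apply: eq_bigr => i _; rewrite big_ord1 !mxE.
rewrite (frob_rows A) mulr_suml frob_rows; apply: ler_sum => i _.
rewrite colE mulr_sumr frobE big_ord1; apply: ler_sum => j _.
apply: le_trans (frob_row_col (row i A) (col j B)).
rewrite frobE !big_ord1.
suff -> : row i (A *m B) ord0 j = (row i A *m col j B) 0 0 by [].
by rewrite !mxE; apply: eq_bigr => k _; rewrite !mxE.
Qed.

Lemma frob_add_le p q (A B : 'M[C]_(p, q)) :
  frob (A + B) <= 2 * frob A + 2 * frob B.
Proof.
rewrite frobD; have := ip_amgm A B.
by move: (ip A B) (frob A) (frob B) => a b c; lra.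
Qed.

Lemma frob_sum_le p q (I : finType) (A : I -> 'M[C]_(p, q)) :
  frob (\sum_i A i) <= #|I|%:R * \sum_i frob (A i).
Proof.
rewrite /frob ip_suml.
apply: (@le_trans _ _ (\sum_i \sum_j (2^-1 * frob (A i) + 2^-1 * frob (A j)))).
  apply: ler_sum => i _; rewrite ip_sumr; apply: ler_sum => j _.
  rewrite -mulrDr -ler_pdivrMl ?invr_gt0// invrK; exact: ip_amgm.
under eq_bigr do rewrite big_split/= sumr_const -mulr_sumr.
rewrite big_split/= sumr_const sumrMnl -mulr_sumr -mulrnDl -mulrDl mulr_natl.
rewrite (_ : 2^-1 + 2^-1 = 1 :> R); last by field.
by rewrite mul1r.
Qed.

Lemma frob_tens N M (A : 'M[C]_N) (B : 'M[C]_M) : frob (A *t B) = frob A * frob B.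
Proof.
rewrite !frobE sum_tens mulr_suml; apply: eq_bigr => i _.
rewrite [RHS]mulr_suml.
transitivity (\sum_(k < M) \sum_(l < N) \sum_(j < M)
   (Re (A i l) ^+ 2 + Im (A i l) ^+ 2) * (Re (B k j) ^+ 2 + Im (B k j) ^+ 2)).
  apply: eq_bigr => k _; rewrite sum_tens; apply: eq_bigr => l _.
  by apply: eq_bigr => j _; rewrite tensmxE Re_mul Im_mul; ring.
rewrite exchange_big; apply: eq_bigr => l _; rewrite mulr_sumr.
by apply: eq_bigr => k _; rewrite mulr_sumr.
Qed.

(** Passes from the unit ball to a net. Twice the norm of K is weakened to [1 + frob K], which for
    the random matrix is bounded by a quadratic polynomial in Gaussian coordinates, hence by an
    integrable function. *)
Lemma ip_herm_lip p q (K : 'M[C]_p) (v w : 'M[C]_(p, q)) (dl : R) : 0 <= dl ->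
  frob v <= 1 -> frob w <= 1 -> frob (v - w) <= dl ^+ 2 ->
  ip v (K *m v) <= ip w (K *m w) + dl * (1 + frob K).
Proof.
move=> dl0 v1 w1 vw.
have -> : ip v (K *m v) = ip w (K *m w) + (ip (v - w) (K *m v) + ip w (K *m (v - w))).
  rewrite mulmxBr ipBl ipBr.
  by move: (ip v (K *m v)) (ip w (K *m v)) (ip w (K *m w)) => x y z; ring.
have K0 := frob_ge0 K.
have s1 (x : 'M[C]_(p, q)) : frob x <= 1 -> Num.sqrt (frob x) <= 1.
  by move=> x1; rewrite -sqrtr1 ler_wsqrtr.
have sd : Num.sqrt (frob (v - w)) <= dl.
  by rewrite -(ger0_norm dl0) -sqrtr_sqr ler_wsqrtr.
have sK (x : 'M[C]_(p, q)) : Num.sqrt (frob (K *m x)) <= Num.sqrt (frob K) * Num.sqrt (frob x).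
  by rewrite -sqrtrM// ler_wsqrtr// frob_mul.
have k2 : 2 * Num.sqrt (frob K) <= 1 + frob K.
  by have := sqr_ge0 (Num.sqrt (frob K) - 1); have := sqr_sqrtr K0; nra.
have a := sqrtr_ge0 (frob K).
have h1 : ip (v - w) (K *m v) <= dl * Num.sqrt (frob K).
  apply: (le_trans (ip_cs _ _)); apply: ler_pM; rewrite ?sqrtr_ge0//.
  by apply: (le_trans (sK v)); rewrite -[leRHS]mulr1 ler_wpM2l// s1.
have h2 : ip w (K *m (v - w)) <= dl * Num.sqrt (frob K).
  apply: (le_trans (ip_cs _ _)); rewrite -[leRHS]mul1r.
  apply: ler_pM; rewrite ?sqrtr_ge0//; first exact: s1.
  by apply: (le_trans (sK _)); rewrite mulrC ler_wpM2r.
rewrite lerD2l; apply: le_trans (lerD h1 h2) _; rewrite -mulrDr.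
by apply: ler_wpM2l => //; rewrite -mulr2n -mulr_natl.
Qed.

Lemma matrix_net p q (dl : R) : 0 < dl ->
  exists (J : finType) (j0 : J) (V : J -> 'M[C]_(p, q)),
  [/\ V j0 = 0, forall j, frob (V j) <= 1 &
      forall W, frob W <= 1 -> exists j, frob (W - V j) <= dl ^+ 2].
Proof.
move=> dl0.
pose D : finType := (('I_p * 'I_q) * bool)%type.
pose mx (x : D -> R) : 'M[C]_(p, q) :=
  \matrix_(i, j) (x ((i, j), true) +i* x ((i, j), false)).
have frobmx x : frob (mx x) = \sum_k x k ^+ 2.
  rewrite frobE pair_bigA/= [RHS](eq_bigr (fun k => x (k.1, k.2) ^+ 2)); last by case.
  rewrite -(pair_bigA _ (fun a b => x (a, b) ^+ 2))/=.
  by apply: eq_bigr => -[i j] _; rewrite big_bool/= !mxE.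
have mxB x y : mx x - mx y = mx (fun k => x k - y k).
  by apply/matrixP => i j; rewrite !mxE.
have mxS W : exists x, W = mx x.
  exists (fun k => if k.2 then Re (W k.1.1 k.1.2) else Im (W k.1.1 k.1.2)).
  by apply/matrixP => i j; rewrite mxE/=; case: (W i j).
(* There are |D| real coordinates, and |D| dl^2 / (|D| + 1)^2 <= dl^2. *)
have e0 : 0 < dl / (#|D|%:R + 1) by rewrite divr_gt0// ltr_wpDl.
have [J [j0 [f [f0 f1 fn]]]] := @ball_net R D _ e0.
exists J, j0, (fun j => mx (f j)); split.
- by apply/matrixP => i j; rewrite !mxE !f0.
- by move=> j; rewrite frobmx.
- move=> W; have [x ->] := mxS W; rewrite frobmx => x1.
  have [j hj] := fn x x1; exists j; rewrite mxB frobmx.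
  apply: (@le_trans _ _ (\sum_(k : D) (dl / (#|D|%:R + 1)) ^+ 2)).
    apply: ler_sum => k _; rewrite -real_normK ?num_real// ler_sqr ?nnegrE//.
      exact: (hj k).1.
    exact: ltW.
  rewrite sumr_const -[leLHS]mulr_natl; have N0 : 0 <= #|D|%:R :> R by [].
  move: N0; generalize (#|D|%:R : R) => N0 hN.
  have N1 : 0 < N0 + 1 by rewrite ltr_wpDl.
  rewrite exprMn mulrCA ler_piMr ?sqr_ge0//.
  rewrite exprVn ler_pdivrMr ?exprn_gt0//; nra.
Qed.

End frobenius.

(** * Real coordinates of the comparison process and the resulting bound *)

Section comparison_process.
Variable R : realType.
Local Notation C := R[i].
Local Notation Re := (@complex.Re R).
Local Notation Im := (@complex.Im R).

Section real_coordinates.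
Variables r N M : nat.
Local Notation D1 := (bool * ('I_r * 'I_N))%type.
Implicit Types (L : 'I_r -> 'M[C]_(N, M)) (h : D1 * 'I_M -> R).

Definition rcoord L (p : D1 * 'I_M) : R :=
  let z := L p.1.2.1 p.1.2.2 p.2 in if p.1.1 then Re z else Im z.

Definition cfamily h (j : 'I_r) : 'M[C]_(N, M) :=
  \matrix_(k, m) (h ((true, (j, k)), m) +i* h ((false, (j, k)), m)).

Lemma sum_bool_pair (F : D1 -> R) :
  \sum_p F p = \sum_j \sum_k (F (true, (j, k)) + F (false, (j, k))).
Proof.
rewrite (eq_bigr (fun p => F (p.1, p.2))); last by case.
rewrite -(pair_bigA _ (fun a b => F (a, b)))/= big_bool/= -big_split/=.
by rewrite pair_bigA/=; apply: eq_bigr => -[].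
Qed.

Lemma sum_rcoord (F : D1 * 'I_M -> R) :
  \sum_p F p = \sum_j \sum_k \sum_m (F ((true, (j, k)), m) + F ((false, (j, k)), m)).
Proof.
rewrite (eq_bigr (fun p => F (p.1, p.2))); last by case.
rewrite -(pair_bigA _ (fun a b => F (a, b)))/= sum_bool_pair.
apply: eq_bigr => j _; apply: eq_bigr => k _; exact: esym (big_split _ _ _ _ _).
Qed.

Lemma ip_cfamily h L : \sum_j ip (cfamily h j) (L j) = \sum_p h p * rcoord L p.
Proof.
rewrite sum_rcoord; apply: eq_bigr => j _; rewrite ipE.
by apply: eq_bigr => k _; apply: eq_bigr => m _; rewrite !mxE.
Qed.

Lemma sum_rcoord_sqr L : \sum_p rcoord L p ^+ 2 = \sum_j frob (L j).
Proof. by rewrite sum_rcoord; apply: eq_bigr => j _; rewrite frobE. Qed.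

Lemma rcoordB L L' p : rcoord (fun j => L j - L' j) p = rcoord L p - rcoord L' p.
Proof. by rewrite /rcoord !mxE; case: ifP => _; rewrite ?Re_sub ?Im_sub. Qed.

(** The factor 2 counts the real and the imaginary part of each column, each being the image under
    the real matrix of a vector as long as the column of the stacked U_j. *)
Lemma cfamily_bound h (t : R) : 0 <= t ->
  (forall x : D1 -> R, norm2 (fun m => \sum_k h (k, m) * x k) <= t * norm2 x) ->
  forall p (U : 'I_r -> 'M[C]_(N, p)),
  frob (\sum_j (cfamily h j)^t* *m U j) <= 2 * t ^+ 2 * \sum_j frob (U j).
Proof.
move=> t0 hb p U.
have hb2 x : \sum_m (\sum_k h (k, m) * x k) ^+ 2 <= t ^+ 2 * \sum_k x k ^+ 2.
  rewrite -!sqr_norm2 -exprMn ler_sqr ?nnegrE ?norm2_ge0 ?mulr_ge0 ?norm2_ge0//.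
pose x1 c (k : D1) : R := let z := U k.2.1 k.2.2 c in if k.1 then Re z else Im z.
(* The coordinates of - i U: for entries a + i b and u + i v, conj (a + i b) (u + i v) = (a u + b v)
   + i (a v - b u). *)
pose x2 c (k : D1) : R := let z := U k.2.1 k.2.2 c in if k.1 then Im z else - Re z.
have entry m c : (\sum_j (cfamily h j)^t* *m U j) m c =
    (\sum_k h (k, m) * x1 c k) +i* (\sum_k h (k, m) * x2 c k).
  apply: complex_eq; rewrite summxE /= ?Re_sum ?Im_sum sum_bool_pair.
    apply: eq_bigr => j _; rewrite mxE Re_sum; apply: eq_bigr => k _.
    by rewrite adjE conjCE Re_mul !mxE/= /x1/=; ring.
  apply: eq_bigr => j _; rewrite mxE Im_sum; apply: eq_bigr => k _.
  by rewrite adjE conjCE Im_mul !mxE/= /x2/=; ring.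
have xx c : \sum_k x2 c k ^+ 2 = \sum_k x1 c k ^+ 2.
  rewrite !sum_bool_pair; apply: eq_bigr => j _; apply: eq_bigr => k _.
  by rewrite /x1 /x2/=; ring.
have xU : \sum_c \sum_k x1 c k ^+ 2 = \sum_j frob (U j).
  under eq_bigr do rewrite sum_bool_pair; rewrite exchange_big.
  apply: eq_bigr => j _; rewrite frobE exchange_big; apply: eq_bigr => k _.
  by apply: eq_bigr.
rewrite frobE exchange_big -xU mulr_sumr; apply: ler_sum => c _.
under eq_bigr do rewrite entry /=.
rewrite big_split/=; have := hb2 (x1 c); have := hb2 (x2 c); rewrite xx.
move: (\sum_k _) (\sum_m _) (\sum_m _) => a b e; lra.
Qed.

End real_coordinates.

Section process.
Variables (n r N M : nat) (A0 : 'M[C]_N) (A : 'I_n -> 'M[C]_N).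
Variable At : 'I_r -> 'M[C]_N.
Hypothesis r_gt0 : (0 < r)%N.
Hypothesis N_gt0 : (0 < N)%N.
Hypothesis M_gt0 : (0 < M)%N.
Hypothesis A0_herm : A0 \is hermsymmx.
Hypothesis A_herm : forall i, A i \is hermsymmx.
Hypothesis At_psd : forall j, possemidefmx (At j).
Hypothesis etaE : forall X, eta A X = eta At X.
Variables (J : finType) (j0 : J) (V : J -> 'M[C]_(N, M)).
Hypothesis V1 : forall v, frob (V v) <= 1.
Local Notation K := ('I_n * ('I_M * 'I_M))%type.
Local Notation D1 := (bool * ('I_r * 'I_N))%type.

Definition gue_sd (k : K) : R := if k.2.1 == k.2.2 then 1 else Num.sqrt 2^-1.

(** The coefficient of the k-th GUE coordinate in <V, (H_M - A0 (x) I) V>, as [ip_model]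
    confirms. *)
Definition gue_coef (k : K) (v : J) : R := (Num.sqrt M%:R)^-1 *
  (hweight R k.2 * hcoord (((V v)^t* *m A k.1 *m V v)^T) k.2).

Lemma gue_sd_gt0 k : 0 < gue_sd k.
Proof. by rewrite /gue_sd; case: ifP => // _; rewrite sqrtr_gt0 invr_gt0. Qed.

(** Off the diagonal, the variance 1/2 cancels the double weight. GUE is thus isotropic for the
    Frobenius norm, and increments of the process are Frobenius distances. *)
Lemma gue_sd_sqr k : gue_sd k ^+ 2 * hweight R k.2 = 1.
Proof.
rewrite /gue_sd /hweight; case: ifP => _; first by rewrite expr1n mulr1.
by rewrite sqr_sqrtr ?invr_ge0// mulVf.
Qed.

Lemma compress_herm p q (B : 'M[C]_p) (W : 'M[C]_(p, q)) :
  B \is hermsymmx -> W^t* *m B *m W \is hermsymmx.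
Proof. by move=> /hermE hB; apply/hermE; rewrite !adjM trmxCK hB mulmxA. Qed.

Lemma gue_increments v w :
  \sum_k (gue_sd k * gue_coef k v - gue_sd k * gue_coef k w) ^+ 2 =
  M%:R^-1 * \sum_i frob ((V v)^t* *m A i *m V v - (V w)^t* *m A i *m V w).
Proof.
have sM : (Num.sqrt M%:R)^-1 ^+ 2 = M%:R^-1 :> R by rewrite exprVn sqr_sqrtr.
rewrite mulr_sumr (eq_bigr (fun k : K => M%:R^-1 * (hweight R k.2 *
   (hcoord (((V v)^t* *m A k.1 *m V v - (V w)^t* *m A k.1 *m V w)^T) k.2) ^+ 2))).
  rewrite -(pair_bigA _ (fun i p => M%:R^-1 * (hweight R p *
   (hcoord (((V v)^t* *m A i *m V v - (V w)^t* *m A i *m V w)^T) p) ^+ 2)))/=.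
  apply: eq_bigr => i _; rewrite -mulr_sumr -frob_tr; congr (_ * _).
  have hD : ((V v)^t* *m A i *m V v - (V w)^t* *m A i *m V w)^T \is hermsymmx.
    apply: tr_herm; apply: hermD; first exact: (compress_herm (V v) (A_herm i)).
    exact: (hermN (compress_herm (V w) (A_herm i))).
  by rewrite /frob (ip_hcoord hD hD); apply: eq_bigr => p _; rewrite expr2.
move=> k _; rewrite raddfB /= hcoordB -sM /gue_coef.
have := gue_sd_sqr k.
move: (gue_sd k) (hweight R k.2) (Num.sqrt _)^-1 (hcoord _ _) (hcoord _ _).
move=> s wt c a b h.
transitivity (c ^+ 2 * wt * (s ^+ 2 * wt) * (a - b) ^+ 2); first by ring.
by rewrite h; ring.
Qed.

(** Subtracting [lam * frob (V v)] instead of [lam] matches the homogeneity of [linear_majorant], so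
    the whole ball may be used whatever the sign of [lam]. *)
Theorem gue_comparison (Z : 'M[C]_N) : posdefmx Z ->
  Qs (steps gue_sd gue_coef (enum {: K})) (maxF j0)
    (fun v => ip (V v) (A0 *m V v)
       - lambda_max (A0 + Z + eta A (invmx Z)) * frob (V v)) <=
  9 / 2 * (Num.sqrt (r%:R * N%:R / M%:R) * Num.sqrt (opnorm (eta A 1%:M))).
Proof.
move=> Z_pos; set lam := lambda_max _; set x0 := fun v => _ : R.
set s := Num.sqrt (opnorm _).
have s0 : 0 <= s := sqrtr_ge0 _.
have M0 : 0 < M%:R :> R by rewrite ltr0n.
have sM0 : 0 < Num.sqrt M%:R :> R by rewrite sqrtr_gt0.
have [D DE] := choice (fun j => possemidef_factor (At_psd j)).
have [T TE] := choice (fun p : J * 'I_r => gram_factor ((D p.2 *m V p.1)^t*)).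
have {}TE p : (T p)^t* *m T p = (D p.2 *m V p.1) *m (D p.2 *m V p.1)^t*.
  by rewrite -TE trmxCK.
have DV v j : (V v)^t* *m At j *m V v = (D j *m V v)^t* *m (D j *m V v).
  by rewrite DE adjM !mulmxA.
pose L v j := T (v, j) *m (D j *m V v).
pose c : R := Num.sqrt (2 / M%:R).
pose b (p : D1 * 'I_M) v := c * rcoord (L v) p.
pose L0 h v := \sum_p h p * b p v.
have L0E h v : L0 h v = c * \sum_j ip (cfamily h j) (L v j).
  by rewrite ip_cfamily mulr_sumr; apply: eq_bigr => p _; rewrite /b; ring.
have c2 : c ^+ 2 = 2 / M%:R by rewrite sqr_sqrtr ?divr_ge0.
have L0d p : L0 (delta p) = b p.
  apply/funext => v; rewrite /L0 (bigD1 p)//= /delta eqxx mul1r big1 ?addr0//.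
  by move=> q /negbTE; rewrite eq_sym => ->; rewrite mul0r.
have incr v w :
    \sum_(a <- steps gue_sd gue_coef (enum {: K})) (a v - a w) ^+ 2 <=
    \sum_(a <- map L0 (map delta (enum {: D1 * 'I_M}))) (a v - a w) ^+ 2.
  rewrite sum_map_delta /steps big_map big_enum gue_increments.
  rewrite (@compress_increments _ _ r _ _ _ At)// => [|j]; last by case: (At_psd j).
  rewrite (eq_bigr (fun p => c ^+ 2 * rcoord (fun j => L v j - L w j) p ^+ 2)); last first.
    move=> p _; rewrite L0d /b rcoordB -mulrBr exprMn; reflexivity.
  rewrite -mulr_sumr sum_rcoord_sqr c2 mulrAC mulrC ler_wpM2r ?invr_ge0 ?(ltW M0)//.
  rewrite mulr_sumr; apply: ler_sum => j _.
  by rewrite !DV; exact: gram_increments (TE (v, j)) (TE (w, j)).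
have k0 : D1 := (true, (Ordinal r_gt0, Ordinal N_gt0)).
have m0 : 'I_M := Ordinal M_gt0.
pose Ks : R := r%:R * N%:R.
have Ks1 : 1 <= Ks by rewrite /Ks -natrM ler1n muln_gt0 r_gt0.
pose B := Qs (map delta (enum {: D1 * 'I_M})) (@l1norm R _) (fun=> 0).
have B0 : 0 <= B.
  rewrite -(Qs_cst (map delta (enum {: D1 * 'I_M})) 0 (fun=> 0)).
  apply: le_Qs; [exact: lipschitz_cst | exact: lipschitz_l1norm | exact: l1norm_ge0].
(* Keeps the net error of [chevet], eps times [B], below 1/8. *)
have eps0 : 0 < 1 / (8 * (B + 1)) by rewrite divr_gt0// mulr_gt0// ltr_wpDl.
have [m [Lm m_ge0 hm Em]] := @chevet R _ _ k0 m0 _ eps0.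
apply: (le_trans (sudakov_fernique j0 x0 incr)).
pose Lx h v := x0 v + L0 h v.
have lipL v : lipschitzF (fun h => Lx h v).
  apply: lipschitzD; first exact: lipschitz_cst.
  apply: lipschitz_sum => p; under eq_fun do rewrite mulrC.
  exact/lipschitzZ/lipschitz_coord.
have x0E : x0 = Lx (fun=> 0).
  by apply/funext => v; rewrite /Lx /L0 big1 ?addr0// => p _; rewrite mul0r.
rewrite x0E -(@Qs_affine _ _ _ Lx L0); last first.
  move=> h t a; apply/funext => v; rewrite /Lx /shift /L0 mulr_sumr -[RHS]addrA.
  by congr (x0 v + _); rewrite -big_split; apply: eq_bigr => p _ /=; ring.
have pw h : maxF j0 (Lx h) <= (2 * s / Num.sqrt M%:R) * m h.
  (* So that tau sqrt M = sqrt M + m h is the bound of [chevet] on the norm of h; the error 2 (tau -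
     1) s is then linear in [m h]. *)
  apply: maxF_le => v; pose tau := 1 + m h / Num.sqrt M%:R.
  have t1 : 1 <= tau by rewrite lerDl divr_ge0// ltW.
  have := @linear_majorant _ _ _ _ _ _ _ _ A0_herm A_herm etaE _ Z_pos (V v)
    (fun j => T (v, j) *m D j) (cfamily h) tau (V1 v) t1 M_gt0.
  have -> : 2 * (tau - 1) = 2 / Num.sqrt M%:R * m h.
    by rewrite /tau; ring.
  rewrite /Lx /x0 L0E /L -/lam -/c -/s.
  under eq_bigr do rewrite -mulmxA.
  move=> maj; rewrite addrAC lerBlDl; apply: (le_trans (maj _ _)).
  - move=> j; rewrite adjM -mulmxA (mulmxA ((T (v, j))^t*)) (TE (v, j)) adjM DE /=.
    by rewrite !mulmxA.
  - have hb := cfamily_bound (t := Num.sqrt M%:R + m h) (addr_ge0 (sqrtr_ge0 _) (m_ge0 h)).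
    move=> p U; rewrite (_ : 2 * M%:R * tau ^+ 2 = 2 * (Num.sqrt M%:R + m h) ^+ 2).
      apply: hb => x; have := hm h x; by rewrite card_ord.
    rewrite -[in LHS](@sqr_sqrtr _ M%:R) ?ltW// /tau; field.
    by rewrite gt_eqF.
  - rewrite (_ : 2 * s / Num.sqrt M%:R * m h = 2 / Num.sqrt M%:R * m h * s)//.
    by ring.
apply: (@le_trans _ _ ((2 * s / Num.sqrt M%:R) *
    Qs (map delta (enum {: D1 * 'I_M})) m (fun=> 0))).
  rewrite -QsZ//; apply: (@le_Qs _ _ _ _ _ _ _ _ pw); last exact: lipschitzZ.
  exact: (lipschitz_comp (lipschitz_maxF _)).
have cD1 : #|{: D1}|%:R = 2 * Ks :> R.
  by rewrite !card_prod card_bool !card_ord !natrM.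
rewrite cD1 in Em.
rewrite sqrtrM ?mulr_ge0// sqrtrV ?(ltW M0)//.
rewrite (_ : 9 / 2 * _ = (2 * s / Num.sqrt M%:R) * (9 / 4 * Num.sqrt Ks)); last first.
  by field; rewrite gt_eqF.
apply: ler_wpM2l; first by rewrite divr_ge0 ?mulr_ge0.
apply: (le_trans Em); rewrite -/B sqrtrM//.
have eB : 1 / (8 * (B + 1)) * B <= 1 / 8.
  have Bp : 0 < B + 1 by rewrite ltr_wpDl.
  by rewrite mulrAC ler_pdivrMr ?mulr_gt0//; lra.
have q1 : 1 <= Num.sqrt Ks by rewrite -sqrtr1 ler_wsqrtr.
(* The claim is sqrt 2 q + sqrt 2 / 2 + 1/8 <= 9/4 q for q = sqrt (rN) >= 1. It is tight enough to
   need sqrt 2 <= 1.415: at q = 1 the left side is then at most 2.2475. *)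
have r2 : Num.sqrt 2 <= 707 / 500 + 1 / 1000 :> R.
  rewrite -[leRHS]ger0_norm; last by lra.
  by rewrite -sqrtr_sqr ler_wsqrtr//; lra.
have r20 : 0 <= Num.sqrt 2 :> R by exact: sqrtr_ge0.
move: eB q1 r2 r20; move: (Num.sqrt 2 : R) (Num.sqrt Ks) (1 / (8 * (B + 1)) * B) => a q e.
nra.
Qed.

End process.

End comparison_process.

(** * The Gaussian model *)

Section gue_independence.
Context d (T : measurableType d) (R : realType) (P : probability T R).
Variables (n M : nat) (G : 'I_n -> T -> 'M[R[i]]_M).
Hypothesis G_GUE : independent_GUE P G.
Local Notation K := ('I_n * ('I_M * 'I_M))%type.

Definition gue_coord (k : K) (w : T) : R := herm_coord (G k.1) k.2 w.

Lemma gue_coord_gaussian k : gaussian_rv P 0 (gue_sd R k) (gue_coord k).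
Proof.
case: k => i [j l]; have [_ hd ho _] := (proj1 G_GUE) i.
rewrite /gue_sd /gue_coord /=; case: ifP => [/eqP ->|jl]; first exact: hd.
by apply: ho; rewrite jl.
Qed.

Lemma sigma_mx_coord i jk (B : set R) : measurable B ->
  sigma_mx (G i) (herm_coord (G i) jk @^-1` B).
Proof.
move=> mB; apply: sub_sigma_algebra.
(* Below the diagonal the coordinate is the imaginary part of the entry with exchanged indices. *)
exists ((jk.1 <= jk.2)%N, (if (jk.1 <= jk.2)%N then jk else (jk.2, jk.1))) => //.
exists B => //; rewrite /herm_coord /=.
by case: ifP.
Qed.

Lemma gue_coord_independent (B : K -> set R) : (forall k, measurable (B k)) ->
  P [set w | forall k, B k (gue_coord k w)] = (\prod_k P (gue_coord k @^-1` B k))%E.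
Proof.
move=> mB.
pose E i := \bigcap_(jk in [set: 'I_M * 'I_M]) (herm_coord (G i) jk @^-1` B (i, jk)).
have mE i : sigma_mx (G i) (E i).
  rewrite /E -[sigma_mx _]/(@measurable _ (g_sigma_algebraType _)).
  apply: fin_bigcap_measurable; first exact: finite_finset.
  by move=> jk _; exact: sigma_mx_coord.
have -> : [set w | forall k, B k (gue_coord k w)] = \bigcap_(i in [set` (finset.setTfor 'I_n)]) E i.
  apply/seteqP; split=> [w h i _ jk _ /=|w h [i jk] /=]; first exact: (h (i, jk)).
  by apply: (h i) => //=; rewrite inE.
rewrite (proj2 G_GUE)//.
rewrite (eq_bigr (fun i => \prod_jk P (herm_coord (G i) jk @^-1` B (i, jk))))%E; last first.
  move=> i _; have [_ _ _ hi] := (proj1 G_GUE) i.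
  have := hi (finset.setTfor ('I_M * 'I_M)%type) (fun jk => herm_coord (G i) jk @^-1` B (i, jk)).
  rewrite (_ : \bigcap_(_ in _) _ = E i); last first.
    by congr bigcap; apply/seteqP; split=> x //= _; rewrite inE.
  move=> ->.
    by apply: eq_bigl => jk; rewrite inE.
  move=> jk; apply: sub_sigma_algebra; exists tt => //; exists (B (i, jk)) => //.
rewrite (eq_bigl xpredT); last by move=> i; rewrite inE.
rewrite pair_bigA /=; apply: eq_bigr => -[i jk] _ //.
Qed.

End gue_independence.

(** * Quadratic form and Frobenius norm of the random matrix *)

Section model.
Context {R : realType} {n N M : nat}.
Local Notation C := R[i].
Variables (A0 : 'M[C]_N) (A : 'I_n -> 'M[C]_N).
Hypothesis A0_herm : A0 \is hermsymmx.
Hypothesis A_herm : forall i, A i \is hermsymmx.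
Local Notation K := ('I_n * ('I_M * 'I_M))%type.

Lemma sum_herm p (I : finType) (B : I -> 'M[C]_p) :
  (forall i, B i \is hermsymmx) -> \sum_i B i \is hermsymmx.
Proof.
by move=> hB; apply/hermE; rewrite adj_sum; apply: eq_bigr => i _; exact/hermE.
Qed.

Lemma scale_herm p (a : R) (B : 'M[C]_p) :
  B \is hermsymmx -> a%:C *: B \is hermsymmx.
Proof. by move=> /hermE hB; apply/hermE; rewrite adjZ hB. Qed.

Lemma model_herm (G : 'I_n -> 'M[C]_M) : (forall i, G i \is hermsymmx) ->
  gaussian_model A0 A G \is hermsymmx.
Proof.
move=> hG; apply: hermD; first by apply: tens_herm => //; apply/hermE; exact: adj1.
by apply: scale_herm; apply: sum_herm => i; exact: tens_herm.
Qed.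

Lemma ip_tens (B : 'M[C]_N) (D : 'M[C]_M) (V : 'M[C]_(N, M)) :
  B \is hermsymmx ->
  ip (tvec V) ((B *t D) *m tvec V) = ip ((V^t* *m B *m V)^T) D.
Proof.
move=> hB; rewrite tens_tvec ip_tvec -ip_trC; apply: ip_tr_eq.
by have /hermE -> := compress_herm V hB; rewrite !mulmxA.
Qed.

Lemma ip_model (G : 'I_n -> 'M[C]_M) (J : finType) (V : J -> 'M[C]_(N, M)) v :
  (forall i, G i \is hermsymmx) ->
  ip (tvec (V v)) (gaussian_model A0 A G *m tvec (V v)) =
  ip (V v) (A0 *m V v) + \sum_k hcoord (G k.1) k.2 * gue_coef A V k v.
Proof.
move=> hG; rewrite mulmxDl ipDr; congr (_ + _).
  by rewrite tens_tvec trmx1 mulmx1 ip_tvec.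
rewrite -scalemxAl ipZr mulmx_suml ip_sumr mulr_sumr.
rewrite [RHS](eq_bigr (fun k : K => hcoord (G k.1) k.2 * gue_coef A V (k.1, k.2) v)); last by case.
rewrite -(pair_bigA _ (fun i p => hcoord (G i) p * gue_coef A V (i, p) v))/=.
apply: eq_bigr => i _; rewrite ip_tens// ip_hcoord//; last first.
  exact/tr_herm/compress_herm.
by rewrite mulr_sumr; apply: eq_bigr => p _; rewrite /gue_coef/=; ring.
Qed.

(** A crude bound, used only to integrate the net error. The mesh is chosen after [c], so the
    dependence on the dimensions is harmless. *)
Lemma frob_model (lam : R) : exists2 c : R, 0 <= c &
  forall G : 'I_n -> 'M[C]_M, (forall i, G i \is hermsymmx) ->
  frob (gaussian_model A0 A G - lam%:C%:M) <=
  c * (1 + \sum_(k : K) hcoord (G k.1) k.2 ^+ 2).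
Proof.
pose a := frob (A0 *t (1%:M : 'M[C]_M) - lam%:C%:M).
pose b := \sum_i frob (A i).
have a0 : 0 <= a := frob_ge0 _.
have b0 : 0 <= b by apply: sumr_ge0 => i _; exact: frob_ge0.
have [t [t0 tE]] : exists t : R, 0 <= t /\ t = (Num.sqrt M%:R)^-1 ^+ 2.
  by eexists; split; last reflexivity; exact: sqr_ge0.
pose q : R := t * n%:R.
have q0 : 0 <= q by rewrite mulr_ge0.
exists (2 * a + 2 * (q * (2 * b))).
  by rewrite addr_ge0 ?mulr_ge0.
move=> G hG; set s := \sum_k _.
have s0 : 0 <= s by apply: sumr_ge0 => k _; exact: sqr_ge0.
have hs i : frob (G i) <= 2 * s.
  rewrite /frob ip_hcoord// /s.
  rewrite [in leRHS](eq_bigr (fun k : K => hcoord (G k.1) k.2 ^+ 2))//.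
  rewrite -(pair_bigA _ (fun i p => hcoord (G i) p ^+ 2))/= (bigD1 i)//= mulrDr mulr_sumr.
  rewrite -[leLHS]addr0; apply: lerD; last first.
    by rewrite mulr_ge0//; apply: sumr_ge0 => j _; apply: sumr_ge0 => p _; exact: sqr_ge0.
  apply: ler_sum => p _; rewrite -expr2 ler_wpM2r ?sqr_ge0// /hweight.
  by case: ifP => // _; rewrite ler1n.
rewrite /gaussian_model addrAC; apply: (le_trans (frob_add_le _ _)).
have h : frob (((Num.sqrt M%:R)^-1)%:C *: \sum_i A i *t G i) <= q * (2 * b) * s.
  rewrite frobZ -tE (_ : q * (2 * b) * s = t * (n%:R * (b * (2 * s)))); last first.
    by rewrite /q; ring.
  apply: ler_wpM2l => //.
  apply: (le_trans (frob_sum_le _)); rewrite card_ord; apply: ler_wpM2l => //.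
  rewrite /b mulr_suml; apply: ler_sum => i _.
  by rewrite frob_tens; apply: ler_wpM2l; [exact: frob_ge0|exact: hs].
rewrite -/a; move: h; set f := frob _; set qb := q * (2 * b).
have : 0 <= qb by rewrite mulr_ge0 ?mulr_ge0.
move=> qb0 h; have := mulr_ge0 qb0 s0; have := mulr_ge0 a0 s0.
by move: h qb0 a0 s0; clear; move: f s a qb => *; lra.
Qed.

End model.

Section core.
Context d (T : measurableType d) (R : realType) (P : probability T R).
Local Notation C := R[i].
Variables (n N M r : nat) (A0 : 'M[C]_N) (A : 'I_n -> 'M[C]_N).
Variables (At : 'I_r -> 'M[C]_N) (G : 'I_n -> T -> 'M[C]_M).
Hypothesis r_gt0 : (0 < r)%N.
Hypothesis N_gt0 : (0 < N)%N.
Hypothesis M_gt0 : (0 < M)%N.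
Hypothesis A0_herm : A0 \is hermsymmx.
Hypothesis A_herm : forall i, A i \is hermsymmx.
Hypothesis At_psd : forall j, possemidefmx (At j).
Hypothesis etaE : forall X, eta A X = eta At X.
Hypothesis G_GUE : independent_GUE P G.
Local Notation K := ('I_n * ('I_M * 'I_M))%type.
Local Notation H w := (gaussian_model A0 A (fun i => G i w)).
Local Notation err :=
  (Num.sqrt (r%:R * N%:R / M%:R) * Num.sqrt (opnorm (eta A 1%:M)) : R).
Local Notation X := (gue_coord G).
Local Notation Pint f := (P.-integrable setT (EFin \o f)).

(* An integrable majorant replaces the expectation of the positive part of
   lambda_max (H w) - lambda_max (A0 + Z + eta A Z^-1), whose measurability is
   thus never needed. *)
Lemma lambda_max_majorant (Z : 'M[C]_N) (dl : R) : posdefmx Z -> 0 < dl ->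
  exists U : T -> R, [/\ Pint U, forall w, 0 <= U w,
    forall w, lambda_max (H w) <= lambda_max (A0 + Z + eta A (invmx Z)) + U w &
    Rintegral P setT U <= 9 / 2 * err + dl].
Proof.
move=> Z_pos dl0; set lam := lambda_max (A0 + _ + _).
have hG w i : G i w \is hermsymmx by have [] := (proj1 G_GUE) i.
have hH w : H w \is hermsymmx by apply: model_herm.
have Xg := gue_coord_gaussian G_GUE; have Xi := gue_coord_independent G_GUE.
have sd0 := @gue_sd_gt0 R n M.
have [c c0 hc] := @frob_model R n N M A0 A lam.
pose S w := 1 + c * (1 + \sum_k X k w ^+ 2).
have iX : Pint (fun w => \sum_k X k w ^+ 2).
  by apply: P_integrable_sum => k; exact: P_integrable_sqr sd0 Xg k.
have iS : Pint S.
  apply: P_integrableD; first exact: P_integrable_cst.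
  by apply: P_integrableZ; apply: P_integrableD => //; exact: P_integrable_cst.
have S0 w : 0 <= S w.
  by rewrite addr_ge0// mulr_ge0// addr_ge0//; apply: sumr_ge0 => k _; exact: sqr_ge0.
pose e := Rintegral P setT S.
have e0 : 0 <= e by apply: Rintegral_ge0 => // w _; exact: S0.
(* The net error is at most the mesh times [S], whose mean is e. With this mesh its mean is dl e /
   (e + 1) <= dl. *)
have eta0 : 0 < dl / (e + 1) by rewrite divr_gt0// ltr_wpDl.
have [J [j0 [V [V0 V1 Vn]]]] := @matrix_net R N M _ eta0.
pose x0 v := ip (V v) (A0 *m V v) - lam * frob (V v).
pose F w := maxF j0 (fun v => x0 v + \sum_k X k w * gue_coef A V k v).
have FE w v : x0 v + \sum_k X k w * gue_coef A V k v =
    ip (tvec (V v)) ((H w - lam%:C%:M) *m tvec (V v)).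
  rewrite mulmxBl mul_scalar_mx ipBr ipZr -/(frob _) [frob _]ip_tvec ip_model//.
  by rewrite /x0 addrAC.
have iF : Pint F.
  have := integrable_walk (gue_coef A V) sd0 Xg (enum {: K}) x0 (lipschitz_maxF j0)
    (measurable_cst (1 : R)) _.
  have h1 : forall w : T, `|1 : R| <= 1 by move=> _; rewrite normr1.
  move=> /(_ h1); apply: eq_integrable => // w _ /=; rewrite mul1r; congr (maxF _ _)%:E.
  by apply/funext => v; rewrite /walk big_enum.
exists (fun w => F w + dl / (e + 1) * S w); split.
- by apply: P_integrableD => //; exact: P_integrableZ.
- move=> w; apply: addr_ge0; last by rewrite mulr_ge0// ltW.
  (* The net contains 0, where the quadratic form vanishes. *)
  apply: le_trans (le_maxF j0 _ j0); rewrite FE V0.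
  by rewrite (_ : tvec 0 = 0) ?ip0l//; apply/colP => k; rewrite !mxE.
- move=> w; have NM0 : (0 < N * M)%N by rewrite muln_gt0 N_gt0.
  have [v [v1 <-]] := lambda_max_attained NM0 (hH w).
  have [W vW] := tvec_surj v; have W1 : frob W <= 1 by rewrite -v1 vW [frob (tvec _)]ip_tvec.
  have [j Wj] := Vn W W1.
  have tB : tvec W - tvec (V j) = tvec (W - V j).
    by apply/colP => k; rewrite !mxE.
  have := @ip_herm_lip R _ _ (H w - lam%:C%:M) (tvec W) (tvec (V j)) _ (ltW eta0).
  rewrite tB [frob (tvec W)]ip_tvec [frob (tvec (V j))]ip_tvec [frob (tvec (W - _))]ip_tvec.
  move=> /(_ W1 (V1 j) Wj).
  have -> : ip (tvec W) ((H w - lam%:C%:M) *m tvec W) = ip v (H w *m v) - lam.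
    by rewrite -vW mulmxBl mul_scalar_mx ipBr ipZr -/(frob _) v1 mulr1.
  rewrite -FE lerBlDl => /le_trans; apply; rewrite lerD2l; apply: lerD.
    exact: (le_maxF j0 (fun v => x0 v + \sum_k X k w * gue_coef A V k v) j).
  apply: ler_wpM2l; first exact: ltW.
  by rewrite /S lerD2l; exact: hc.
- rewrite RintegralD//; last exact: P_integrableZ.
  rewrite RintegralZl//; apply: lerD.
    rewrite (EP_walk _ sd0 Xg Xi x0 (lipschitz_maxF j0)).
    exact: (@gue_comparison R n r N M A0 A At r_gt0 N_gt0 M_gt0 A0_herm A_herm At_psd etaE J j0 V V1 Z Z_pos).
  rewrite [X in _ * X](_ : _ = e)// mulrAC ler_pdivrMr ?ltr_wpDl//.
  by rewrite ler_wpM2l ?ltW// ltrDl.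
Qed.

End core.

Section expectation.
Context d (T : measurableType d) (R : realType) (P : probability T R).
Local Notation Pint f := (P.-integrable setT (EFin \o f)).

(* No measurability is assumed: the integral of a nonnegative function is a
   supremum over the simple functions below it. *)
Lemma le_expectation (f g : T -> R) : (forall w, f w <= g w) ->
  ('E_P[f] <= 'E_P[g])%E.
Proof.
move=> fg; rewrite unlock /integral; apply: leeB; apply: ereal_sup_le => _ [h hf <-];
  exists h => // w; apply: (le_trans (hf w)); rewrite ?funeposE ?funenegE !patchE !in_setT.
  by rewrite ge_max !le_max lee_fin fg lexx orbT.
by rewrite ge_max !le_max leeN2 lee_fin fg lexx orbT.
Qed.

Lemma expectation_le (f g : T -> R) (c : R) : (forall w, f w <= g w) ->
  Pint g -> Rintegral P setT g <= c -> ('E_P[f] <= c%:E)%E.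
Proof.
move=> fg ig gc; apply: (le_trans (le_expectation fg)).
rewrite unlock -[X in (X <= _)%E]fineK ?lee_fin//.
exact: integrable_fin_num.
Qed.

Lemma expectation_ge (f g : T -> R) (c : R) : (forall w, g w <= f w) ->
  Pint g -> c <= Rintegral P setT g -> (c%:E <= 'E_P[f])%E.
Proof.
move=> gf ig gc; apply: le_trans (le_expectation gf).
rewrite unlock -[X in (_ <= X)%E]fineK ?lee_fin//.
exact: integrable_fin_num.
Qed.

Lemma RintegralDc (f : T -> R) c : Pint f ->
  Rintegral P setT (fun w => c + f w) = c + Rintegral P setT f.
Proof.
move=> fi; rewrite RintegralD//; last exact: P_integrable_cst.
by rewrite Rintegral_cst// [X in fine X]probability_setT mulr1.
Qed.

End expectation.

(** * The quantities rho and their behaviour under change of sign *)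

Section rho.
Context {R : realType} {n N : nat}.
Local Notation C := R[i].
Variables (A0 : 'M[C]_N) (A : 'I_n -> 'M[C]_N).

Lemma etaN (X : 'M[C]_N) : eta (fun i => - A i) X = eta A X.
Proof. by apply: eq_bigr => i _; rewrite mulmxN !mulNmx opprK. Qed.

Lemma posdefN (Z : 'M[C]_N) : negdefmx Z <-> posdefmx (- Z).
Proof.
have E v : quad_form (- Z) v = - quad_form Z v.
  by rewrite /quad_form mulmxN mulNmx mxE.
split=> -[hZ h]; split.
- exact: hermN.
- by move=> v v0; rewrite E oppr_gt0; exact: h.
- by rewrite -[Z]opprK; exact: hermN.
- by move=> v v0; rewrite -oppr_gt0 -E; exact: h.
Qed.

Lemma posdef1 : posdefmx (1%:M : 'M[C]_N).
Proof.
split; first by apply/hermE; exact: adj1.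
move=> v v0; rewrite /quad_form mulmx1 lt_neqAle; apply/andP; split; last first.
  rewrite mxE; apply: sumr_ge0 => i _; rewrite adjE mulrC; exact: mul_conjC_ge0.
apply/eqP => h; move/eqP: v0; apply; apply: frob_eq0.
by rewrite /frob /ip /mxtrace big_ord1 -h.
Qed.

Lemma invmxN (Z : 'M[C]_N) : invmx (- Z) = - invmx Z.
Proof.
have [Zu|Zu] := boolP (Z \in unitmx).
  have NZu : - Z \in unitmx by rewrite -scaleN1r unitmxZ// unitrN1.
  by rewrite -scaleN1r invmxZ ?scaleN1r// invrN1 scaleN1r.
(* Outside the invertible matrices [invmx] returns its argument, so the identity persists. *)
have NZu : - Z \notin unitmx.
  by apply: contra Zu => h; rewrite -[Z]opprK -scaleN1r unitmxZ// unitrN1.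
by rewrite !invmx_out.
Qed.

Definition lambda_at (A0 : 'M[C]_N) (A : 'I_n -> 'M[C]_N) (Z : 'M[C]_N) : R :=
  lambda_max (A0 + Z + eta A (invmx Z)).

Lemma rho_minusE : rho_minus A0 A = - rho_plus (- A0) (fun i => - A i).
Proof.
rewrite /rho_plus /inf opprK; congr sup; apply/seteqP; split=> x /=.
  move=> [Z /posdefN Zp <-]; exists (lambda_at (- A0) (fun i => - A i) (- Z)).
    by exists (- Z).
  rewrite lambda_minE /lambda_at etaN invmxN; congr (- lambda_max _).
  rewrite !opprD; congr (_ + _ + _).
  by rewrite -sumrN; apply: eq_bigr => i _; rewrite mulmxN mulNmx.
move=> [y [Z Zp <-] <-]; exists (- Z); first by apply/posdefN; rewrite opprK.
rewrite lambda_minE invmxN; congr (- lambda_max _).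
rewrite !opprD !opprK; congr (_ + _ + _).
rewrite -sumrN; apply: eq_bigr => i _.
by rewrite !mulNmx !mulmxN !mulNmx opprK.
Qed.

(** With V = Z Y and Z = E^* E, the form equals |E Y|^2. *)
Lemma ip_inv_ge0 (Z : 'M[C]_N) p (V : 'M[C]_(N, p)) : posdefmx Z ->
  0 <= ip V (invmx Z *m V).
Proof.
move=> Zp; have [Zu [E ZE]] := posdef_factor Zp.
rewrite -{1}[V](mulKVmx Zu); move: (invmx Z *m V) => Y.
by rewrite ZE -mulmxA ip_mull trmxCK -/(frob _) frob_ge0.
Qed.

(** Bounds from below the set defining [rho_plus], so that its [inf] is a genuine infimum and can be
    approached by some Z. *)
Lemma lambda_at_ge (Z : 'M[C]_N) : (0 < N)%N -> A0 \is hermsymmx ->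
  (forall i, A i \is hermsymmx) -> posdefmx Z -> lambda_max A0 <= lambda_at A0 A Z.
Proof.
move=> N0 hA0 hA Zp; have [v [v1 <-]] := lambda_max_attained N0 hA0.
have := @lambda_max_ge _ _ _ _ v (hermD (hermD hA0 Zp.1)
   (eta_herm hA (herm_inv Zp.1))).
rewrite v1 mulr1 => /(le_trans _); apply.
rewrite !mulmxDl !ipDr -addrA lerDl; apply: addr_ge0.
  have [_ [E ->]] := posdef_factor Zp.
  by rewrite -mulmxA -{1}[E]trmxCK -ip_mull trmxCK; exact: frob_ge0.
rewrite /eta mulmx_suml ip_sumr; apply: sumr_ge0 => i _.
have /hermE hi := hA i.
by rewrite -!mulmxA -{1}hi -ip_mull; exact: ip_inv_ge0.
Qed.

Lemma has_inf_rho : (0 < N)%N -> A0 \is hermsymmx ->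
  (forall i, A i \is hermsymmx) ->
  has_inf [set lambda_at A0 A Z | Z in [set Z : 'M[C]_N | posdefmx Z]].
Proof.
move=> N0 hA0 hA; split.
  by exists (lambda_at A0 A 1%:M); exists 1%:M => //; exact: posdef1.
by exists (lambda_max A0) => _ [Z Zp <-]; exact: lambda_at_ge.
Qed.

Lemma rho_plus_adherent (e : R) : 0 < e -> (0 < N)%N -> A0 \is hermsymmx ->
  (forall i, A i \is hermsymmx) ->
  exists2 Z, posdefmx Z & lambda_at A0 A Z <= rho_plus A0 A + e.
Proof.
move=> e0 N0 hA0 hA.
have [_ [Z Zp <-] h] := inf_adherent e0 (has_inf_rho N0 hA0 hA).
by exists Z => //; exact: ltW.
Qed.

End rho.

Section psd_family.
Context {R : realType} {N r : nat}.
Local Notation C := R[i].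

Lemma opnorm0 : opnorm (0 : 'M[C]_N) = 0.
Proof.
have h0 : (0 : 'M[C]_N) \is hermsymmx.
  by apply/hermE; apply/matrixP => i j; rewrite !mxE rmorph0.
apply/eqP; rewrite eq_le opnorm_ge0// andbT; apply: ge_sup.
  by exists (euclid_norm ((0 : 'M[C]_N) *m 0)); exists 0 => //=;
    rewrite euclid_normE /frob ip0l sqrtr0.
by move=> _ [v _ <-]; rewrite mul0mx euclid_normE /frob ip0l sqrtr0.
Qed.

Lemma possemidef0 : possemidefmx (0 : 'M[C]_N).
Proof.
split; first by apply/hermE; apply/matrixP => i j; rewrite !mxE rmorph0.
by move=> v; rewrite /quad_form mulmx0 mul0mx mxE.
Qed.

End psd_family.

Section opposite.
Context {R : realType} {n N M : nat}.
Local Notation C := R[i].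

Lemma gaussian_modelN (A0 : 'M[C]_N) (A : 'I_n -> 'M[C]_N) (G : 'I_n -> 'M[C]_M) :
  - gaussian_model A0 A G = gaussian_model (- A0) (fun i => - A i) G.
Proof.
have tN (B : 'M[C]_N) (D : 'M[C]_M) : - (B *t D) = (- B) *t D.
  by apply/matrixP => i j; rewrite !mxE mulNr.
rewrite /gaussian_model opprD tN -scalerN -sumrN; congr (_ + _ *: _).
by apply: eq_bigr => i _; rewrite tN.
Qed.

End opposite.

(** * Bounds for the expectations *)

Section bounds.
Context d (T : measurableType d) (R : realType) (P : probability T R).
Local Notation C := R[i].
Variables (n N M r : nat) (A0 : 'M[C]_N) (A : 'I_n -> 'M[C]_N).
Variables (At : 'I_r -> 'M[C]_N) (G : 'I_n -> T -> 'M[C]_M).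
Hypothesis N_gt0 : (0 < N)%N.
Hypothesis M_gt0 : (0 < M)%N.
Hypothesis A0_herm : A0 \is hermsymmx.
Hypothesis A_herm : forall i, A i \is hermsymmx.
Hypothesis At_psd : forall j, possemidefmx (At j).
Hypothesis etaE : forall X, eta A X = eta At X.
Hypothesis G_GUE : independent_GUE P G.
Local Notation H w := (gaussian_model A0 A (fun i => G i w)).
Local Notation err :=
  (Num.sqrt (r%:R * N%:R / M%:R) * Num.sqrt (opnorm (eta A 1%:M)) : R).
Local Notation Pint f := (P.-integrable setT (EFin \o f)).

(* For an empty family, [eta = 0] and the one-element family [0] serves instead. *)
Lemma lambda_max_majorant_any (Z : 'M[C]_N) (dl : R) : posdefmx Z -> 0 < dl ->
  exists U : T -> R, [/\ Pint U, forall w, 0 <= U w,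
    forall w, lambda_max (H w) <= lambda_at A0 A Z + U w &
    Rintegral P setT U <= 9 / 2 * err + dl].
Proof.
move=> Zp dl0; have [r0|r_gt0] := posnP r; last first.
  exact: (lambda_max_majorant r_gt0 N_gt0 M_gt0 A0_herm A_herm At_psd etaE G_GUE).
have eta0 X : eta A X = 0.
  by rewrite etaE /eta big1// => j _; have := ltn_ord j; rewrite [X in (_ < X)%N]r0.
have := @lambda_max_majorant _ _ _ P n N M 1 A0 A (fun=> 0) G (ltn0Sn 0) N_gt0 M_gt0
  A0_herm A_herm (fun=> possemidef0) _ G_GUE Z dl Zp dl0.
rewrite (eta0 1%:M) opnorm0 sqrtr0 !mulr0; apply.
by move=> X; rewrite eta0; apply/esym; rewrite /eta big1// => j _; rewrite mul0mx mul0mx.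
Qed.


Lemma expectation_lambda_max :
  ('E_P[fun w => lambda_max (H w)] <= (rho_plus A0 A + 9 / 2 * err)%:E)%E.
Proof.
apply/lee_addgt0Pr => e e0; have e2 : 0 < e / 2 by rewrite divr_gt0.
have [Z Zp hZ] := rho_plus_adherent e2 N_gt0 A0_herm A_herm.
have [U [iU U0 hU EU]] := lambda_max_majorant_any Zp e2.
apply: (expectation_le hU); first by apply: P_integrableD => //; exact: P_integrable_cst.
rewrite RintegralDc//; move: hZ EU; move: (lambda_at _ _ _) (rho_plus _ _) err => l p q.
by move: (Rintegral _ _ _) => u; lra.
Qed.

End bounds.

Section conclusion.
Context d (T : measurableType d) (R : realType) (P : probability T R).
Local Notation C := R[i].
Variables (n N M r : nat) (A0 : 'M[C]_N) (A : 'I_n -> 'M[C]_N).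
Variables (At : 'I_r -> 'M[C]_N) (G : 'I_n -> T -> 'M[C]_M).
Hypothesis N_gt0 : (0 < N)%N.
Hypothesis M_gt0 : (0 < M)%N.
Hypothesis A0_herm : A0 \is hermsymmx.
Hypothesis A_herm : forall i, A i \is hermsymmx.
Hypothesis At_psd : forall j, possemidefmx (At j).
Hypothesis etaE : forall X, eta A X = eta At X.
Hypothesis G_GUE : independent_GUE P G.
Local Notation H w := (gaussian_model A0 A (fun i => G i w)).
Local Notation err :=
  (Num.sqrt (r%:R * N%:R / M%:R) * Num.sqrt (opnorm (eta A 1%:M)) : R).
Local Notation Pint f := (P.-integrable setT (EFin \o f)).

Let NA0_herm : - A0 \is hermsymmx. Proof. exact: hermN. Qed.
Let NA_herm i : - A i \is hermsymmx. Proof. exact: hermN. Qed.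
Let NetaE X : eta (fun i => - A i) X = eta At X. Proof. by rewrite etaN. Qed.

Lemma lambda_min_minorant (e : R) : 0 < e -> exists U : T -> R,
  [/\ Pint U, forall w, 0 <= U w,
      forall w, lambda_max (- H w) <= - rho_minus A0 A + e + U w &
      Rintegral P setT U <= 9 / 2 * err + e].
Proof.
move=> e0; have [Z Zp hZ] := rho_plus_adherent e0 N_gt0 NA0_herm NA_herm.
have [U [iU U0 hU EU]] :=
  lambda_max_majorant_any N_gt0 M_gt0 NA0_herm NA_herm At_psd NetaE G_GUE Zp e0.
rewrite etaN in EU; exists U; split; [exact: iU | exact: U0 | move=> w | exact: EU].
by rewrite gaussian_modelN rho_minusE opprK; apply: (le_trans (hU w)); rewrite lerD2r.
Qed.

Lemma expectation_lambda_min :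
  ((rho_minus A0 A - 9 / 2 * err)%:E <= 'E_P[fun w => lambda_min (H w)])%E.
Proof.
apply/lee_addgt0Pr => e e0; have e2 : 0 < e / 2 by rewrite divr_gt0.
have [U [iU U0 hU EU]] := lambda_min_minorant e2.
rewrite -leeBlDr// -EFinB.
apply: (@expectation_ge _ _ _ _ _
  (fun w => (rho_minus A0 A - e / 2) + -1 * U w)) => [w||].
- rewrite lambda_minE; have := hU w.
  by move: (lambda_max _) (rho_minus _ _) => a b; lra.
- by apply: P_integrableD; [exact: P_integrable_cst | exact: P_integrableZ].
- rewrite RintegralDc; last exact: P_integrableZ.
  rewrite RintegralZl//; move: EU.
  by move: (Rintegral _ _ _) (rho_minus _ _) err => u a q; lra.
Qed.

Lemma expectation_opnorm :
  ('E_P[fun w => opnorm (H w)] <= (rho_star A0 A + 9 * err)%:E)%E.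
Proof.
apply/lee_addgt0Pr => e e0; have e3 : 0 < e / 3 by rewrite divr_gt0.
have [Z Zp hZ] := rho_plus_adherent e3 N_gt0 A0_herm A_herm.
have [U [iU U0 hU EU]] :=
  lambda_max_majorant_any N_gt0 M_gt0 A0_herm A_herm At_psd etaE G_GUE Zp e3.
have [U' [iU' U'0 hU' EU']] := lambda_min_minorant e3.
(* Since U and U' are nonnegative, their sum dominates both errors at once. The cost is 9/2 + 9/2 =
   9, and the three parts e/3 come from rho and from the two means. *)
apply: (@expectation_le _ _ _ _ _
  (fun w => (rho_star A0 A + e / 3) + (U w + U' w))) => [w||].
- have hH : H w \is hermsymmx.
    by apply: model_herm => // i; have [] := (proj1 G_GUE) i.
  have h1 : rho_plus A0 A <= rho_star A0 A by rewrite le_max lexx.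
  have h2 : - rho_minus A0 A <= rho_star A0 A by rewrite le_max lexx orbT.
  have a := hU w; have b := hU' w; have u := U0 w; have u' := U'0 w.
  apply: opnorm_le_max => //; rewrite ?muln_gt0 ?N_gt0//.
    move: h1 hZ a; move: (lambda_max _) (lambda_at _ _ _) (rho_plus _ _) (rho_star _ _).
    by move=> *; lra.
  rewrite lambda_minE lerN2.
  move: h2 b; move: (lambda_max _) (rho_minus _ _) (rho_star _ _).
  by move=> *; lra.
- by apply: P_integrableD; [exact: P_integrable_cst | exact: P_integrableD].
- rewrite RintegralDc; last exact: P_integrableD.
  rewrite RintegralD//; move: EU EU'.
  move: (Rintegral _ _ U) (Rintegral _ _ U') (rho_star _ _) err.
  by move=> *; lra.
Qed.

End conclusion.

Theorem theorem8p4 (R : realType) (d : measure_display) (T : measurableType d)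
    (P : probability T R) (n N M : nat)
    (n_ge1 : (1 <= n)%N) (N_ge1 : (1 <= N)%N) (M_ge1 : (1 <= M)%N)
    (le_NM : (N <= M)%N)
    (A0 : 'M[R[i]]_N) (A : 'I_n -> 'M[R[i]]_N)
    (A0_herm : A0 \is hermsymmx) (A_herm : forall i, A i \is hermsymmx)
    (G : 'I_n -> T -> 'M[R[i]]_M) (G_GUE : independent_GUE P G)
    (r : nat) (At : 'I_r -> 'M[R[i]]_N)
    (At_psd : forall j, possemidefmx (At j))
    (etaE : forall X : 'M[R[i]]_N, eta A X = \sum_(j < r) At j *m X *m At j) :
  let H : T -> 'M[R[i]]_(N * M) :=
    fun w => gaussian_model A0 A (fun i => G i w) in
  let err : R :=
    Num.sqrt (r%:R * N%:R / M%:R) * Num.sqrt (opnorm (eta A 1%:M)) in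
  [/\ ('E_P[fun w => lambda_max (H w)] <= (rho_plus A0 A + 6 * err)%:E)%E,
      ('E_P[fun w => lambda_min (H w)] >= (rho_minus A0 A - 6 * err)%:E)%E &
      ('E_P[fun w => opnorm (H w)] <= (rho_star A0 A + 9 * err)%:E)%E].
Proof.
move=> H err; have err0 : 0 <= err := mulr_ge0 (sqrtr_ge0 _) (sqrtr_ge0 _).
have h6 : 9 / 2 * err <= 6 * err by apply: ler_wpM2r => //; lra.
split.
- apply: (le_trans (expectation_lambda_max N_ge1 M_ge1 A0_herm A_herm At_psd etaE G_GUE)).
  by rewrite lee_fin lerD2l.
- apply: le_trans (expectation_lambda_min N_ge1 M_ge1 A0_herm A_herm At_psd etaE G_GUE).
  by rewrite lee_fin lerD2l lerN2.
- exact: (expectation_opnorm N_ge1 M_ge1 A0_herm A_herm At_psd etaE G_GUE).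
Qed.
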